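(* Let $u:\mathbb{R}^n\times[0,\infty)\to\mathbb{R}$ be a (continuous, bounded) viscosity solution, in the sense of Evans–Spruck defined below, of the level set mean curvature flow $$u_t=\Big(\delta_{ij}-\frac{D_iuD_ju}{|Du|^2}\Big)D_iD_ju,$$ with initial data $u(\cdot,0)=g$, where $g:\mathbb{R}^n\to\mathbb{R}$ is continuous and constant on $\{x\in\mathbb{R}^n:|x|\ge S\}$ for some $S>0$. Define $$\omega(s,t)=\sup\Big\{\tfrac{u(y,t)-u(x,t)}{2}\;:\;x,y\in\mathbb{R}^n,\ \tfrac{|y-x|}{2}=s\Big\}.$$ Then $\omega$ is a viscosity subsolution of $\omega_t=\max\{0,\tfrac14(\omega''+|\omega''|)\}$ on $(0,\infty)\times(0,\infty)$; that is, whenever $\phi$ is a smooth function such that $\omega-\phi$ has a local maximum at $(s_0,t_0)$ with $s_0>0$, $t_0>0$, then at $(s_0,t_0)$ $$\phi_t\le \max\Big\{0,\tfrac14\big(\phi''+|\phi''|\big)\Big\},$$ where $'$ denotes differentiation in $s$.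
   Context: Evans–Spruck viscosity solutions of the level set mean curvature flow: a continuous bounded $u:\mathbb{R}^n\times[0,\infty)\to\mathbb{R}$ is a viscosity subsolution if for every $\varphi\in C^\infty(\mathbb{R}^{n+1})$ such that $u-\varphi$ has a local maximum at $(x_0,t_0)\in\mathbb{R}^n\times(0,\infty)$: if $D\varphi(x_0,t_0)\neq0$ then $\varphi_t\le(\delta_{ij}-\frac{D_i\varphi D_j\varphi}{|D\varphi|^2})D_iD_j\varphi$ at $(x_0,t_0)$, and if $D\varphi(x_0,t_0)=0$ then $\varphi_t\le(\delta_{ij}-\eta_i\eta_j)D_iD_j\varphi$ at $(x_0,t_0)$ for some $\eta\in\mathbb{R}^n$ with $|\eta|\le1$. It is a viscosity supersolution if the same holds with ''local minimum'' and ''$\ge$'' in place of ''local maximum'' and ''$\le$''. A viscosity solution is a continuous bounded function that is both. Summation over repeated indices is used. *)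

(* Defs.v *)
From mathcomp Require Import ssreflect ssrfun ssrbool eqtype ssrnat fintype bigop.
From Stdlib Require Import Reals.
Set Implicit Arguments. Unset Strict Implicit.
Local Open Scope R_scope.

Definition upd {I : finType} (p : I -> R) (i : I) (h : R) : I -> R :=
  fun j => if j == i then p j + h else p j.

Definition has_partial {I : finType} (F G : (I -> R) -> R) (i : I) : Prop :=
  forall p, derivable_pt_lim (fun h => F (upd p i h)) 0 (G p).

Definition contR {I : finType} (F : (I -> R) -> R) : Prop :=
  forall p eps, 0 < eps -> exists del, 0 < del /\
    forall q, (forall j, Rabs (q j - p j) < del) -> Rabs (F q - F p) < eps.

Fixpoint Ck {I : finType} (k : nat) (F : (I -> R) -> R) : Prop :=
  match k with
  | O => contR F
  | S k' => contR F /\ forall i, exists G, has_partial F G i /\ Ck k' G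
  end.

Definition smooth {I : finType} (F : (I -> R) -> R) : Prop := forall k, Ck k F.

Definition sumI (n : nat) (f : 'I_n -> R) : R := \big[Rplus/0]_(i < n) f i.

Definition vnorm (n : nat) (x : 'I_n -> R) : R := sqrt (sumI (fun i => x i ^ 2)).

Definition vsub (n : nat) (x y : 'I_n -> R) : 'I_n -> R := fun i => x i - y i.

Definition kdelta (n : nat) (i j : 'I_n) : R := if i == j then 1 else 0.

Definition st (n : nat) (x : 'I_n -> R) (t : R) : option 'I_n -> R :=
  fun d => match d with Some i => x i | None => t end.

Definition loc_max_st (n : nat) (u : ('I_n -> R) -> R -> R)
  (phi : (option 'I_n -> R) -> R) (x0 : 'I_n -> R) (t0 : R) : Prop :=
  exists r, 0 < r /\ forall x t, 0 <= t -> vnorm (vsub x x0) < r -> Rabs (t - t0) < r ->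
    u x t - phi (st x t) <= u x0 t0 - phi (st x0 t0).

Definition loc_min_st (n : nat) (u : ('I_n -> R) -> R -> R)
  (phi : (option 'I_n -> R) -> R) (x0 : 'I_n -> R) (t0 : R) : Prop :=
  exists r, 0 < r /\ forall x t, 0 <= t -> vnorm (vsub x x0) < r -> Rabs (t - t0) < r ->
    u x t - phi (st x t) >= u x0 t0 - phi (st x0 t0).

(* The Evans-Spruck conditions.  Dphi d = d-th first partial of phi,
   D2phi e d = e-th partial of Dphi d, so D_i D_j phi = D2phi (Some i) (Some j). *)
Definition ES_sub_ineq (n : nat) (phit : R) (Dx : 'I_n -> R) (H : 'I_n -> 'I_n -> R) : Prop :=
  ((exists i, Dx i <> 0) ->
     phit <= sumI (fun i => sumI (fun j =>
       (kdelta i j - Dx i * Dx j / (vnorm Dx) ^ 2) * H i j))) /\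
  ((forall i, Dx i = 0) ->
     exists eta : 'I_n -> R, vnorm eta <= 1 /\
       phit <= sumI (fun i => sumI (fun j => (kdelta i j - eta i * eta j) * H i j))).

Definition ES_super_ineq (n : nat) (phit : R) (Dx : 'I_n -> R) (H : 'I_n -> 'I_n -> R) : Prop :=
  ((exists i, Dx i <> 0) ->
     phit >= sumI (fun i => sumI (fun j =>
       (kdelta i j - Dx i * Dx j / (vnorm Dx) ^ 2) * H i j))) /\
  ((forall i, Dx i = 0) ->
     exists eta : 'I_n -> R, vnorm eta <= 1 /\
       phit >= sumI (fun i => sumI (fun j => (kdelta i j - eta i * eta j) * H i j))).

Definition derivs_of (n : nat) (phi : (option 'I_n -> R) -> R)
  (Dphi : option 'I_n -> (option 'I_n -> R) -> R)
  (D2phi : option 'I_n -> option 'I_n -> (option 'I_n -> R) -> R) : Prop :=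
  (forall d, has_partial phi (Dphi d) d) /\
  (forall e d, has_partial (Dphi d) (D2phi e d) e).

Definition cont_bdd (n : nat) (u : ('I_n -> R) -> R -> R) : Prop :=
  (forall x t, 0 <= t -> forall eps, 0 < eps -> exists del, 0 < del /\
     forall y s, 0 <= s -> vnorm (vsub y x) < del -> Rabs (s - t) < del ->
       Rabs (u y s - u x t) < eps) /\
  (exists M, forall x t, 0 <= t -> Rabs (u x t) <= M).

Definition ES_subsolution (n : nat) (u : ('I_n -> R) -> R -> R) : Prop :=
  cont_bdd u /\
  forall phi, smooth phi -> forall x0 t0, 0 < t0 -> loc_max_st u phi x0 t0 ->
    forall Dphi D2phi, derivs_of phi Dphi D2phi ->
      ES_sub_ineq (Dphi None (st x0 t0)) (fun i => Dphi (Some i) (st x0 t0))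
        (fun i j => D2phi (Some i) (Some j) (st x0 t0)).

Definition ES_supersolution (n : nat) (u : ('I_n -> R) -> R -> R) : Prop :=
  cont_bdd u /\
  forall phi, smooth phi -> forall x0 t0, 0 < t0 -> loc_min_st u phi x0 t0 ->
    forall Dphi D2phi, derivs_of phi Dphi D2phi ->
      ES_super_ineq (Dphi None (st x0 t0)) (fun i => Dphi (Some i) (st x0 t0))
        (fun i j => D2phi (Some i) (Some j) (st x0 t0)).

Definition ES_solution (n : nat) (u : ('I_n -> R) -> R -> R) : Prop :=
  ES_subsolution u /\ ES_supersolution u.

Definition pt2 (s t : R) : bool -> R := fun b => if b then s else t.

Definition is_omega (n : nat) (u : ('I_n -> R) -> R -> R) (omega : R -> R -> R) : Prop :=
  forall s t, 0 <= s -> 0 <= t ->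
    is_lub (fun v => exists x y : 'I_n -> R,
              vnorm (vsub y x) / 2 = s /\ v = (u y t - u x t) / 2) (omega s t).

Definition omega_subsolution (omega : R -> R -> R) : Prop :=
  forall phi : (bool -> R) -> R, smooth phi ->
  forall s0 t0, 0 < s0 -> 0 < t0 ->
  (exists r, 0 < r /\ forall s t, 0 < s -> 0 < t -> Rabs (s - s0) < r -> Rabs (t - t0) < r ->
     omega s t - phi (pt2 s t) <= omega s0 t0 - phi (pt2 s0 t0)) ->
  forall (Dphi : bool -> (bool -> R) -> R) (D2phi : bool -> bool -> (bool -> R) -> R),
    (forall d, has_partial phi (Dphi d) d) ->
    (forall e d, has_partial (Dphi d) (D2phi e d) e) ->
    Dphi false (pt2 s0 t0) <=
      Rmax 0 (/4 * (D2phi true true (pt2 s0 t0) + Rabs (D2phi true true (pt2 s0 t0)))).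

(* Main.v *)
(** A comparison argument that needs neither the theorem on sums nor Alexandrov's theorem. Suppose
    [phi] touches [omega] from above at [(s0, t0)], so that, for [y - x] close to a vector [z0] of
    length [2 s0] and [w = y - x - z0], the difference [u y t - u x t] is at most
    [2 omega s0 t0] plus a quadratic polynomial in [(w, t - t0)], whose time slope is [2 phi_t].
    The supremum need not be attained, only approached.

    If [phi' = 0], doubling the time variable suffices: at an interior maximum of
    [u y t - u x s - quadratic - N (t - s)^2] the two test functions have spatial Hessians close to
    [(phi''/2) e e^T], and adding the inequalities for [u] and [- u] gives [2 phi_t <= max 0 phi''].

    If [phi' <> 0], then [phi_t <= 0]. Otherwise, at a time [t0 - tau], the functions [u (y0 + .)]
    and [u (x0 + .) + const] are separated by a gap [2 phi_t tau], up to a quadratic doubling error.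
    A Lasry-Lions double convolution provides a C^{1,1} function [h] between them whose gradient at
    the origin is close to [p = phi' e <> 0]. Since the gradient of [h] stays close to [p], on a
    small ball the equation is a small perturbation of the linear heat equation in the directions
    orthogonal to [p], so [h] (first averaged over small boxes, then evolved by a discrete heat
    semigroup) is a barrier for both functions, with an error [o(tau)] against the gap [2 phi_t tau].
    The discrete heat operator is linear, so the two barriers are the same function at time [t0],
    which contradicts the near-touching there. *)
Require Import Defs.
From HB Require Import structures.
From mathcomp Require Import ssreflect ssrfun ssrbool eqtype ssrnat seq fintype bigop.
From Stdlib Require Import Reals Lra Psatz FunctionalExtensionality ClassicalEpsilon Classical.
From Coquelicot Require Import Coquelicot.
Set Implicit Arguments. Unset Strict Implicit.
Local Open Scope R_scope.

(** The obstacle when [phi' <> 0] is the curvature of the distance function. Testing [u] and [- u]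
    separately, as is done when [phi' = 0], would for [phi' > 0] leave second derivatives orthogonal
    to [p] of order [phi' / s0], with the wrong sign. They cancel only when both functions are moved
    by parallel translation, which is the information that the joint matrix inequality of the
    theorem on sums would supply. Here the cancellation comes from linearity: both functions are
    compared with one and the same discrete evolution, whose Hessian then enters only through error
    terms. Since the near-maximal pair changes with the tolerance, all constants depend on [|p|] but
    not on [p] or the pair, and the tolerance is fixed only after [tau], as a fraction of the
    gap. *)

Lemma Rplus_assocM : associative Rplus.
Proof. by move=> x y z; rewrite Rplus_assoc. Qed.
HB.instance Definition _ := Monoid.isComLaw.Build R 0 Rplus Rplus_assocM Rplus_comm Rplus_0_l.

(** * Vectors *)

Section Sums.
Variable n : nat.
Implicit Types f g : 'I_n -> R.

Lemma sumI_ext f g : (forall i, f i = g i) -> sumI f = sumI g.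
Proof. by move=> h; apply: eq_bigr => i _. Qed.

Lemma sumI_add f g : sumI (fun i => f i + g i) = sumI f + sumI g.
Proof. exact: big_split. Qed.

Lemma sumI_scal a f : sumI (fun i => a * f i) = a * sumI f.
Proof.
rewrite /sumI; apply: (big_ind2 (fun x y => x = a * y)); first ring.
- by move=> x1 x2 y1 y2 -> ->; ring.
- by [].
Qed.

Lemma sumI_le f g : (forall i, f i <= g i) -> sumI f <= sumI g.
Proof.
move=> h; rewrite /sumI; apply: (big_ind2 (fun x y => x <= y)); [lra| |by move=> i _].
by move=> x1 x2 y1 y2; lra.
Qed.

Lemma sumI_const a : sumI (fun _ : 'I_n => a) = INR n * a.
Proof.
rewrite /sumI big_const card_ord.
elim: (n) => [|m IH]; first by rewrite /=; ring.
by rewrite iterS IH S_INR; ring.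
Qed.

Lemma sumI_delta f i : sumI (fun j => if j == i then f j else 0) = f i.
Proof. by rewrite /sumI -big_mkcond big_pred1_eq. Qed.

Lemma sumI_exch (F : 'I_n -> 'I_n -> R) :
  sumI (fun i => sumI (fun j => F i j)) = sumI (fun j => sumI (fun i => F i j)).
Proof. exact: exchange_big. Qed.

Lemma sumI_abs f : Rabs (sumI f) <= sumI (fun i => Rabs (f i)).
Proof.
rewrite /sumI; apply: (big_ind2 (fun x y => Rabs x <= y)).
- by rewrite Rabs_R0; lra.
- move=> x1 x2 y1 y2 h1 h2; apply: Rle_trans (Rabs_triang _ _) _; lra.
- by move=> i _; lra.
Qed.

Lemma sumI_ge_term f i : (forall j, 0 <= f j) -> f i <= sumI f.
Proof.
move=> h; rewrite -(sumI_delta f i); apply: sumI_le => j.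
by case: eqP => _; [lra|].
Qed.

Lemma sumI_bound f M : (forall i, Rabs (f i) <= M) -> Rabs (sumI f) <= INR n * M.
Proof.
move=> h; apply: Rle_trans (sumI_abs f) _; rewrite -sumI_const; exact: sumI_le.
Qed.

End Sums.

Definition vadd {n : nat} (x y : 'I_n -> R) : 'I_n -> R := fun i => x i + y i.
Definition vscal {n : nat} (a : R) (x : 'I_n -> R) : 'I_n -> R := fun i => a * x i.
Definition vzero {n : nat} : 'I_n -> R := fun _ => 0.
Definition dot {n : nat} (x y : 'I_n -> R) : R := sumI (fun i => x i * y i).
Definition ebas {n : nat} (i : 'I_n) : 'I_n -> R := fun j => if j == i then 1 else 0.
Definition qform {n : nat} (X : 'I_n -> 'I_n -> R) (y : 'I_n -> R) : R :=
  sumI (fun i => sumI (fun j => X i j * y i * y j)).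

Ltac vext := apply: functional_extensionality => ?; rewrite /vadd /vscal /vsub /vzero; ring.

Section Vectors.
Variable n : nat.
Implicit Types x y z p : 'I_n -> R.

Lemma dotC x y : dot x y = dot y x.
Proof. by apply: sumI_ext => i; ring. Qed.
Lemma dotDl x y z : dot (vadd x y) z = dot x z + dot y z.
Proof. by rewrite /dot -sumI_add; apply: sumI_ext => i; rewrite /vadd; ring. Qed.
Lemma dotDr x y z : dot z (vadd x y) = dot z x + dot z y.
Proof. by rewrite dotC dotDl !(dotC z). Qed.
Lemma dotZl a x z : dot (vscal a x) z = a * dot x z.
Proof. by rewrite /dot -sumI_scal; apply: sumI_ext => i; rewrite /vscal; ring. Qed.
Lemma dotZr a x z : dot z (vscal a x) = a * dot z x.
Proof. by rewrite dotC dotZl (dotC z). Qed.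
Lemma vsubE x y : vsub x y = vadd x (vscal (-1) y).
Proof. vext. Qed.
Lemma dotBl x y z : dot (vsub x y) z = dot x z - dot y z.
Proof. by rewrite vsubE dotDl dotZl; ring. Qed.
Lemma dotBr x y z : dot z (vsub x y) = dot z x - dot z y.
Proof. by rewrite vsubE dotDr dotZr; ring. Qed.
Lemma dot0l x : dot vzero x = 0.
Proof.
have -> : @vzero n = vscal 0 x by vext.
by rewrite dotZl; ring.
Qed.
Lemma dot0r x : dot x vzero = 0.
Proof. by rewrite dotC dot0l. Qed.

Lemma dot_ebas x i : dot x (ebas i) = x i.
Proof.
rewrite -(sumI_delta x i); apply: sumI_ext => j; rewrite /ebas; case: eqP => _; ring.
Qed.
Lemma dot_ge0 x : 0 <= dot x x.
Proof.
have <- : sumI (fun _ : 'I_n => 0) = 0 by rewrite sumI_const; ring.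
apply: sumI_le => i; nra.
Qed.

Lemma vnormE x : vnorm x = sqrt (dot x x).
Proof. by rewrite /vnorm; congr sqrt; apply: sumI_ext => i; ring. Qed.
Lemma vnorm_ge0 x : 0 <= vnorm x.
Proof. exact: sqrt_pos. Qed.
Lemma vnorm_sq x : vnorm x * vnorm x = dot x x.
Proof. by rewrite vnormE sqrt_sqrt //; apply: dot_ge0. Qed.
Lemma vnorm_le x a : 0 <= a -> dot x x <= a * a -> vnorm x <= a.
Proof. by move=> h1 h2; have := vnorm_sq x; have := vnorm_ge0 x; nra. Qed.

Lemma CS x y : Rabs (dot x y) <= vnorm x * vnorm y.
Proof.
have h : forall a b, 0 <= a*a*dot x x + 2*a*b*dot x y + b*b*dot y y.
  move=> a b; have := dot_ge0 (vadd (vscal a x) (vscal b y)).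
  rewrite !(dotDl, dotDr, dotZl, dotZr) (dotC y x); lra.
have hx := vnorm_sq x; have hy := vnorm_sq y.
have gx := vnorm_ge0 x; have gy := vnorm_ge0 y.
set X := vnorm x in hx gx *; set Y := vnorm y in hy gy *.
case: (Req_dec Y 0) => [y0|yn].
  have e0 : dot y y = 0 by nra.
  have e1 : dot x y = 0.
    have h1 := h 1 (- (dot x x + 1) * dot x y).
    have gxx := dot_ge0 x.
    rewrite e0 in h1.
    have := h (dot x y) (- (dot x x + 1)); rewrite e0; nra.
  by rewrite e1 Rabs_R0 y0; lra.
have Yp : 0 < Y by lra.
case: (Req_dec X 0) => [x0|xn].
  have e0 : dot x x = 0 by nra.
  have e1 : dot x y = 0.
    have := h (- (dot y y + 1)) (dot x y); rewrite e0.
    have gyy := dot_ge0 y; nra.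
  by rewrite e1 Rabs_R0 x0; lra.
have Xp : 0 < X by lra.
(* The weights [|y|] and [|x|], [- |x|] make both squares equal to [X^2 Y^2]; dividing by
   [2 X Y > 0] gives the two signs. *)
have h1 := h Y X; have h2 := h Y (-X).
rewrite -hx -hy in h1 h2.
have XY : 0 < X * Y by nra.
apply: Rabs_le; split; nra.
Qed.

Lemma vnorm_add x y : vnorm (vadd x y) <= vnorm x + vnorm y.
Proof.
have gx := vnorm_ge0 x; have gy := vnorm_ge0 y.
apply: vnorm_le; first lra.
rewrite !(dotDl, dotDr) (dotC y x) -!vnorm_sq.
have := CS x y; have := Rle_abs (dot x y); nra.
Qed.
Lemma vnorm_scal a x : vnorm (vscal a x) = Rabs a * vnorm x.
Proof.
rewrite !vnormE dotZl dotZr -Rmult_assoc sqrt_mult; [|nra|exact: dot_ge0].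
by congr (_ * _); rewrite -/(Rsqr a) sqrt_Rsqr_abs.
Qed.
Lemma vnorm_opp x : vnorm (vscal (-1) x) = vnorm x.
Proof. by rewrite vnorm_scal Rabs_left; lra. Qed.
Lemma vnorm_sub x y : vnorm (vsub x y) <= vnorm x + vnorm y.
Proof. by rewrite vsubE; have := vnorm_add x (vscal (-1) y); rewrite vnorm_opp. Qed.
Lemma vnorm0 : vnorm (@vzero n) = 0.
Proof. by rewrite vnormE dot0l sqrt_0. Qed.
Lemma coord_le_vnorm x i : Rabs (x i) <= vnorm x.
Proof.
have h : x i * x i <= dot x x by apply: (@sumI_ge_term n (fun j => x j * x j) i) => j; nra.
have := vnorm_sq x; have := vnorm_ge0 x.
by move=> *; apply: Rabs_le; split; nra.
Qed.
Lemma vnorm_le_sup x a : 0 <= a -> (forall i, Rabs (x i) <= a) -> vnorm x <= INR n * a.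
Proof.
move=> ha h; have hn := pos_INR n.
case: (Nat.eq_dec n 0) => [e|ne].
  have -> : vnorm x = 0; last by nra.
  rewrite /vnorm /sumI big1 ?sqrt_0 // => i; exfalso.
  by case: i => m hm; move: hm; rewrite e.
have n1 : 1 <= INR n by rewrite -INR_1; apply: le_INR; lia.
apply: vnorm_le; first nra.
have : dot x x <= INR n * (a * a).
  rewrite -sumI_const; apply: sumI_le => i.
  have := h i; have := Rabs_pos (x i).
  have -> : x i * x i = Rabs (x i) * Rabs (x i).
    by rewrite -Rabs_mult Rabs_pos_eq //; nra.
  nra.
have : 0 <= a * a by nra.
nra.
Qed.
Lemma vnorm_ebas (i : 'I_n) : vnorm (ebas i) = 1.
Proof. by rewrite vnormE dot_ebas /ebas eqxx sqrt_1. Qed.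
Lemma vnorm_pos x i : x i <> 0 -> 0 < vnorm x.
Proof. by move=> h; have := coord_le_vnorm x i; have := Rabs_pos_lt _ h; lra. Qed.

Implicit Types X Y : 'I_n -> 'I_n -> R.

Lemma qform_scal X a y : qform X (vscal a y) = a * a * qform X y.
Proof.
rewrite /qform -sumI_scal; apply: sumI_ext => i; rewrite -sumI_scal.
by apply: sumI_ext => j; rewrite /vscal; ring.
Qed.

Lemma dsum_bound (F : 'I_n -> 'I_n -> R) M : (forall i j, Rabs (F i j) <= M) ->
  Rabs (sumI (fun i => sumI (fun j => F i j))) <= INR n * (INR n * M).
Proof. by move=> h; apply: sumI_bound => i; apply: sumI_bound. Qed.

End Vectors.

(** * Compactness *)

Definition extraction (s : nat -> nat) : Prop := forall k, (s k < s (S k))%coq_nat.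

Lemma extraction_lt s : extraction s -> forall j k, (j < k)%coq_nat -> (s j < s k)%coq_nat.
Proof.
move=> h j k; elim: k => [|k IH] hjk; first lia.
have := h k; case: (Nat.eq_dec j k) => [->|ne]; first by [].
have := IH ltac:(lia); lia.
Qed.

Lemma extraction_ge s : extraction s -> forall k, (k <= s k)%coq_nat.
Proof. by move=> h; elim=> [|k IH]; [lia|have := h k; lia]. Qed.

Lemma Un_cv_extract u l s : extraction s -> Un_cv u l -> Un_cv (fun k => u (s k)) l.
Proof.
move=> hs hu eps he; have [N hN] := hu eps he; exists N => k hk; apply: hN.
have := extraction_ge hs k; lia.
Qed.

(** The library theorem yields a cluster value only. The subsequence is built by choice: term [k]
    lies within [1 / (k + 1)] of it and beyond the previous index. *)
Lemma bolzano_seq (u : nat -> R) B : (forall k, Rabs (u k) <= B) ->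
  exists s l, extraction s /\ Un_cv (fun k => u (s k)) l.
Proof.
move=> hB.
have [|l hl] := Bolzano_Weierstrass u (fun c => -B <= c <= B) (compact_P3 (-B) B).
  by move=> k; have := Rcomplements.Rabs_le_between (u k) B; have := hB k; tauto.
have step : forall N k : nat, exists p, (N <= p)%coq_nat /\ Rabs (u p - l) < / INR (S k).
  move=> N k; have ek : 0 < / INR (S k) by apply: Rinv_0_lt_compat; apply: lt_0_INR; lia.
  have [|p [hp1 hp2]] := hl (disc l (mkposreal _ ek)) N; last by exists p.
  by exists (mkposreal _ ek).
pose nxt N k := proj1_sig (constructive_indefinite_description _ (step N k)).
have nxtP N k : (N <= nxt N k)%coq_nat /\ Rabs (u (nxt N k) - l) < / INR (S k).
  by rewrite /nxt; case: constructive_indefinite_description.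
pose fix s k := match k with O => nxt O O | S k' => nxt (S (s k')) k end.
exists s, l; split.
  by move=> k; rewrite /=; have [] := nxtP (S (s k)) (S k); lia.
have hs k : Rabs (u (s k) - l) < / INR (S k).
  by case: k => [|k]; [exact: (proj2 (nxtP O O))|exact: (proj2 (nxtP _ (S k)))].
move=> eps he.
have [N [hN1 hN2]] := archimed_cor1 eps he.
exists N => k hk; rewrite /Rdist; apply: Rlt_trans (hs k) _; apply: Rle_lt_trans hN1.
apply: Rinv_le_contravar; [apply: lt_0_INR; lia|apply: le_INR; lia].
Qed.

Lemma bolzano_family (I : finType) (x : nat -> I -> R) B : (forall k i, Rabs (x k i) <= B) ->
  exists s l, extraction s /\ forall i, Un_cv (fun k => x (s k) i) (l i).
Proof.
move=> hB.
suff [s [l [hs hl]]] : exists s l, extraction s /\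
    forall i, i \in enum I -> Un_cv (fun k => x (s k) i) (l i).
  by exists s, l; split=> // i; apply: hl; rewrite mem_enum.
elim: (enum I) => [|a L [s [l [hs hl]]]].
  by exists (fun k => k), (fun _ => 0); split=> // k; lia.
have [s' [c [hs' hc]]] := bolzano_seq (fun k => hB (s k) a).
exists (fun k => s (s' k)), (fun i => if i == a then c else l i); split.
  by move=> k; apply: extraction_lt.
move=> i; rewrite inE; case: eqP => [->|_] //= hi.
exact: (@Un_cv_extract (fun k => x (s k) i)) (hl i hi).
Qed.

(** Closedness and semicontinuity are asked together, along convergent sequences in [D]. Upper
    semicontinuity is the right generality: [lasry_lions] minimizes a supremum of continuous
    functions, for which lower semicontinuity comes for free. *)
Lemma usc_attains_max (I : finType) (D : (I -> R) -> Prop) (f : (I -> R) -> R) B :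
  (exists p, D p) -> (forall p, D p -> forall i, Rabs (p i) <= B) ->
  (forall x l, (forall k, D (x k)) -> (forall i, Un_cv (fun k => x k i) (l i)) ->
    D l /\ forall eps, 0 < eps -> exists N, forall k, (N <= k)%coq_nat -> f (x k) <= f l + eps) ->
  exists p, D p /\ forall q, D q -> f q <= f p.
Proof.
move=> [p0 hp0] hB hcl.
have bd : exists M, forall q, D q -> f q <= M.
  apply: NNPP => hn.
  have h k : exists q, D q /\ INR k < f q.
    apply: NNPP => hk; apply: hn; exists (INR k) => q hq.
    by apply: Rnot_lt_le => hlt; apply: hk; exists q.
  pose x k := proj1_sig (constructive_indefinite_description _ (h k)).
  have xP k : D (x k) /\ INR k < f (x k) by rewrite /x; case: constructive_indefinite_description.
  have [s [l [hs hl]]] := bolzano_family (fun k i => hB _ (proj1 (xP k)) i).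
  have [_ /(_ 1 ltac:(lra)) [N hN]] := hcl _ l (fun k => proj1 (xP (s k))) hl.
  have [M hM] := INR_unbounded (f l + 1).
  pose k := (N + M)%coq_nat.
  have h1 := hN k ltac:(rewrite /k; lia).
  have h2 := proj2 (xP (s k)).
  have h3 : INR M <= INR (s k).
    by apply: le_INR; have := extraction_ge hs k; rewrite /k; lia.
  lra.
have [| |m [hub hlub]] := completeness (fun v => exists q, D q /\ v = f q).
- by have [M hM] := bd; exists M => v [q [hq ->]]; apply: hM.
- by exists (f p0); exists p0.
have h k : exists q, D q /\ m - / INR (S k) < f q.
  apply: NNPP => hk; have ek : 0 < / INR (S k) by apply: Rinv_0_lt_compat; apply: lt_0_INR; lia.
  have : m <= m - / INR (S k); last by lra.
  apply: hlub => v [q [hq ->]]; apply: Rnot_lt_le => hlt; apply: hk; by exists q.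
pose x k := proj1_sig (constructive_indefinite_description _ (h k)).
have xP k : D (x k) /\ m - / INR (S k) < f (x k).
  by rewrite /x; case: constructive_indefinite_description.
have [s [l [hs hl]]] := bolzano_family (fun k i => hB _ (proj1 (xP k)) i).
have [Dl usc] := hcl _ l (fun k => proj1 (xP (s k))) hl.
exists l; split=> // q hq.
have : f q <= m by apply: hub; exists q.
suff : m <= f l by lra.
apply: Rnot_lt_le => hlt.
pose e := (m - f l) / 2; have he : 0 < e by rewrite /e; lra.
have [N hN] := usc e he.
have [M [hM1 hM2]] := archimed_cor1 e he.
pose k := (N + M)%coq_nat.
have h1 := hN k ltac:(rewrite /k; lia).
have h2 := proj2 (xP (s k)).
have h3 : / INR (S (s k)) <= / INR M.
  apply: Rinv_le_contravar; first exact: lt_0_INR.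
  by apply: le_INR; have := extraction_ge hs k; rewrite /k; lia.
rewrite /e in h1 h3 hM1; lra.
Qed.

(** * Quadratic test functions and jets *)

Section SmoothQuadratic.
Variable I : finType.
Implicit Types (F G : (I -> R) -> R) (p : I -> R).
Let bsum (f : I -> R) : R := \big[Rplus/0]_(d : I) f d.

Lemma bsum_ext (f g : I -> R) : (forall d, f d = g d) -> bsum f = bsum g.
Proof. by move=> h; apply: eq_bigr. Qed.
Lemma bsum_add (f g : I -> R) : bsum (fun d => f d + g d) = bsum f + bsum g.
Proof. exact: big_split. Qed.
Lemma bsum_scal a (f : I -> R) : bsum (fun d => a * f d) = a * bsum f.
Proof.
rewrite /bsum; apply: (big_ind2 (fun x y => x = a * y)); [ring| |by []].
by move=> x1 x2 y1 y2 -> ->; ring.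
Qed.
Lemma bsum_delta (f : I -> R) i : bsum (fun d => if d == i then f d else 0) = f i.
Proof. by rewrite /bsum -big_mkcond big_pred1_eq. Qed.

Lemma contR_const c : contR (fun _ : I -> R => c).
Proof. by move=> p e he; exists 1; split; [lra|move=> q _; rewrite Rminus_diag Rabs_R0]. Qed.
Lemma contR_coord d : contR (fun p : I -> R => p d).
Proof. by move=> p e he; exists e; split=> // q h; apply: h. Qed.
Lemma contR_add F G : contR F -> contR G -> contR (fun p => F p + G p).
Proof.
move=> hF hG p e he.
have [d1 [d1p h1]] := hF p (e/2) ltac:(lra).
have [d2 [d2p h2]] := hG p (e/2) ltac:(lra).
exists (Rmin d1 d2); split; first exact: Rmin_pos.
move=> q hq.
have := h1 q ltac:(move=> j; apply: Rlt_le_trans (hq j) (Rmin_l _ _)).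
have := h2 q ltac:(move=> j; apply: Rlt_le_trans (hq j) (Rmin_r _ _)).
by move=> /Rabs_def2 ? /Rabs_def2 ?; apply: Rabs_def1; lra.
Qed.
Lemma contR_mul F G : contR F -> contR G -> contR (fun p => F p * G p).
Proof.
move=> hF hG p e he.
pose A := Rabs (F p) + 1; pose B := Rabs (G p) + 1.
have Ap : 0 < A by rewrite /A; have := Rabs_pos (F p); lra.
have Bp : 0 < B by rewrite /B; have := Rabs_pos (G p); lra.
have [d1 [d1p h1]] := hF p (Rmin 1 (e/2/B)) ltac:(apply: Rmin_pos; [lra|apply: Rdiv_lt_0_compat; lra]).
have [d2 [d2p h2]] := hG p (e/2/A) ltac:(apply: Rdiv_lt_0_compat; lra).
exists (Rmin d1 d2); split; first exact: Rmin_pos.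
move=> q hq.
have k1 := h1 q ltac:(move=> j; apply: Rlt_le_trans (hq j) (Rmin_l _ _)).
have k2 := h2 q ltac:(move=> j; apply: Rlt_le_trans (hq j) (Rmin_r _ _)).
have k11 := Rlt_le_trans _ _ _ k1 (Rmin_l _ _).
have k12 := Rlt_le_trans _ _ _ k1 (Rmin_r _ _).
have -> : F q * G q - F p * G p = F q * (G q - G p) + G p * (F q - F p) by ring.
apply: Rle_lt_trans (Rabs_triang _ _) _; rewrite !Rabs_mult.
have fq : Rabs (F q) < A.
  have := Rabs_triang (F q - F p) (F p).
  have -> : F q - F p + F p = F q by ring.
  rewrite /A; lra.
have e1 : A * (e/2/A) = e/2 by field; lra.
have e2 : B * (e/2/B) = e/2 by field; lra.
have g0 := Rabs_pos (G q - G p); have g1 := Rabs_pos (F q - F p).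
have g2 := Rabs_pos (G p); have g3 := Rabs_pos (F q).
have gB : Rabs (G p) < B by rewrite /B; lra.
have : Rabs (F q) * Rabs (G q - G p) <= A * Rabs (G q - G p) by nra.
have : Rabs (G p) * Rabs (F q - F p) <= B * Rabs (F q - F p) by nra.
nra.
Qed.
Lemma contR_sum (f : I -> (I -> R) -> R) : (forall d, contR (f d)) -> contR (fun p => bsum (fun d => f d p)).
Proof.
move=> h; rewrite /bsum; elim: (index_enum I) => [|d L IH].
  have -> : (fun p => \big[Rplus/0]_(d <- [::]) f d p) = fun _ => 0.
    by apply: functional_extensionality => p; rewrite big_nil.
  exact: contR_const.
have -> : (fun p => \big[Rplus/0]_(d <- d :: L) f d p) =
  fun p => f d p + \big[Rplus/0]_(d <- L) f d p.
  by apply: functional_extensionality => p; rewrite big_cons.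
exact: contR_add.
Qed.

Lemma smooth_step F : contR F -> (forall i, exists G, has_partial F G i /\ smooth G) -> smooth F.
Proof.
move=> hF h; case=> [//|k]; split=> // i; have [G [h1 h2]] := h i.
by exists G; split=> //; apply: h2.
Qed.

(** Every test function fed to the viscosity definition is a polynomial of degree at most two, so
    its increment along a coordinate is exact and differentiation reduces to an identity. *)
Lemma has_partial_quadratic F G (D : R) i :
  (forall p h, F (upd p i h) = F p + h * G p + h * h * D) -> has_partial F G i.
Proof.
move=> hF p eps he.
pose A := Rabs D + 1; have Ap : 0 < A by rewrite /A; have := Rabs_pos D; lra.
have ep : 0 < eps / A by apply: Rdiv_lt_0_compat; lra.
exists (mkposreal _ ep) => h hn /= hh.
rewrite !Rplus_0_l !hF.
have -> : (F p + h * G p + h * h * D - (F p + 0 * G p + 0 * 0 * D)) / h - G p = h * D by field.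
rewrite Rabs_mult; have e1 : eps / A * A = eps by field; lra.
have := Rabs_pos D; have := Rabs_pos h; rewrite /A in e1 hh *; nra.
Qed.

Lemma smooth_const c : smooth (fun _ : I -> R => c).
Proof.
have h : forall k, forall c, Ck k (fun _ : I -> R => c).
  elim=> [|k IH] c'; first exact: contR_const.
  split; first exact: contR_const.
  move=> i; exists (fun _ => 0); split; last exact: IH.
  by apply: (@has_partial_quadratic _ _ 0) => p h; ring.
by move=> k; apply: h.
Qed.

Definition affine (c : R) (l p0 : I -> R) (p : I -> R) : R := c + bsum (fun d => l d * (p d - p0 d)).
Definition quadratic (l p0 : I -> R) (M : I -> I -> R) (p : I -> R) : R :=
  bsum (fun d => l d * (p d - p0 d)) +
  /2 * bsum (fun d => (p d - p0 d) * bsum (fun e => M d e * (p e - p0 e))).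

Lemma bsum_upd (l p p0 : I -> R) i h :
  bsum (fun d => l d * (upd p i h d - p0 d)) = bsum (fun d => l d * (p d - p0 d)) + h * l i.
Proof.
rewrite -(bsum_delta l i) -bsum_scal -bsum_add; apply: bsum_ext => d.
rewrite /upd; case: eqP => [->|_]; ring.
Qed.

Lemma has_partial_affine c l p0 i : has_partial (affine c l p0) (fun _ => l i) i.
Proof.
by apply: (@has_partial_quadratic _ _ 0) => p h; rewrite /affine bsum_upd; ring.
Qed.

Lemma has_partial_quadr l p0 M i : (forall d e, M d e = M e d) ->
  has_partial (quadratic l p0 M) (affine (l i) (M i) p0) i.
Proof.
move=> sM; apply: (@has_partial_quadratic _ _ (/2 * M i i)) => p h.
rewrite /quadratic /affine bsum_upd.
have -> : bsum (fun d => (upd p i h d - p0 d) * bsum (fun e => M d e * (upd p i h e - p0 e))) =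
  bsum (fun d => (p d - p0 d) * bsum (fun e => M d e * (p e - p0 e))) +
  2 * h * bsum (fun e => M i e * (p e - p0 e)) + h * h * M i i; last by field.
have -> : bsum (fun d => (upd p i h d - p0 d) * bsum (fun e => M d e * (upd p i h e - p0 e))) =
  bsum (fun d => ((p d - p0 d) * bsum (fun e => M d e * (p e - p0 e)) +
   h * (M i d * (p d - p0 d))) +
   (if d == i then h * bsum (fun e => M d e * (p e - p0 e)) + h * h * M d i else 0)).
  apply: bsum_ext => d; rewrite bsum_upd (sM i d) /upd; case: eqP => _; ring.
rewrite !bsum_add bsum_scal (@bsum_delta (fun d => h * bsum (fun e => M d e * (p e - p0 e)) + h * h * M d i)).
ring.
Qed.

Lemma contR_affine c l p0 : contR (affine c l p0).
Proof.
apply: contR_add; first exact: contR_const.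
apply: contR_sum => d; apply: contR_mul; first exact: contR_const.
apply: contR_add; [exact: contR_coord|exact: contR_const].
Qed.

Lemma smooth_affine c l p0 : smooth (affine c l p0).
Proof.
apply: smooth_step; first exact: contR_affine.
by move=> i; exists (fun _ => l i); split; [exact: has_partial_affine|exact: smooth_const].
Qed.

Lemma smooth_quadratic l p0 M : (forall d e, M d e = M e d) -> smooth (quadratic l p0 M).
Proof.
move=> sM; apply: smooth_step; last first.
  by move=> i; exists (affine (l i) (M i) p0); split; [exact: has_partial_quadr|exact: smooth_affine].
apply: contR_add.
  apply: contR_sum => d; apply: contR_mul; first exact: contR_const.
  apply: contR_add; [exact: contR_coord|exact: contR_const].
apply: contR_mul; first exact: contR_const.
apply: contR_sum => d; apply: contR_mul.
  apply: contR_add; [exact: contR_coord|exact: contR_const].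
apply: contR_sum => e; apply: contR_mul; first exact: contR_const.
apply: contR_add; [exact: contR_coord|exact: contR_const].
Qed.

End SmoothQuadratic.

Lemma big_option (T : finType) (f : option T -> R) :
  \big[Rplus/0]_(d : option T) f d = f None + \big[Rplus/0]_(i : T) f (Some i).
Proof.
have hp : perm_eq (index_enum (option T)) (None :: map Some (index_enum T)).
  apply: uniq_perm; first exact: index_enum_uniq.
    rewrite /= map_inj_uniq ?index_enum_uniq ?andbT; last by move=> x y [].
    by apply/mapP => -[].
  move=> [x|]; rewrite mem_index_enum inE //=.
  by apply/esym/mapP; exists x => //; rewrite mem_index_enum.
by rewrite (perm_big _ hp) big_cons big_map.
Qed.

Section Jets.
Variable n : nat.
Implicit Types (x q eta : 'I_n -> R) (X : 'I_n -> 'I_n -> R) (w : ('I_n -> R) -> R -> R).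

Definition symm X := forall i j, X i j = X j i.
Definition tr_perp eta X : R :=
  sumI (fun i => sumI (fun j => (kdelta i j - eta i * eta j) * X i j)).
(** Merges the two Evans-Spruck cases: [eta] is the unit gradient if [q] is nonzero, and any vector
    of the closed unit ball otherwise. *)
Definition admissible q eta :=
  vnorm eta <= 1 /\ ((exists i, q i <> 0) -> forall i, eta i = q i / vnorm q).

(** The constant [C] is arbitrary and absent from the conclusion: errors quadratic in time are free,
    which later absorbs time penalties and products of time and space increments. *)
Definition jet_subsolution w := forall x0 t0, 0 < t0 -> forall a q X C r, symm X -> 0 < r ->
  (forall x t, 0 <= t -> vnorm (vsub x x0) < r -> Rabs (t - t0) < r ->
     w x t <= w x0 t0 + a * (t - t0) + dot q (vsub x x0) + /2 * qform X (vsub x x0)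
       + C * ((t - t0) * (t - t0))) ->
  exists eta, admissible q eta /\ a <= tr_perp eta X.

Definition jsub w := cont_bdd w /\ jet_subsolution w.

Definition jet_lin (a : R) q : option 'I_n -> R := fun d => if d is Some i then q i else a.
Definition jet_hess (C : R) X : option 'I_n -> option 'I_n -> R := fun d e =>
  match d, e with Some i, Some j => X i j | None, None => 2 * C | _, _ => 0 end.
Definition jet_test a q X C (p0 : option 'I_n -> R) := quadratic (jet_lin a q) p0 (jet_hess C X).

Lemma jet_hess_sym C X : symm X -> forall d e, jet_hess C X d e = jet_hess C X e d.
Proof. by move=> sX [i|] [j|] //=. Qed.

Lemma jet_testE a q X C x0 t0 x t :
  jet_test a q X C (st x0 t0) (st x t) = a * (t - t0) + dot q (vsub x x0)
    + /2 * qform X (vsub x x0) + C * ((t - t0) * (t - t0)).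
Proof.
rewrite /jet_test /quadratic !big_option /=.
rewrite (_ : \big[Rplus/0]_(i : 'I_n) (q i * (x i - x0 i)) = dot q (vsub x x0)) //.
rewrite (_ : \big[Rplus/0]_(i : 'I_n) (0 * (x i - x0 i)) = 0); last first.
  by apply: big1 => i _; ring.
rewrite (_ : \big[Rplus/0]_(i : 'I_n) _ = qform X (vsub x x0)); first by field.
apply: eq_bigr => i _; rewrite big_option /= /vsub -!/(sumI _) Rmult_0_l Rplus_0_l -sumI_scal.
by apply: sumI_ext => j; ring.
Qed.

Lemma jet_test0 a q X C x0 t0 : jet_test a q X C (st x0 t0) (st x0 t0) = 0.
Proof.
rewrite jet_testE; have -> : vsub x0 x0 = vzero by vext.
have -> : @vzero n = vscal 0 vzero by vext.
by rewrite qform_scal dotZr; ring.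
Qed.

Lemma jet_test_derivs a q X C p0 : symm X ->
  derivs_of (jet_test a q X C p0) (fun d => affine (jet_lin a q d) (jet_hess C X d) p0)
    (fun e d _ => jet_hess C X d e).
Proof.
move=> sX; split=> [d|e d]; last exact: has_partial_affine.
by apply: has_partial_quadr; apply: jet_hess_sym.
Qed.

Lemma affine0 (I : finType) c (l p0 : I -> R) : affine c l p0 p0 = c.
Proof. by rewrite /affine big1 => [|d _]; ring. Qed.

Lemma vnorm_unit q i : q i <> 0 -> vnorm (fun k => q k / vnorm q) = 1.
Proof.
move=> hi; have hp := vnorm_pos hi.
have -> : (fun k => q k / vnorm q) = vscal (/ vnorm q) q.
  by apply: functional_extensionality => k; rewrite /vscal; field; lra.
rewrite vnorm_scal Rabs_pos_eq; last by left; apply: Rinv_0_lt_compat.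
by field; lra.
Qed.

Lemma ES_sub_ineq_admissible a q X : ES_sub_ineq a q X ->
  exists eta, admissible q eta /\ a <= tr_perp eta X.
Proof.
move=> [h1 h2]; case: (classic (exists i, q i <> 0)) => [hq|hq].
  exists (fun k => q k / vnorm q); split.
    by split=> //; have [i hi] := hq; rewrite (vnorm_unit hi); lra.
  apply: Rle_trans (h1 hq) _; right; apply: sumI_ext => i; apply: sumI_ext => j.
  by have [k hk] := hq; have := vnorm_pos hk => ?; field; lra.
have q0 : forall i, q i = 0 by move=> i; apply: NNPP => hi; apply: hq; exists i.
by have [eta [e1 e2]] := h2 q0; exists eta; split.
Qed.

Lemma ES_sub_jsub w : ES_subsolution w -> jsub w.
Proof.
move=> [hc hs]; split=> // x0 t0 ht0 a q X C r sX hr hw.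
have := hs (jet_test a q X C (st x0 t0)) _ x0 t0 ht0 _ _ _ (jet_test_derivs a q C (st x0 t0) sX).
rewrite !affine0 /=.
have -> : (fun i j => X j i) = X.
  by do 2 (apply: functional_extensionality => ?); apply: sX.
have -> : (fun i => affine (jet_lin a q (Some i)) (jet_hess C X (Some i)) (st x0 t0) (st x0 t0)) = q.
  by apply: functional_extensionality => i; rewrite affine0.
move=> h; apply: ES_sub_ineq_admissible; apply: h.
- exact: smooth_quadratic (jet_hess_sym C sX).
- exists r; split=> // x t ht hx ht'.
  have := hw x t ht hx ht'; rewrite jet_test0 jet_testE; lra.
Qed.

(** The operator is odd under a change of sign, since [q i * q j] is even in [q]. From here on only
    subsolutions occur, applied to [u] and to [- u]. *)
Lemma ES_super_jsub w : ES_supersolution w -> jsub (fun x t => - w x t).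
Proof.
move=> [hc hs]; split.
  have [c1 [M c2]] := hc; split; last first.
    by exists M => x t ht; rewrite Rabs_Ropp; apply: c2.
  move=> x t ht e he; have [d [dp hd]] := c1 x t ht e he; exists d; split=> // y s hs0 h1 h2.
  rewrite (_ : - w y s - - w x t = - (w y s - w x t)); last by ring.
  by rewrite Rabs_Ropp; apply: hd.
move=> x0 t0 ht0 a q X C r sX hr hw.
pose mX := fun i j => - X i j.
have smX : symm mX by move=> i j; rewrite /mX sX.
have := hs (jet_test (-a) (vscal (-1) q) mX (-C) (st x0 t0)) _ x0 t0 ht0 _ _ _
  (jet_test_derivs (-a) (vscal (-1) q) (-C) (st x0 t0) smX).
rewrite !affine0 /=.
have -> : (fun i j => mX j i) = mX.
  by do 2 (apply: functional_extensionality => ?); apply: smX.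
have -> : (fun i => affine (jet_lin (-a) (vscal (-1) q) (Some i)) (jet_hess (-C) mX (Some i)) (st x0 t0) (st x0 t0))
   = vscal (-1) q.
  by apply: functional_extensionality => i; rewrite affine0.
have qfN : forall y, qform mX y = - qform X y.
  move=> y; rewrite (_ : - qform X y = (-1) * qform X y); last by ring.
  rewrite /qform -sumI_scal; apply: sumI_ext => i; rewrite -sumI_scal.
  by apply: sumI_ext => j; rewrite /mX; ring.
have dsN : forall F : 'I_n -> 'I_n -> R,
  - sumI (fun i => sumI (fun j => F i j * mX i j)) = sumI (fun i => sumI (fun j => F i j * X i j)).
  move=> F; rewrite (_ : forall z, - z = (-1) * z); last by move=> z; ring.
  rewrite -sumI_scal; apply: sumI_ext => i; rewrite -sumI_scal.
  by apply: sumI_ext => j; rewrite /mX; ring.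
move=> h; apply: ES_sub_ineq_admissible.
have [||h1 h2] := h.
- exact: smooth_quadratic (jet_hess_sym (-C) smX).
- exists r; split=> // x t ht hx ht'.
  have := hw x t ht hx ht'; rewrite jet_test0 jet_testE qfN dotZl; lra.
split=> [[i hi]|q0].
  have hp : exists i, vscal (-1) q i <> 0 by exists i; rewrite /vscal; lra.
  have := h1 hp; rewrite vnorm_opp.
  rewrite -(dsN (fun i j => kdelta i j - q i * q j / vnorm q ^ 2)) => h3.
  rewrite -[X in X <= _]Ropp_involutive; apply: Ropp_le_contravar.
  apply: Rle_trans (Rge_le _ _ h3); right.
  by apply: sumI_ext => k; apply: sumI_ext => l; rewrite /vscal /Rdiv; ring.
have hp : forall i, vscal (-1) q i = 0 by move=> i; rewrite /vscal q0; ring.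
have [eta [e1 e2]] := h2 hp; exists eta; split=> //.
by rewrite -(dsN (fun i j => kdelta i j - eta i * eta j)); lra.
Qed.

Lemma jsub_shift w x1 c : jsub w -> jsub (fun x t => w (vadd x1 x) t + c).
Proof.
have sh : forall x y, vsub (vadd x1 x) (vadd x1 y) = vsub x y by move=> x y; vext.
move=> [[hc [M hM]] hj]; split.
  split.
    move=> x t ht e he; have [d [dp hd]] := hc (vadd x1 x) t ht e he; exists d; split=> // y s hs h1 h2.
    rewrite (_ : w (vadd x1 y) s + c - (w (vadd x1 x) t + c) = w (vadd x1 y) s - w (vadd x1 x) t); last by ring.
    by apply: hd => //; rewrite sh.
  exists (M + Rabs c) => x t ht; apply: Rle_trans (Rabs_triang _ _) _.
  by have := hM (vadd x1 x) t ht; lra.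
move=> x0 t0 ht0 a q X C r sX hr hw.
apply: (hj (vadd x1 x0) t0 ht0 a q X C r) => // x t ht hx ht'.
have e : x = vadd x1 (vsub x x1) by vext.
have e2 : vsub x (vadd x1 x0) = vsub (vsub x x1) x0 by vext.
have := hw (vsub x x1) t ht; rewrite -e -e2 => /(_ hx ht'); lra.
Qed.

End Jets.

(** * Comparison with strict supersolutions *)

Section Matrices.
Variable n : nat.
Implicit Types (y eta : 'I_n -> R) (X Y : 'I_n -> 'I_n -> R).

Lemma dsum_lin (F X Y : 'I_n -> 'I_n -> R) a b :
  sumI (fun i => sumI (fun j => F i j * (a * X i j + b * Y i j))) =
  a * sumI (fun i => sumI (fun j => F i j * X i j)) +
  b * sumI (fun i => sumI (fun j => F i j * Y i j)).
Proof.
rewrite -!sumI_scal -sumI_add; apply: sumI_ext => i.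
by rewrite -!sumI_scal -sumI_add; apply: sumI_ext => j; ring.
Qed.

Lemma qform_lin X Y a b y :
  qform (fun i j => a * X i j + b * Y i j) y = a * qform X y + b * qform Y y.
Proof.
have h : forall Z : 'I_n -> 'I_n -> R, qform Z y = sumI (fun i => sumI (fun j => y i * y j * Z i j)).
  by move=> Z; apply: sumI_ext => i; apply: sumI_ext => j; ring.
by rewrite !h dsum_lin.
Qed.

Lemma tr_perp_lin eta X Y a b :
  tr_perp eta (fun i j => a * X i j + b * Y i j) = a * tr_perp eta X + b * tr_perp eta Y.
Proof. exact: dsum_lin. Qed.

Lemma sum_kdelta (f : 'I_n -> R) i : sumI (fun j => kdelta i j * f j) = f i.
Proof.
rewrite -(sumI_delta f i); apply: sumI_ext => j; rewrite /kdelta (eq_sym i j).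
by case: eqP => _; ring.
Qed.

Lemma qform_id y : qform (@kdelta n) y = dot y y.
Proof.
apply: sumI_ext => i; rewrite -(sum_kdelta (fun j => y i * y j)).
by apply: sumI_ext => j; ring.
Qed.

Lemma tr_perp_id eta : tr_perp eta (@kdelta n) = INR n - dot eta eta.
Proof.
have -> : INR n = sumI (fun _ : 'I_n => 1) by rewrite sumI_const; ring.
rewrite (_ : forall a b, a - b = a + (-1) * b); last by move=> a b; ring.
rewrite /dot -sumI_scal -sumI_add; apply: sumI_ext => i.
have -> : 1 + -1 * (eta i * eta i) = kdelta i i - eta i * eta i by rewrite /kdelta eqxx; ring.
rewrite -(sum_kdelta (fun j => kdelta i j - eta i * eta j)).
by apply: sumI_ext => j; ring.
Qed.

Lemma symm_lin X Y a b : symm X -> symm Y -> symm (fun i j => a * X i j + b * Y i j).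
Proof. by move=> hX hY i j; rewrite hX hY. Qed.
Lemma symm_id : symm (@kdelta n).
Proof. by move=> i j; rewrite /kdelta eq_sym. Qed.

End Matrices.

Section Comparison.
Variable n : nat.
Implicit Types (y z q eta : 'I_n -> R) (X : 'I_n -> 'I_n -> R) (w : ('I_n -> R) -> R -> R).

Definition vcont (f : ('I_n -> R) -> R) := forall z eps, 0 < eps -> exists del, 0 < del /\
  forall y, vnorm (vsub y z) < del -> Rabs (f y - f z) < eps.
Definition vcv (x : nat -> 'I_n -> R) z := forall eps, 0 < eps -> exists N, forall k,
  (N <= k)%coq_nat -> vnorm (vsub (x k) z) < eps.

Lemma finite_eventually (I : finType) (P : I -> nat -> Prop) :
  (forall i, exists N, forall k, (N <= k)%coq_nat -> P i k) ->
  exists N, forall k, (N <= k)%coq_nat -> forall i, P i k.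
Proof.
move=> h; suff [N hN] : exists N, forall k, (N <= k)%coq_nat -> forall i, i \in enum I -> P i k.
  by exists N => k hk i; apply: hN => //; rewrite mem_enum.
elim: (enum I) => [|a L [N hN]]; first by exists O.
have [M hM] := h a; exists (N + M)%coq_nat => k hk i; rewrite inE => /orP [/eqP ->|hi].
  by apply: hM; lia.
by apply: hN => //; lia.
Qed.

Lemma coord_vcv (x : nat -> 'I_n -> R) z : (forall i, Un_cv (fun k => x k i) (z i)) -> vcv x z.
Proof.
move=> h eps he; have np := pos_INR n.
pose e := eps / (INR n + 1); have ep : 0 < e by apply: Rdiv_lt_0_compat; lra.
have [N hN] := finite_eventually (fun i => h i e ep).
exists N => k hk; apply: Rle_lt_trans (vnorm_le_sup (Rlt_le _ _ ep) _) _.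
  by move=> i; left; apply: hN.
have : e * (INR n + 1) = eps by rewrite /e; field; lra.
nra.
Qed.

Lemma vcont_vcv f x z : vcont f -> vcv x z -> Un_cv (fun k => f (x k)) (f z).
Proof.
move=> hf hx eps he; have [d [dp hd]] := hf z eps he; have [N hN] := hx d dp.
by exists N => k hk; apply: hd; apply: hN.
Qed.

Lemma Un_cv_const c : Un_cv (fun _ => c) c.
Proof. by move=> eps he; exists O => k _; rewrite /Rdist Rminus_diag Rabs_R0. Qed.

Lemma Un_cv_between (s : nat -> R) l a b : (forall k, a <= s k <= b) -> Un_cv s l -> a <= l <= b.
Proof.
move=> h hs; split; apply: Rnot_lt_le => hlt.
  have [N /(_ N (le_n _))] := hs (a - l) ltac:(lra).
  by rewrite /Rdist => /Rabs_def2; have := h N; lra.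
have [N /(_ N (le_n _))] := hs (l - b) ltac:(lra).
by rewrite /Rdist => /Rabs_def2; have := h N; lra.
Qed.

Lemma vcv_norm_le x z R : (forall k, vnorm (x k) <= R) -> vcv x z -> vnorm z <= R.
Proof.
move=> h hx; apply: Rnot_lt_le => hlt.
have [N /(_ N (le_n _)) hN] := hx (vnorm z - R) ltac:(lra).
have e : z = vsub (x N) (vsub (x N) z) by vext.
have := vnorm_sub (x N) (vsub (x N) z); rewrite -e; have := h N; lra.
Qed.

Lemma parabolic_max (g : ('I_n -> R) -> R -> R) rho D : 0 <= rho -> 0 <= D ->
  (forall x s z s0, (forall k, 0 <= s k <= D) -> vcv x z -> Un_cv s s0 ->
     Un_cv (fun k => g (x k) (s k)) (g z s0)) ->
  exists z s, vnorm z <= rho /\ 0 <= s <= D /\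
    forall y s', vnorm y <= rho -> 0 <= s' <= D -> g y s' <= g z s.
Proof.
move=> hR hD hg.
pose vs (p : option 'I_n -> R) : 'I_n -> R := fun i => p (Some i).
have [|||p [[h1 h2] h3]] := @usc_attains_max _
  (fun p : option 'I_n -> R => vnorm (vs p) <= rho /\ 0 <= p None <= D)
  (fun p => g (vs p) (p None)) (rho + D).
- by exists (st vzero 0); split; [rewrite (_ : vs (st vzero 0) = vzero) // vnorm0|rewrite /=; lra].
- move=> p [h1 h2] [i|]; first by apply: Rle_trans (coord_le_vnorm (vs p) i) _; lra.
  by rewrite Rabs_pos_eq; [apply: Rle_trans (proj2 h2) _; lra|exact: proj1 h2].
- move=> x l hx hl.
  have cv : vcv (fun k => vs (x k)) (vs l) by apply: coord_vcv => i; apply: hl.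
  split.
    split; first by apply: vcv_norm_le cv => k; apply: (proj1 (hx k)).
    exact: Un_cv_between (fun k => proj2 (hx k)) (hl None).
  move=> eps he.
  have [N hN] := hg (fun k => vs (x k)) (fun k => x k None) (vs l) (l None)
    (fun k => proj2 (hx k)) cv (hl None) eps he.
  by exists N => k hk; have := hN k hk; rewrite /Rdist => /Rabs_def2; lra.
exists (vs p), (p None); split=> //; split=> // y s' hy hs'.
exact: (h3 (st y s')).
Qed.

Lemma cont_bdd_cv w x s z s0 : cont_bdd w -> (forall k, 0 <= s k) -> vcv x z -> Un_cv s s0 ->
  Un_cv (fun k => w (x k) (s k)) (w z s0).
Proof.
move=> [hc _] hs hx hcv eps he.
have hs0 : 0 <= s0.
  apply: Rnot_lt_le => hlt; have [N /(_ N (le_n _))] := hcv (- s0) ltac:(lra).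
  by rewrite /Rdist => /Rabs_def2; have := hs N; lra.
have [d [dp hd]] := hc z s0 hs0 eps he.
have [N1 h1] := hx d dp; have [N2 h2] := hcv d dp.
exists (N1 + N2)%coq_nat => k hk; apply: hd => //; first by apply: h1; lia.
by apply: h2; lia.
Qed.

(** The penalty [G (t - s')_+^2] is not a polynomial, but it lies below a parabola touching it at
    [s], and that is all a jet inequality requires. *)
Lemma Rmax0_sq_step s s' t G : 0 <= G ->
  G * (Rmax 0 (t - s') * Rmax 0 (t - s')) <=
  G * (Rmax 0 (s - s') * Rmax 0 (s - s')) + 2 * G * Rmax 0 (s - s') * (t - s) + G * ((t - s) * (t - s)).
Proof.
move=> hG.
suff : Rmax 0 (t - s') * Rmax 0 (t - s') <=
  Rmax 0 (s - s') * Rmax 0 (s - s') + 2 * Rmax 0 (s - s') * (t - s) + ((t - s) * (t - s)) by nra.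
have -> : t - s = (t - s') - (s - s') by ring.
set a := t - s'; set b := s - s'; rewrite /Rmax.
have sa := Rle_0_sqr a; have sb := Rle_0_sqr (a - b); rewrite /Rsqr in sa sb.
by case: (Rle_dec 0 a) => ha; case: (Rle_dec 0 b) => hb; nra.
Qed.

Lemma Rmax0_Un_cv s l : Un_cv s l -> Un_cv (fun k => Rmax 0 (s k)) (Rmax 0 l).
Proof.
move=> h eps he; have [N hN] := h eps he; exists N => k hk.
apply: Rle_lt_trans (hN k hk); rewrite /Rdist /Rmax.
by do 2 case: Rle_dec => ?; split_Rabs; lra.
Qed.

(* [A + s B] is a barrier, strict by the margin [eps0]. The definition of [jsub] tests two-sidedly
   in time, so a maximum at the final time [s = D] is excluded by a penalty [G (s - s')_+^2]
   vanishing up to the time [s'] of a putative violation. *)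
Lemma comparison w t1 D rho (A B : ('I_n -> R) -> R) eps0 :
  jsub w -> 0 <= t1 -> 0 < D -> 0 < rho -> 0 < eps0 -> vcont A -> vcont B ->
  (forall z s, vnorm z < rho -> 0 < s < D -> exists q X K3 L,
    symm X /\ 0 <= K3 /\ 0 <= L /\
    (forall y, vnorm y <= 1 -> A (vadd z y) + s * B (vadd z y) <=
       A z + s * B z + dot q y + /2 * qform X y + K3 * (vnorm y * dot y y)) /\
    (forall y, vnorm y <= 1 -> Rabs (B (vadd z y) - B z) <= L * vnorm y) /\
    (forall eta, admissible q eta -> tr_perp eta X + eps0 <= B z)) ->
  (forall z, vnorm z <= rho -> w z t1 <= A z) ->
  (forall z s, vnorm z = rho -> 0 <= s <= D -> w z (t1 + s) <= A z + s * B z) ->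
  forall z s, vnorm z <= rho -> 0 <= s <= D -> w z (t1 + s) <= A z + s * B z.
Proof.
move=> [hcb hj] ht1 hD hR heps hA hB hjet hinit hbd.
have cvpsi : forall G s' x s z s0, (forall k, 0 <= s k <= D) -> vcv x z -> Un_cv s s0 ->
   Un_cv (fun k => w (x k) (t1 + s k) - (A (x k) + s k * B (x k)) -
     G * (Rmax 0 (s k - s') * Rmax 0 (s k - s')))
    (w z (t1 + s0) - (A z + s0 * B z) - G * (Rmax 0 (s0 - s') * Rmax 0 (s0 - s'))).
  move=> G s' x s z s0 hs hx hcv.
  have cm : Un_cv (fun k => Rmax 0 (s k - s')) (Rmax 0 (s0 - s')).
    by apply: Rmax0_Un_cv; apply: CV_minus => //; apply: Un_cv_const.
  apply: CV_minus; last by apply: CV_mult; [apply: Un_cv_const|apply: CV_mult].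
  apply: CV_minus.
    apply: cont_bdd_cv => // [k|]; first by have := hs k; lra.
    by apply: CV_plus => //; apply: Un_cv_const.
  by apply: CV_plus; [apply: vcont_vcv|apply: CV_mult => //; apply: vcont_vcv].
have main : forall z s, vnorm z <= rho -> 0 <= s < D -> w z (t1 + s) <= A z + s * B z.
  move=> z' s' hz' hs'; apply: Rnot_lt_le => hviol.
  have [z1 [s1 [_ [_ hmax1]]]] := parabolic_max (Rlt_le _ _ hR) (Rlt_le _ _ hD) (cvpsi 0 0).
  pose M1 := w z1 (t1 + s1) - (A z1 + s1 * B z1) - 0 * (Rmax 0 (s1 - 0) * Rmax 0 (s1 - 0)).
  pose m1 := Rmax 0 M1.
  have m1p : 0 <= m1 := Rmax_l _ _; have m1M : M1 <= m1 := Rmax_r _ _.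
  (* At [sh = D] the penalty equals [m1 + 1], more than the unpenalized maximum [M1]; a positive
     maximum therefore lies at a time before [D]. *)
  pose G := (m1 + 1) / ((D - s') * (D - s')).
  have dd : 0 < (D - s') * (D - s') by apply: Rmult_lt_0_compat; lra.
  have Gp : 0 < G by apply: Rdiv_lt_0_compat; lra.
  have [zh [sh [hzh [hsh hmax]]]] := parabolic_max (Rlt_le _ _ hR) (Rlt_le _ _ hD) (cvpsi G s').
  have v0 := hmax z' s' hz' (conj (proj1 hs') (Rlt_le _ _ (proj2 hs'))).
  rewrite (_ : s' - s' = 0) in v0; last by ring.
  rewrite Rmax_left in v0; last by lra.
  have pen0 : 0 <= G * (Rmax 0 (sh - s') * Rmax 0 (sh - s')).
    by apply: Rmult_le_pos; [lra|have := Rmax_l 0 (sh - s'); nra].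
  have pos : 0 < w zh (t1 + sh) - (A zh + sh * B zh) by lra.
  have zlt : vnorm zh < rho.
    case: (Req_dec (vnorm zh) rho) => [e|]; last by lra.
    by have := hbd zh sh e hsh; lra.
  have s0 : 0 < sh.
    case: (Req_dec sh 0) => [e|]; last by lra.
    have := hinit zh hzh; rewrite e in pos; rewrite Rplus_0_r Rmult_0_l in pos; lra.
  have sD : sh < D.
    case: (Req_dec sh D) => [e|]; last by lra.
    have := hmax1 zh sh hzh hsh; rewrite -/M1 Rmult_0_l => hm.
    have : G * (Rmax 0 (sh - s') * Rmax 0 (sh - s')) = m1 + 1.
      by rewrite e Rmax_right; [rewrite /G; field; lra|lra].
    lra.
  have [q [X [K3 [L [sX [K3p [Lp [hA3 [hBL hstr]]]]]]]]] := hjet zh sh zlt (conj s0 sD).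
  (* Adding [2 al I] to the Hessian costs at most [2 al n <= eps0 / 2] in the trace. It gives
     [al |y|^2], half of which absorbs the cubic remainder ([p5]) and half the product of the
     increments of [s] and [B] ([p6]). *)
  pose al := eps0 / (4 * (INR n + 1)).
  have np := pos_INR n.
  have alp : 0 < al by apply: Rdiv_lt_0_compat; lra.
  have ale : al * (INR n + 1) = eps0 / 4 by rewrite /al; field; lra.
  pose X' := fun i j => 1 * X i j + 2 * al * kdelta i j.
  pose pd := 2 * G * Rmax 0 (sh - s').
  have pdp : 0 <= pd by rewrite /pd; have := Rmax_l 0 (sh - s'); nra.
  pose r := Rmin (Rmin 1 (al / 2 / (K3 + 1))) (Rmin (Rmin sh (D - sh)) (rho - vnorm zh)).
  have rp : 0 < r.
    by rewrite /r; do 3 (try apply: Rmin_pos); try lra; apply: Rdiv_lt_0_compat; lra.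
  have [||||eta [had hle]] := hj zh (t1 + sh) _ (B zh + pd) q X' (G + L * L / (2 * al)) r.
  - lra.
  - by apply: symm_lin => //; apply: symm_id.
  - exact: rp.
  - move=> x t ht hx htt.
    pose y := vsub x zh; have ex : x = vadd zh y by rewrite /y; vext.
    have r1 : r <= 1 by apply: Rle_trans (Rmin_l _ _) (Rmin_l _ _).
    have r2 : r <= al / 2 / (K3 + 1) by apply: Rle_trans (Rmin_l _ _) (Rmin_r _ _).
    have r3 : r <= sh by apply: Rle_trans (Rmin_r _ _) (Rle_trans _ _ _ (Rmin_l _ _) (Rmin_l _ _)).
    have r4 : r <= D - sh by apply: Rle_trans (Rmin_r _ _) (Rle_trans _ _ _ (Rmin_l _ _) (Rmin_r _ _)).
    have r5 : r <= rho - vnorm zh by apply: Rle_trans (Rmin_r _ _) (Rmin_r _ _).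
    pose s := t - t1; have et : t = t1 + s by rewrite /s; ring.
    have ed : t - (t1 + sh) = s - sh by rewrite /s; ring.
    rewrite ed in htt *.
    have [hs1 hs2] := Rabs_def2 _ _ htt.
    rewrite -/y in hx *.
    have hx1 : vnorm x <= rho by rewrite ex; have := vnorm_add zh y; lra.
    have := hmax x s hx1 ltac:(lra).
    have := hA3 y ltac:(lra); have := hBL y ltac:(lra); rewrite -ex -et.
    have := @Rmax0_sq_step sh s' s G (Rlt_le _ _ Gp); rewrite -/pd.
    rewrite /X' qform_lin qform_id.
    move=> p1 p2 p3 p4.
    have y0 := vnorm_ge0 y; have yy := vnorm_sq y.
    have p5 : K3 * (vnorm y * dot y y) <= al / 2 * dot y y.
      have e1 : al / 2 / (K3 + 1) * (K3 + 1) = al / 2 by field; lra.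
      have : vnorm y * K3 <= al / 2 by nra.
      have := dot_ge0 y; nra.
    have p6 : (s - sh) * (B x - B zh) <= al / 2 * dot y y + L * L / (2 * al) * ((s - sh) * (s - sh)).
      have e2 : L * L / (2 * al) = 2 * al * (L / (2 * al)) * (L / (2 * al)) by field; lra.
      have e3 : 2 * al * (L / (2 * al)) = L by field; lra.
      set c := L / (2 * al) in e2 e3 *; rewrite e2 -yy.
      have := Rle_abs ((s - sh) * (B x - B zh)); rewrite Rabs_mult.
      have a0 := Rabs_pos (s - sh); have a1 : Rabs (s - sh) * Rabs (s - sh) = (s - sh) * (s - sh).
        by rewrite -Rabs_mult Rabs_pos_eq //; exact: Rle_0_sqr.
      rewrite -a1; set a := Rabs (s - sh) in a0 a1 *; set b := Rabs (B x - B zh) in p2 *.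
      have h4 : a * b <= a * (L * vnorm y) by apply: Rmult_le_compat_l.
      have h5 : 0 <= al / 2 * ((vnorm y - 2 * c * a) * (vnorm y - 2 * c * a)).
        by apply: Rmult_le_pos; [lra|exact: Rle_0_sqr].
      have h6 : a * (L * vnorm y) = 2 * al * c * a * vnorm y by rewrite -e3; ring.
      move=> h7; nra.
    lra.
  have h1 := hstr eta had.
  have h2 : tr_perp eta X' <= tr_perp eta X + 2 * al * INR n.
    by rewrite /X' tr_perp_lin tr_perp_id; have := dot_ge0 eta; nra.
  nra.
(* The final time follows from earlier times by continuity of [w] in time. *)
move=> z s hz hs; case: (Req_dec s D) => [->|ne]; last by apply: main => //; lra.
apply: Rnot_lt_le => hviol.
pose th := w z (t1 + D) - (A z + D * B z); have thp : 0 < th by rewrite /th; lra.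
have [d [dp hd]] := proj1 hcb z (t1 + D) ltac:(lra) (th / 2) ltac:(lra).
have b0 := Rabs_pos (B z).
pose e := Rmin (D / 2) (Rmin (d / 2) (th / 2 / (Rabs (B z) + 1))).
have ep : 0 < e by rewrite /e; do 2 (try apply: Rmin_pos); try lra; apply: Rdiv_lt_0_compat; lra.
have e1 : e <= D / 2 := Rmin_l _ _.
have e2 : e <= d / 2 := Rle_trans _ _ _ (Rmin_r _ _) (Rmin_l _ _).
have e3 : e <= th / 2 / (Rabs (B z) + 1) := Rle_trans _ _ _ (Rmin_r _ _) (Rmin_r _ _).
have := main z (D - e) hz ltac:(lra).
have := hd z (t1 + (D - e)) ltac:(lra).
have -> : vsub z z = vzero by vext.
rewrite vnorm0 => /(_ dp); rewrite (_ : t1 + (D - e) - (t1 + D) = - e); last by ring.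
rewrite Rabs_Ropp Rabs_pos_eq; last by lra.
move=> /(_ ltac:(lra)) /Rabs_def2 [f1 f2] f3.
have e4 : th / 2 / (Rabs (B z) + 1) * (Rabs (B z) + 1) = th / 2 by field; lra.
have := Rle_abs (B z); have := Rle_abs (- B z); rewrite Rabs_Ropp /th in thp e3 e4 f2 *; nra.
Qed.

End Comparison.

(** * Rough barriers: paraboloids and C^{1,1} functions *)

Section Barrier.
Variable n : nat.
Implicit Types (x y z p eta : 'I_n -> R) (w : ('I_n -> R) -> R -> R) (h : ('I_n -> R) -> R)
  (q : ('I_n -> R) -> 'I_n -> R).

(* A C^{1,1} function [h] with gradient [q], in quantitative form. *)
Definition C1 h q K := forall z y, Rabs (h (vadd z y) - h z - dot (q z) y) <= K * dot y y.

Lemma vcont_local_lip h : (forall z, exists L, forall y, vnorm y <= 1 ->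
  Rabs (h (vadd z y) - h z) <= L * vnorm y) -> vcont h.
Proof.
move=> hl z eps he; have [L hL] := hl z.
have L0 := Rabs_pos L; have L1 := Rle_abs L.
exists (Rmin 1 (eps / (Rabs L + 1))); split.
  by apply: Rmin_pos; [lra|apply: Rdiv_lt_0_compat; lra].
move=> y hy.
have h1 := Rlt_le_trans _ _ _ hy (Rmin_l _ _); have h2 := Rlt_le_trans _ _ _ hy (Rmin_r _ _).
have := hL (vsub y z) ltac:(lra).
have -> : vadd z (vsub y z) = y by vext.
have e : eps / (Rabs L + 1) * (Rabs L + 1) = eps by field; lra.
have := vnorm_ge0 (vsub y z); nra.
Qed.

Lemma C1_local_lip h q K : 0 <= K -> C1 h q K -> forall z y, vnorm y <= 1 ->
  Rabs (h (vadd z y) - h z) <= (vnorm (q z) + K) * vnorm y.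
Proof.
move=> hK hC z y hy; have := hC z y; have := CS (q z) y; have := vnorm_ge0 y.
rewrite -vnorm_sq => h0 h1 h2.
have -> : h (vadd z y) - h z = (h (vadd z y) - h z - dot (q z) y) + dot (q z) y by ring.
apply: Rle_trans (Rabs_triang _ _) _.
have : K * (vnorm y * vnorm y) <= K * vnorm y by apply: Rmult_le_compat_l => //; nra.
lra.
Qed.

Lemma C1_vcont h q K : 0 <= K -> C1 h q K -> vcont h.
Proof.
by move=> hK hC; apply: vcont_local_lip => z; exists (vnorm (q z) + K); apply: C1_local_lip.
Qed.

Lemma C1_quadratic al p K : 0 <= K ->
  C1 (fun y => al + dot p y + K * dot y y) (fun z => vadd p (vscal (2 * K) z)) K.
Proof.
move=> hK z y; rewrite !(dotDl, dotDr, dotZl, dotZr) (dotC y z).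
set r := (X in Rabs X); have -> : r = K * dot y y by rewrite /r; ring.
by rewrite Rabs_pos_eq; [lra|have := dot_ge0 y; nra].
Qed.

(** The paraboloid rises at speed [2 n K + 1]: its Hessian [2 K I] has trace [2 n K], and the extra
    [1] is the strictness margin of [comparison]. *)
Lemma quadratic_barrier w t1 al p K : jsub w -> 0 <= t1 -> 0 < K ->
  (forall y, w y t1 <= al + dot p y + K * dot y y) ->
  forall tau, 0 <= tau -> w vzero (t1 + tau) <= al + (2 * INR n * K + 1) * tau.
Proof.
move=> hw ht1 hK hb tau htau.
case: (Req_dec tau 0) => [->|tne].
  by have := hb vzero; rewrite !dot0r (Rplus_0_r t1); lra.
have [_ [M hM]] := proj1 hw.
have M0 : 0 <= M by apply: Rle_trans (Rabs_pos _) (hM vzero t1 ht1).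
have p0 := vnorm_ge0 p; have a0 := Rabs_pos al; have np := pos_INR n.
(* On a sphere this large the paraboloid exceeds the bound [M] of [w], so the lateral boundary
   condition holds. *)
pose rho := (vnorm p + Rabs al + M + 1) / K + 1.
have Kr : K * rho = vnorm p + Rabs al + M + 1 + K by rewrite /rho; field; lra.
have rho1 : 1 <= rho.
  have : 0 < (vnorm p + Rabs al + M + 1) / K by apply: Rdiv_lt_0_compat; lra.
  rewrite /rho; lra.
set B := 2 * INR n * K + 1.
pose A := fun y : 'I_n -> R => al + dot p y + K * dot y y.
have Bp : 0 < B by rewrite /B; nra.
have := @comparison n w t1 tau rho A (fun _ => B) 1 hw ht1.
move=> /(_ ltac:(lra) ltac:(lra) ltac:(lra)) cmp.
have := cmp _ _ _ _ _ vzero tau; rewrite /A !dot0r vnorm0 => cmp0.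
apply: Rle_trans (cmp0 _ _ _ _ _ _ _) _; try lra.
- exact: C1_vcont (Rlt_le _ _ hK) (C1_quadratic al p (Rlt_le _ _ hK)).
- by move=> z e he; exists 1; split; [lra|move=> y _; rewrite Rminus_diag Rabs_R0].
- move=> z s hz hs; exists (vadd p (vscal (2 * K) z)), (fun i j => 2 * K * kdelta i j + 0 * kdelta i j), 0, 0.
  split; first by apply: symm_lin; exact: symm_id.
  split; first lra. split; first lra.
  split.
    move=> y _; rewrite qform_lin qform_id !(dotDl, dotDr, dotZl, dotZr) (dotC y z); lra.
  split; first by move=> y _; rewrite Rminus_diag Rabs_R0; lra.
  move=> eta _; rewrite tr_perp_lin tr_perp_id /B; have := dot_ge0 eta; nra.
- by move=> z _; apply: hb.
- move=> z s hz hs; apply: Rle_trans (Rle_trans _ _ _ (Rle_abs _) (hM z (t1 + s) ltac:(lra))) _.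
  have := CS p z; rewrite hz -vnorm_sq hz => h1.
  have h2 : - (vnorm p * rho) <= dot p z by move: h1; split_Rabs; lra.
  have h3 : K * (rho * rho) = (vnorm p + Rabs al + M + 1 + K) * rho by rewrite -Kr; ring.
  have h4 : - Rabs al <= al by split_Rabs; lra.
  have : Rabs al + M <= (Rabs al + M + 1 + K) * rho by nra.
  have : 0 <= s * B by nra.
  nra.
Qed.

(** At each [z] the function [h] lies below a paraboloid touching it there; each paraboloid is used
    at its own centre only. *)
Lemma C1_barrier w t1 h q K : jsub w -> 0 <= t1 -> 0 < K -> C1 h q K ->
  (forall y, w y t1 <= h y) ->
  forall z tau, 0 <= tau -> w z (t1 + tau) <= h z + (2 * INR n * K + 1) * tau.
Proof.
move=> hw ht1 hK hC hb z tau htau.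
have hs := jsub_shift z 0 hw.
have -> : w z (t1 + tau) = w (vadd z vzero) (t1 + tau) + 0.
  have -> : vadd z vzero = z by vext.
  ring.
apply: (quadratic_barrier (p := q z) hs ht1 hK) => // y.
have := hC z y; have := hb (vadd z y); move=> h1 h2.
have := Rle_trans _ _ _ (Rle_abs _) h2; lra.
Qed.

End Barrier.

Lemma is_derive_remainder (f : R -> R) s d C :
  (forall h, Rabs (f (s + h) - f s - h * d) <= C * (h * h)) -> is_derive f s d.
Proof.
move=> hf; apply/is_derive_Reals => eps he.
pose A := Rabs C + 1; have Ap : 0 < A by rewrite /A; have := Rabs_pos C; lra.
have ep : 0 < eps / A by apply: Rdiv_lt_0_compat; lra.
exists (mkposreal _ ep) => h hn /= hh.
have -> : (f (s + h) - f s) / h - d = (f (s + h) - f s - h * d) / h by field.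
rewrite Rabs_mult Rabs_inv.
have hp := Rabs_pos_lt _ hn.
apply: (Rmult_lt_reg_r (Rabs h)) => //; rewrite Rmult_assoc Rinv_l; last lra.
rewrite Rmult_1_r; apply: Rle_lt_trans (hf h) _.
have hhE : h * h = Rabs h * Rabs h by rewrite -Rabs_mult Rabs_pos_eq //; exact: Rle_0_sqr.
have e1 : eps / A * A = eps by field; lra.
have c1 := Rle_abs C; rewrite hhE.
have : Rabs h * A < eps by rewrite -e1; apply: Rmult_lt_compat_r.
rewrite /A; nra.
Qed.

(** * Smoothing by box averages *)

Section IntervalAverage.
Implicit Types F G : R -> R.

Definition avgI F : R := /2 * RInt F (-1) 1.
Definition ctn F := forall s, continuous F s.

Lemma ctn_ex F a b : ctn F -> ex_RInt F a b.
Proof. by move=> h; apply: ex_RInt_continuous => z _; apply: h. Qed.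
Lemma avgI_add F G : ctn F -> ctn G -> avgI (fun s => F s + G s) = avgI F + avgI G.
Proof.
move=> hF hG; rewrite /avgI (RInt_plus F G); [|exact: ctn_ex|exact: ctn_ex].
by rewrite /plus /=; ring.
Qed.
Lemma avgI_scal c F : ctn F -> avgI (fun s => c * F s) = c * avgI F.
Proof.
move=> hF; rewrite /avgI (RInt_scal F); last exact: ctn_ex.
by rewrite /scal /= /mult /=; ring.
Qed.
Lemma avgI_const c : avgI (fun _ => c) = c.
Proof. by rewrite /avgI RInt_const /scal /= /mult /=; field. Qed.
Lemma avgI_bound F M : ctn F -> (forall s, -1 <= s <= 1 -> Rabs (F s) <= M) -> Rabs (avgI F) <= M.
Proof.
move=> hF hM; rewrite /avgI Rabs_mult Rabs_pos_eq; last lra.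
have := @abs_RInt_le_const F (-1) 1 M ltac:(lra) (ctn_ex _ _ hF) hM; lra.
Qed.
Lemma ctn_add F G : ctn F -> ctn G -> ctn (fun s => F s + G s).
Proof. by move=> hF hG s; apply: (@continuous_plus _ R_AbsRing R_NormedModule). Qed.
Lemma ctn_const c : ctn (fun _ => c).
Proof. by move=> s; apply: continuous_const. Qed.
Lemma ctn_scal c F : ctn F -> ctn (fun s => c * F s).
Proof. by move=> hF s; apply: (@continuous_scal_r _ R_AbsRing R_NormedModule). Qed.
Lemma ctn_id : ctn (fun s => s).
Proof. by move=> s; apply: continuous_id. Qed.
Lemma avgI_derive F f : (forall s, is_derive F s (f s)) -> ctn f -> avgI f = (F 1 - F (-1)) / 2.
Proof.
move=> hF hf; rewrite /avgI (is_RInt_unique f (-1) 1 (F 1 - F (-1))); first by field.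
by apply: (is_RInt_derive F f) => *; [apply: hF|apply: hf].
Qed.
Lemma avgI_id : avgI (fun s => s) = 0.
Proof.
rewrite (@avgI_derive (fun s => s * s / 2)); [field| |exact: ctn_id].
by move=> s; auto_derive => //; field.
Qed.
Lemma avgI_sum n (f : 'I_n -> R -> R) : (forall i, ctn (f i)) ->
  ctn (fun s => sumI (fun i => f i s)) /\
  avgI (fun s => sumI (fun i => f i s)) = sumI (fun i => avgI (f i)).
Proof.
move=> h; rewrite /sumI; elim: (index_enum _) => [|a L [IH1 IH2]].
  have -> : (fun s => \big[Rplus/0]_(i <- [::]) f i s) = fun _ => 0.
    by apply: functional_extensionality => s; rewrite big_nil.
  by split; [exact: ctn_const|rewrite avgI_const big_nil].
have -> : (fun s => \big[Rplus/0]_(i <- a :: L) f i s) =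
   fun s => f a s + \big[Rplus/0]_(i <- L) f i s.
  by apply: functional_extensionality => s; rewrite big_cons.
split; first exact: ctn_add.
by rewrite avgI_add // IH2 big_cons.
Qed.
End IntervalAverage.

Section Smoothing.
Variable n : nat.
Implicit Types (x y z v p eta : 'I_n -> R) (h H f : ('I_n -> R) -> R)
  (q Q : ('I_n -> R) -> 'I_n -> R).

(** For [|v| <= |y|], expanding [h (z + y + v)] from [z + y] and from [z], and [h (z + y)] from [z],
    gives errors [1 + 4 + 1 = 6] times [K |y|^2]. Then [v] is taken as plus or minus [|y|] times a
    basis vector. *)
Lemma gradient_lipschitz h q K : 0 <= K -> C1 h q K ->
  forall z y i, Rabs (q (vadd z y) i - q z i) <= 6 * K * vnorm y.
Proof.
move=> hK hC z y i; have y0 := vnorm_ge0 y; have yy := vnorm_sq y.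
have key : forall v, vnorm v <= vnorm y ->
    dot (q (vadd z y)) v - dot (q z) v <= 6 * K * (vnorm y * vnorm y).
  move=> v hv.
  have := hC (vadd z y) v; have := hC z (vadd y v); have := hC z y.
  have -> : vadd (vadd z y) v = vadd z (vadd y v) by vext.
  have d1 : dot v v <= vnorm y * vnorm y by rewrite -vnorm_sq; have := vnorm_ge0 v; nra.
  have d2 : dot (vadd y v) (vadd y v) <= 4 * (vnorm y * vnorm y).
    by rewrite -vnorm_sq; have := vnorm_add y v; have := vnorm_ge0 (vadd y v); nra.
  have e1 : K * dot v v <= K * (vnorm y * vnorm y) by nra.
  have e2 : K * dot (vadd y v) (vadd y v) <= 4 * K * (vnorm y * vnorm y) by nra.
  have e3 : K * dot y y = K * (vnorm y * vnorm y) by rewrite yy.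
  rewrite dotDr; move=> /Rabs_le_between h1 /Rabs_le_between h2 /Rabs_le_between h3; lra.
case: (Req_dec (vnorm y) 0) => [e|ne].
  have -> : vadd z y = z.
    apply: functional_extensionality => j; rewrite /vadd.
    have := coord_le_vnorm y j; rewrite e; have := Rabs_pos (y j); split_Rabs; lra.
  by rewrite Rminus_diag Rabs_R0 e; lra.
have yp : 0 < vnorm y by lra.
have ne1 : forall a, Rabs a = vnorm y -> vnorm (vscal a (ebas i)) <= vnorm y.
  by move=> a ha; rewrite vnorm_scal vnorm_ebas ha; lra.
have k1 := key _ (ne1 (vnorm y) (Rabs_pos_eq _ y0)).
have k2 := key _ (ne1 (- vnorm y) ltac:(by rewrite Rabs_Ropp Rabs_pos_eq)).
rewrite !dotZr !dot_ebas in k1 k2.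
apply: Rabs_le; split; nra.
Qed.

(** Interpolation between the uniform distance and the second-order bound: compare increments of
    length [s] in both directions of a coordinate axis. The step [s] is left to the caller. *)
Lemma gradient_close h q H Q K eps : C1 h q K -> C1 H Q K ->
  (forall z, Rabs (H z - h z) <= eps) ->
  forall z i s, 0 < s -> Rabs (Q z i - q z i) <= 2 * eps / s + 2 * K * s.
Proof.
move=> hC HC he z i s hs.
have key : forall a, Rabs a = s -> a * (Q z i - q z i) <= 2 * eps + 2 * K * (s * s).
  move=> a ha.
  have := hC z (vscal a (ebas i)); have := HC z (vscal a (ebas i)).
  have := he z; have := he (vadd z (vscal a (ebas i))).
  rewrite !dotZr !dotZl !dot_ebas (_ : ebas i i = 1); last by rewrite /ebas eqxx.
  have -> : a * (a * 1) = s * s.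
    by rewrite -ha -Rabs_mult Rabs_pos_eq; [ring|exact: Rle_0_sqr].
  move=> /Rabs_le_between h1 /Rabs_le_between h2 /Rabs_le_between h3 /Rabs_le_between h4; lra.
have k1 := key s (Rabs_pos_eq _ (Rlt_le _ _ hs)).
have k2 := key (-s) ltac:(by rewrite Rabs_Ropp Rabs_pos_eq //; lra).
have e : s * (2 * eps / s + 2 * K * s) = 2 * eps + 2 * K * (s * s) by field; lra.
apply: Rabs_le; split; nra.
Qed.

Definition box v f z : R := avgI (fun s => f (vadd z (vscal s v))).

Lemma vcont_ctn f z v : vcont f -> ctn (fun s => f (vadd z (vscal s v))).
Proof.
move=> hf s; apply/continuity_pt_filterlim => eps he.
have [d [dp hd]] := hf (vadd z (vscal s v)) eps he.
have v0 := vnorm_ge0 v.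
exists (d / (vnorm v + 1)); split; first by apply: Rdiv_lt_0_compat; lra.
move=> t [_ /=]; rewrite /R_dist => ht; apply: hd.
have -> : vsub (vadd z (vscal t v)) (vadd z (vscal s v)) = vscal (t - s) v by vext.
rewrite vnorm_scal.
have e : d / (vnorm v + 1) * (vnorm v + 1) = d by field; lra.
have := Rabs_pos (t - s); rewrite /Rdist in ht; nra.
Qed.

Lemma lip_vcont f L : (forall z y, Rabs (f (vadd z y) - f z) <= L * vnorm y) -> vcont f.
Proof. by move=> hL; apply: vcont_local_lip => z; exists L => y _; apply: hL. Qed.

Lemma C1_grad_vcont h q K i : 0 <= K -> C1 h q K -> vcont (fun z => q z i).
Proof. by move=> hK hC; apply: (@lip_vcont _ (6 * K)) => z y; apply: gradient_lipschitz hC _ _ _. Qed.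

Lemma C1_box v h q K : 0 <= K -> C1 h q K -> C1 (box v h) (fun z i => box v (fun x => q x i) z) K.
Proof.
move=> hK hC z y.
have ch : forall z, ctn (fun s => h (vadd z (vscal s v))) by move=> z'; apply: vcont_ctn; apply: C1_vcont hC.
have cq : forall i, ctn (fun s => q (vadd z (vscal s v)) i).
  by move=> i; apply: (@vcont_ctn (fun x => q x i)); apply: C1_grad_vcont hC.
have cqy : forall i, ctn (fun s => y i * q (vadd z (vscal s v)) i) by move=> i; apply: ctn_scal.
have [c1 c2] := avgI_sum cqy.
have -> : dot (fun i => box v (fun x => q x i) z) y =
    avgI (fun s => sumI (fun i => y i * q (vadd z (vscal s v)) i)).
  by rewrite c2; apply: sumI_ext => i; rewrite avgI_scal // /box; ring.
have -> : box v h (vadd z y) - box v h z - avgI (fun s => sumI (fun i => y i * q (vadd z (vscal s v)) i)) =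
  avgI (fun s => (h (vadd (vadd z y) (vscal s v)) + (-1) * h (vadd z (vscal s v))) +
    (-1) * sumI (fun i => y i * q (vadd z (vscal s v)) i)).
  rewrite !avgI_add ?avgI_scal //; do ?[apply: ctn_scal|apply: ctn_add]; rewrite // /box; ring.
apply: avgI_bound; first by do ?[apply: ctn_scal|apply: ctn_add].
move=> s _; have := hC (vadd z (vscal s v)) y.
have -> : vadd (vadd z (vscal s v)) y = vadd (vadd z y) (vscal s v) by vext.
have -> : dot (q (vadd z (vscal s v))) y = sumI (fun i => y i * q (vadd z (vscal s v)) i).
  by apply: sumI_ext => i; ring.
by move=> hh; apply: Rle_trans hh; right; congr Rabs; ring.
Qed.

Lemma is_derive_line h q K z v s : C1 h q K ->
  is_derive (fun s => h (vadd z (vscal s v))) s (dot (q (vadd z (vscal s v))) v).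
Proof.
move=> hC; apply: (@is_derive_remainder _ _ _ (K * dot v v)) => t.
have := hC (vadd z (vscal s v)) (vscal t v).
have -> : vadd (vadd z (vscal s v)) (vscal t v) = vadd z (vscal (s + t) v) by vext.
by rewrite !dotZr dotZl => hh; apply: Rle_trans hh _; right; ring.
Qed.

(** The linear part of the expansion averages to zero over the symmetric segment. *)
Lemma box_close v h q K : 0 <= K -> C1 h q K -> forall z, Rabs (box v h z - h z) <= K * dot v v.
Proof.
move=> hK hC z; have v0 := dot_ge0 v.
have ch : ctn (fun s => h (vadd z (vscal s v))) by apply: vcont_ctn; apply: C1_vcont hC.
have -> : box v h z - h z = avgI (fun s => h (vadd z (vscal s v)) + ((-1) * h z + (- dot (q z) v) * s)).
  rewrite avgI_add //; last by apply: ctn_add; [exact: ctn_const|apply: ctn_scal; exact: ctn_id].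
  rewrite avgI_add; [|exact: ctn_const|apply: ctn_scal; exact: ctn_id].
  rewrite avgI_const avgI_scal; last exact: ctn_id.
  by rewrite avgI_id /box; ring.
apply: avgI_bound.
  by apply: ctn_add => //; apply: ctn_add; [exact: ctn_const|apply: ctn_scal; exact: ctn_id].
move=> s hs; have := hC z (vscal s v); rewrite !dotZr dotZl => hh.
have : K * (s * (s * dot v v)) <= K * dot v v.
  by apply: Rmult_le_compat_l => //; have := Rmult_le_compat_r _ _ 1 v0 (_ : s * s <= 1); nra.
by move=> h2; apply: Rle_trans h2; apply: Rle_trans hh; right; congr Rabs; ring.
Qed.

Lemma box_partial h Q K rho i z : 0 <= K -> 0 < rho -> C1 h Q K ->
  box (vscal rho (ebas i)) (fun x => Q x i) z =
  (h (vadd z (vscal rho (ebas i))) - h (vadd z (vscal (- rho) (ebas i)))) / (2 * rho).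
Proof.
move=> hK hr hC; set v := vscal rho (ebas i).
have c : ctn (fun s => Q (vadd z (vscal s v)) i).
  by apply: (@vcont_ctn (fun x => Q x i)); apply: C1_grad_vcont hC.
have d s : is_derive (fun s => h (vadd z (vscal s v))) s (rho * Q (vadd z (vscal s v)) i).
  by have := is_derive_line z v s hC; rewrite /v dotZr dot_ebas.
have := avgI_derive d (@ctn_scal rho _ c); rewrite avgI_scal // -/(box v (fun x => Q x i) z).
have -> : vscal 1 v = v by vext.
have -> : vscal (-1) v = vscal (- rho) (ebas i) by rewrite /v; vext.
by move=> e; apply: (Rmult_eq_reg_l rho); [rewrite e; field; lra|lra].
Qed.

Lemma C1_diff_quotient h Q K rho v1 v2 : 0 < rho -> C1 h Q K ->
  C1 (fun z => (h (vadd z v1) - h (vadd z v2)) / (2 * rho))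
     (fun z => vscal (/ (2 * rho)) (vsub (Q (vadd z v1)) (Q (vadd z v2)))) (K / rho).
Proof.
move=> hr hC z y; have := hC (vadd z v1) y; have := hC (vadd z v2) y.
have e : forall v, vadd (vadd z y) v = vadd (vadd z v) y by move=> v; vext.
rewrite !e dotZl dotBl => /Rabs_le_between h1 /Rabs_le_between h2.
have ip : 0 < / (2 * rho) by apply: Rinv_0_lt_compat; lra.
have e1 : K / rho * dot y y = / (2 * rho) * (2 * (K * dot y y)) by field; lra.
rewrite e1.
set a := h (vadd (vadd z v1) y) in h2 *; set b := h (vadd (vadd z v2) y) in h1 *.
set r := (X in Rabs X).
have -> : r = / (2 * rho) * ((a - h (vadd z v1) - dot (Q (vadd z v1)) y)
   - (b - h (vadd z v2) - dot (Q (vadd z v2)) y)) by rewrite /r; field; lra.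
rewrite Rabs_mult Rabs_pos_eq; last lra.
by apply: Rmult_le_compat_l; [lra|apply: Rabs_le; split; lra].
Qed.

(* Averaging over a segment in direction [i] turns the [i]-th partial derivative into a difference
   quotient of a [C1] function; averaging in the remaining directions preserves this. *)
Lemma smooth_coords h q K rho (L : seq 'I_n) : 0 <= K -> 0 < rho -> C1 h q K ->
  exists H Q r, C1 H Q K /\ (forall z, Rabs (H z - h z) <= INR (size L) * (K * (rho * rho))) /\
    forall i, i \in L -> C1 (fun z => Q z i) (r i) (K / rho).
Proof.
move=> hK hr hC; have Kr : 0 <= K / rho by apply: Rdiv_le_0_compat.
elim: L => [|a L [H [Q [r [HC [Hc Hr]]]]]].
  exists h, q, (fun _ _ => vzero); split=> //; split=> // z.
  by rewrite Rminus_diag Rabs_R0 /=; lra.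
pose v : 'I_n -> R := vscal rho (ebas a).
exists (box v H), (fun z i => box v (fun x => Q x i) z),
  (fun i => if i == a then
     fun z => vscal (/ (2 * rho)) (vsub (Q (vadd z v)) (Q (vadd z (vscal (- rho) (ebas a)))))
     else fun z j => box v (fun x => r i x j) z).
split; first exact: C1_box.
split.
  move=> z; rewrite (_ : size (a :: L) = S (size L)) // S_INR.
  have := box_close v hK HC z; have := Hc z.
  have -> : dot v v = rho * rho.
    by rewrite /v dotZl dotZr dot_ebas /ebas eqxx; ring.
  have := Rabs_triang (box v H z - H z) (H z - h z).
  rewrite (_ : box v H z - H z + (H z - h z) = box v H z - h z); [lra|ring].
move=> i; rewrite inE; case: eqP => [-> _|_ /= hi].
  have -> : (fun z => box v (fun x => Q x a) z) =
     fun z => (H (vadd z v) - H (vadd z (vscal (- rho) (ebas a)))) / (2 * rho).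
    by apply: functional_extensionality => z; apply: box_partial HC.
  exact: C1_diff_quotient.
exact: (C1_box v Kr (Hr i hi)).
Qed.

(* The factor [6 K] is the Lipschitz constant of the gradient of a function in [C1 _ _ K]. *)
Definition C2 H Q (X : ('I_n -> R) -> 'I_n -> 'I_n -> R) K K3 :=
  C1 H Q K /\ (forall z, symm (X z)) /\ (forall z i j, Rabs (X z i j) <= 6 * K) /\
  (forall z y i j, Rabs (X (vadd z y) i j - X z i j) <= K3 * vnorm y) /\
  (forall z y, Rabs (H (vadd z y) - H z - dot (Q z) y - /2 * qform (X z) y) <= K3 * (vnorm y * dot y y)).

(** Difference quotients of [Q i] are at most [6 K] and approximate [r] up to [K3 s], with [s]
    arbitrary. So the Hessian bound is unaffected by the smoothing scale, while [K3] blows up with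
    it; only the time step of the discrete flow has to follow [K3]. *)
Lemma C1_second_bound H Q K K3 (r : ('I_n -> R) -> 'I_n -> R) i : 0 <= K -> 0 <= K3 ->
  C1 H Q K -> C1 (fun z => Q z i) r K3 -> forall z j, Rabs (r z j) <= 6 * K.
Proof.
move=> hK hK3 hC hr z j.
have key : forall s, 0 < s -> Rabs (r z j) <= 6 * K + K3 * s.
  move=> s hs; have := hr z (vscal s (ebas j)); have := gradient_lipschitz hK hC z (vscal s (ebas j)) i.
  rewrite vnorm_scal vnorm_ebas !dotZr dotZl !dot_ebas (_ : ebas j j = 1); last by rewrite /ebas eqxx.
  rewrite (Rabs_pos_eq s); last lra.
  move=> h1 h2; apply: (Rmult_le_reg_l s) => //.
  have -> : s * Rabs (r z j) = Rabs (s * r z j) by rewrite Rabs_mult (Rabs_pos_eq s) //; lra.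
  by move: h1 h2; split_Rabs; nra.
apply: Rnot_lt_le => hlt.
have := key ((Rabs (r z j) - 6 * K) / 2 / (K3 + 1)) ltac:(do 2 (apply: Rdiv_lt_0_compat; last lra); lra).
set s := _ / _ / _; have : s * (K3 + 1) = (Rabs (r z j) - 6 * K) / 2 by rewrite /s; field; lra.
have : 0 < s by rewrite /s; do 2 (apply: Rdiv_lt_0_compat; last lra); lra.
nra.
Qed.

(** Symmetrizing the derivative of the gradient avoids any theorem on mixed derivatives, because a
    quadratic form does not see the antisymmetric part. In [n + 6], the [n] comes from summing the
    Taylor remainders over coordinates and the [6] from [gradient_lipschitz]. *)
Lemma C2_of_C1 H Q (r : 'I_n -> ('I_n -> R) -> 'I_n -> R) K K3 : 0 <= K -> 0 <= K3 ->
  C1 H Q K -> (forall i, C1 (fun z => Q z i) (r i) K3) ->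
  C2 H Q (fun z i j => (r i z j + r j z i) / 2) K ((INR n + 6) * K3).
Proof.
move=> hK hK3 hC hr; have np := pos_INR n.
split=> //; split; first by move=> z i j; rewrite Rplus_comm.
split.
  move=> z i j; have := C1_second_bound hK hK3 hC (hr i) z j; have := C1_second_bound hK hK3 hC (hr j) z i.
  by move=> /Rabs_le_between h1 /Rabs_le_between h2; apply: Rabs_le; split; lra.
split.
  move=> z y i j; have := gradient_lipschitz hK3 (hr i) z y j; have := gradient_lipschitz hK3 (hr j) z y i.
  have := vnorm_ge0 y; move=> y0 /Rabs_le_between h1 /Rabs_le_between h2.
  have : 0 <= INR n * K3 * vnorm y by apply: Rmult_le_pos => //; apply: Rmult_le_pos.
  by move=> h3; apply: Rabs_le; split; lra.
move=> z y.
pose rr := sumI (fun i => y i * dot (r i z) y).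
have -> : qform (fun i j => (r i z j + r j z i) / 2) y = rr.
  rewrite (_ : rr = /2 * rr + /2 * rr); last by field.
  rewrite {1}/rr {1}(_ : rr = sumI (fun i => sumI (fun j => r j z i * y i * y j))); last first.
    rewrite sumI_exch /rr; apply: sumI_ext => i; rewrite -sumI_scal.
    by apply: sumI_ext => j; ring.
  rewrite -!sumI_scal -sumI_add; apply: sumI_ext => i.
  by rewrite -!sumI_scal -sumI_add; apply: sumI_ext => j; field.
(* The mean value theorem for the second-order remainder along the segment reduces it to first-order
   remainders of the gradient. *)
pose g s := H (vadd z (vscal s y)) - H z - s * dot (Q z) y - /2 * (s * s) * rr.
pose g' s := dot (Q (vadd z (vscal s y))) y - dot (Q z) y - s * rr.
have dg s : is_derive g s (g' s).
  have d1 := is_derive_line z y s hC.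
  have d2 : is_derive (fun s => - H z - s * dot (Q z) y - /2 * (s * s) * rr) s (- dot (Q z) y - s * rr).
    by auto_derive => //; field.
  have := is_derive_plus _ _ _ _ _ d1 d2; rewrite /plus /= => d3.
  have -> : g' s = dot (Q (vadd z (vscal s y))) y + (- dot (Q z) y - s * rr) by rewrite /g'; ring.
  by apply: is_derive_ext d3 => t; rewrite /g /=; ring.
have [||c [hc hg]] := @MVT_gen g 0 1 g'.
- by move=> s _; apply: dg.
- by move=> s _; apply/continuity_pt_filterlim; apply: ex_derive_continuous; exists (g' s).
rewrite Rmin_left in hc; last lra; rewrite Rmax_right in hc; last lra.
have g1 : g 1 = H (vadd z y) - H z - dot (Q z) y - / 2 * rr.
  rewrite /g (_ : vscal 1 y = y); [ring|vext].
have g0 : g 0 = 0.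
  rewrite /g (_ : vadd z (vscal 0 y) = z); [ring|vext].
rewrite -g1; have -> : g 1 = g' c by lra.
have -> : g' c = sumI (fun i => y i * (Q (vadd z (vscal c y)) i - Q z i - dot (r i z) (vscal c y))).
  rewrite /g' /rr (_ : forall a b d, a - b - d = a + (-1) * b + (-1) * d); last by move=> a b d; ring.
  rewrite /dot -!sumI_scal -!sumI_add; apply: sumI_ext => i.
  have -> : sumI (fun j => r i z j * vscal c y j) = c * sumI (fun j => r i z j * y j).
    by rewrite -sumI_scal; apply: sumI_ext => j; rewrite /vscal; ring.
  ring.
have y0 := vnorm_ge0 y; have yy := dot_ge0 y.
have pos : 0 <= K3 * (vnorm y * dot y y) by do 2 apply: Rmult_le_pos => //.
apply: Rle_trans (_ : INR n * (vnorm y * (K3 * dot y y)) <= _); last by lra.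
apply: sumI_bound => i; rewrite Rabs_mult.
apply: Rmult_le_compat; [exact: Rabs_pos|exact: Rabs_pos|exact: coord_le_vnorm|].
apply: Rle_trans (hr i z (vscal c y)) _; apply: Rmult_le_compat_l => //.
rewrite dotZl dotZr; have : c * c <= 1 by nra. nra.
Qed.

Lemma smoothing h q K rho : 0 <= K -> 0 < rho -> C1 h q K ->
  exists H Q X K3, 0 <= K3 /\ C2 H Q X K K3 /\ forall z, Rabs (H z - h z) <= INR n * (K * (rho * rho)).
Proof.
move=> hK hr hC; have [H [Q [r [HC [Hc Hr]]]]] := smooth_coords (enum 'I_n) hK hr hC.
have Kr : 0 <= K / rho by apply: Rdiv_le_0_compat.
exists H, Q, (fun z i j => (r i z j + r j z i) / 2), ((INR n + 6) * (K / rho)).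
split; first by apply: Rmult_le_pos => //; have := pos_INR n; lra.
split; first by apply: C2_of_C1 => // i; apply: Hr; rewrite mem_enum.
by move=> z; have := Hc z; rewrite size_enum_ord.
Qed.

End Smoothing.

(** * Discrete heat flow orthogonal to a direction *)

Section HeatStep.
Variable n : nat.
Hypothesis np : 0 < INR n.
Implicit Types (x y z p q eta : 'I_n -> R) (H h : ('I_n -> R) -> R) (Q : ('I_n -> R) -> 'I_n -> R)
  (X : ('I_n -> R) -> 'I_n -> 'I_n -> R).

(* The vectors [perp_dir p i], [i < n], are the projections of the canonical basis onto the
   hyperplane orthogonal to [p]. They form a tight frame: [sum_i v_i v_i^T] is the projection, so no
   orthonormal basis of the hyperplane is needed. *)
Definition perp_dir p (i : 'I_n) : 'I_n -> R := vadd (ebas i) (vscal (- (p i / dot p p)) p).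
(** The mean curvature operator with its direction frozen at [p]. *)
Definition trP p (Y : 'I_n -> 'I_n -> R) : R :=
  sumI (fun i => sumI (fun j => (kdelta i j - p i * p j / dot p p) * Y i j)).

Lemma perp_dir_dot p i j : dot p p <> 0 -> dot (perp_dir p i) (perp_dir p j) = kdelta i j - p i * p j / dot p p.
Proof.
move=> hp; rewrite /perp_dir !(dotDl, dotDr, dotZl, dotZr) !dot_ebas (dotC (ebas i) p) dot_ebas.
by rewrite /ebas /kdelta (eq_sym j i); case: eqP => _; field; exact: hp.
Qed.

Lemma perp_dir_sym p i k : perp_dir p i k = perp_dir p k i.
Proof. rewrite /perp_dir /vadd /vscal /ebas (eq_sym k i); rewrite /Rdiv; ring. Qed.

Lemma perp_dir_norm p i : 0 < dot p p -> vnorm (perp_dir p i) <= 1.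
Proof.
move=> hp; apply: vnorm_le; first lra.
rewrite perp_dir_dot; last lra.
have : 0 <= p i * p i / dot p p by apply: Rdiv_le_0_compat => //; exact: Rle_0_sqr.
rewrite /kdelta eqxx; lra.
Qed.

Variables (c : R) (p : 'I_n -> R).
Hypotheses (c0 : 0 <= c) (pp : 0 < dot p p).

Definition avgT (F : ('I_n -> R) -> R) : R :=
  / (2 * INR n) * sumI (fun i => F (vscal c (perp_dir p i)) + F (vscal (- c) (perp_dir p i))).
(** One step of a random walk with jumps [c v_i] and [- c v_i], each of probability [1 / (2 n)]. For
    [c^2 = 2 n D] it is an explicit scheme of time step [D] for the heat equation of [trP p]. *)
Definition heat_step H z : R := avgT (fun s => H (vadd z s)).

Lemma avgT_ext F G : (forall s, F s = G s) -> avgT F = avgT G.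
Proof. by move=> h; rewrite /avgT; congr (_ * _); apply: sumI_ext => i; rewrite !h. Qed.
Lemma avgT_lin a b F G : avgT (fun s => a * F s + b * G s) = a * avgT F + b * avgT G.
Proof.
rewrite /avgT -!Rmult_assoc !(Rmult_comm _ (/ _)) !Rmult_assoc -Rmult_plus_distr_l; congr (_ * _).
by rewrite -!sumI_scal -sumI_add; apply: sumI_ext => i; ring.
Qed.
Lemma avgT_const a : avgT (fun _ => a) = a.
Proof. by rewrite /avgT sumI_const; field; lra. Qed.
Lemma avgT_odd F : (forall s, F (vscal (-1) s) = - F s) -> avgT F = 0.
Proof.
move=> h; rewrite /avgT (_ : sumI _ = 0); first ring.
rewrite -[RHS](Rmult_0_r (INR n)) -sumI_const; apply: sumI_ext => i.
have -> : vscal (- c) (perp_dir p i) = vscal (-1) (vscal c (perp_dir p i)) by vext.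
by rewrite h; ring.
Qed.
Lemma avgT_bound F M : (forall s, vnorm s <= c -> Rabs (F s) <= M) -> Rabs (avgT F) <= M.
Proof.
move=> h; rewrite /avgT Rabs_mult Rabs_pos_eq; last by left; apply: Rinv_0_lt_compat; lra.
have nb : forall a i, Rabs a = c -> vnorm (vscal a (perp_dir p i)) <= c.
  move=> a i ha; rewrite vnorm_scal ha; have := perp_dir_norm i pp; nra.
apply: Rle_trans (_ : / (2 * INR n) * (INR n * (2 * M)) <= _); last by right; field; lra.
apply: Rmult_le_compat_l; first by left; apply: Rinv_0_lt_compat; lra.
apply: sumI_bound => i; apply: Rle_trans (Rabs_triang _ _) _.
have := h _ (nb c i (Rabs_pos_eq _ c0)).
have := h _ (nb (- c) i ltac:(by rewrite Rabs_Ropp Rabs_pos_eq)); lra.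
Qed.
Lemma avgT_sum (F : 'I_n -> ('I_n -> R) -> R) :
  avgT (fun s => sumI (fun i => F i s)) = sumI (fun i => avgT (F i)).
Proof.
rewrite /avgT [RHS]sumI_scal; congr (_ * _).
by rewrite sumI_exch; apply: sumI_ext => i; rewrite -sumI_add.
Qed.
Lemma avgT_dot (F : ('I_n -> R) -> 'I_n -> R) y :
  dot (fun k => avgT (fun s => F s k)) y = avgT (fun s => dot (F s) y).
Proof.
rewrite /dot avgT_sum; apply: sumI_ext => i.
have := avgT_lin (y i) 0 (fun s => F s i) (fun _ => 0); rewrite avgT_const => e.
rewrite Rmult_comm; transitivity (y i * avgT (fun s => F s i) + 0 * 0); first ring.
by rewrite -e; apply: avgT_ext => s; ring.
Qed.
Lemma avgT_qform (F : ('I_n -> R) -> 'I_n -> 'I_n -> R) y :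
  qform (fun k l => avgT (fun s => F s k l)) y = avgT (fun s => qform (F s) y).
Proof.
rewrite /qform avgT_sum; apply: sumI_ext => i; rewrite avgT_sum; apply: sumI_ext => j.
have := avgT_lin (y i * y j) 0 (fun s => F s i j) (fun _ => 0); rewrite avgT_const => e.
transitivity (y i * y j * avgT (fun s => F s i j) + 0 * 0); first ring.
by rewrite -e; apply: avgT_ext => s; ring.
Qed.

Definition stepQ Q z : 'I_n -> R := fun k => avgT (fun s => Q (vadd z s) k).
Definition stepX X z : 'I_n -> 'I_n -> R := fun k l => avgT (fun s => X (vadd z s) k l).

Lemma vaddAC z s y : vadd (vadd z y) s = vadd (vadd z s) y.
Proof. vext. Qed.

(** A step averages translates, so the constants do not deteriorate and may be used after any number
    of iterations. The same holds for [C2] below. *)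
Lemma heat_step_C1 H Q K : C1 H Q K -> C1 (heat_step H) (stepQ Q) K.
Proof.
move=> hC z y; rewrite /stepQ (@avgT_dot (fun s => Q (vadd z s))).
have -> : heat_step H (vadd z y) - heat_step H z - avgT (fun s => dot (Q (vadd z s)) y) =
  avgT (fun s => 1 * (1 * H (vadd (vadd z y) s) + (-1) * H (vadd z s)) + (-1) * dot (Q (vadd z s)) y).
  by rewrite avgT_lin (avgT_lin 1 (-1)) /heat_step; ring.
apply: avgT_bound => s _; rewrite vaddAC; apply: Rle_trans (hC (vadd z s) y).
by right; congr Rabs; ring.
Qed.

Lemma heat_step_C2 H Q X K K3 : C2 H Q X K K3 -> C2 (heat_step H) (stepQ Q) (stepX X) K K3.
Proof.
move=> [hC [hs [hb [hl ht]]]]; split; first exact: heat_step_C1.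
split; first by move=> z i j; apply: avgT_ext => s; apply: hs.
split; first by move=> z i j; apply: avgT_bound => s _; apply: hb.
split.
  move=> z y i j.
  have -> : stepX X (vadd z y) i j - stepX X z i j =
     avgT (fun s => 1 * X (vadd (vadd z y) s) i j + (-1) * X (vadd z s) i j).
    by rewrite avgT_lin /stepX; ring.
  apply: avgT_bound => s _; rewrite vaddAC; apply: Rle_trans (hl (vadd z s) y i j).
  by right; congr Rabs; ring.
move=> z y; rewrite /stepQ (@avgT_dot (fun s => Q (vadd z s))) (@avgT_qform (fun s => X (vadd z s))).
have -> : heat_step H (vadd z y) - heat_step H z - avgT (fun s => dot (Q (vadd z s)) y)
   - / 2 * avgT (fun s => qform (X (vadd z s)) y) =
  avgT (fun s => 1 * (1 * (1 * H (vadd (vadd z y) s) + (-1) * H (vadd z s)) + (-1) * dot (Q (vadd z s)) y)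
     + (- / 2) * qform (X (vadd z s)) y).
  by rewrite avgT_lin (avgT_lin 1 (-1)) (avgT_lin 1 (-1)) /heat_step; ring.
apply: avgT_bound => s _; rewrite vaddAC; apply: Rle_trans (ht (vadd z s) y).
by right; congr Rabs; ring.
Qed.

Lemma stepX_close X K3 : 0 <= K3 ->
  (forall z y i j, Rabs (X (vadd z y) i j - X z i j) <= K3 * vnorm y) ->
  forall z i j, Rabs (stepX X z i j - X z i j) <= K3 * c.
Proof.
move=> hK hl z i j.
have -> : stepX X z i j - X z i j = avgT (fun s => 1 * X (vadd z s) i j + (-1) * X z i j).
  by rewrite avgT_lin avgT_const /stepX; ring.
apply: avgT_bound => s hs.
rewrite (_ : 1 * _ + _ = X (vadd z s) i j - X z i j); last by ring.
by apply: Rle_trans (hl z s i j) _; apply: Rmult_le_compat_l.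
Qed.

Lemma dot_oddr y s : dot y (vscal (-1) s) = - dot y s.
Proof. by rewrite dotZr; ring. Qed.

Lemma heat_step_close H Q K : 0 <= K -> C1 H Q K -> forall z, Rabs (heat_step H z - H z) <= K * (c * c).
Proof.
move=> hK hC z.
have -> : heat_step H z - H z =
   avgT (fun s => 1 * (1 * H (vadd z s) + (-1) * H z) + (-1) * dot (Q z) s).
  rewrite avgT_lin (avgT_lin 1 (-1)) avgT_const (avgT_odd (dot_oddr (Q z))) /heat_step; ring.
apply: avgT_bound => s hs; apply: Rle_trans (_ : K * dot s s <= _).
  by apply: Rle_trans (hC z s); right; congr Rabs; ring.
by apply: Rmult_le_compat_l => //; rewrite -vnorm_sq; have := vnorm_ge0 s; nra.
Qed.

Lemma avgT_half_qform (Y : 'I_n -> 'I_n -> R) D : c * c = 2 * INR n * D ->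
  avgT (fun s => /2 * qform Y s) = D * trP p Y.
Proof.
move=> hc; rewrite /avgT.
have -> : sumI (fun i => / 2 * qform Y (vscal c (perp_dir p i)) + / 2 * qform Y (vscal (- c) (perp_dir p i)))
  = c * c * sumI (fun i => qform Y (perp_dir p i)).
  by rewrite -sumI_scal; apply: sumI_ext => i; rewrite !qform_scal; field.
(* The tight frame identity: the matrix with rows [perp_dir p i] is symmetric and equals its own
   square. *)
have -> : sumI (fun i => qform Y (perp_dir p i)) = trP p Y.
  rewrite /qform sumI_exch /trP; apply: sumI_ext => k; rewrite sumI_exch; apply: sumI_ext => l.
  rewrite -perp_dir_dot; last lra.
  rewrite Rmult_comm /dot -sumI_scal; apply: sumI_ext => i.
  by rewrite (perp_dir_sym p k i) (perp_dir_sym p l i); ring.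
by rewrite hc; field; lra.
Qed.

(** The first-order term cancels between opposite jumps and the second-order one is [D trP]; only
    the cubic Taylor remainder is left. *)
Lemma heat_step_generator H Q X K K3 D : 0 <= K3 -> C2 H Q X K K3 -> c * c = 2 * INR n * D ->
  forall z, Rabs (heat_step H z - H z - D * trP p (X z)) <= K3 * (c * (c * c)).
Proof.
move=> hK [_ [_ [_ [_ ht]]]] hc z.
have -> : heat_step H z - H z - D * trP p (X z) =
   avgT (fun s => 1 * (1 * (1 * H (vadd z s) + (-1) * H z) + (-1) * dot (Q z) s) + (-1) * (/2 * qform (X z) s)).
  rewrite avgT_lin (avgT_lin 1 (-1)) (avgT_lin 1 (-1)) avgT_const (avgT_odd (dot_oddr (Q z))).
  rewrite (avgT_half_qform _ hc) /heat_step; ring.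
apply: avgT_bound => s hs; apply: Rle_trans (_ : K3 * (vnorm s * dot s s) <= _).
  by apply: Rle_trans (ht z s); right; congr Rabs; ring.
apply: Rmult_le_compat_l => //; have := vnorm_ge0 s; rewrite -vnorm_sq => s0.
apply: Rmult_le_compat => //; nra.
Qed.

End HeatStep.

(** * Comparison of the curvature flow with the discrete heat flow *)

Section Evolution.
Variable n : nat.
Hypothesis np : 0 < INR n.
Implicit Types (x y z p q eta : 'I_n -> R) (H h : ('I_n -> R) -> R) (Q : ('I_n -> R) -> 'I_n -> R)
  (X : ('I_n -> R) -> 'I_n -> 'I_n -> R).

Lemma Rabs_div_le u m a : 0 < a -> Rabs u <= m -> Rabs (u / a) <= m / a.
Proof.
move=> ha hu; have ia : 0 < / a by apply: Rinv_0_lt_compat.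
by rewrite /Rdiv Rabs_mult (Rabs_pos_eq (/ a)); [apply: Rmult_le_compat_r|]; lra.
Qed.

Definition near_direction p d th : Prop := forall q, (forall i, Rabs (q i - p i) <= d) ->
  (exists i, q i <> 0) /\
  forall i j, Rabs (q i / vnorm q * (q j / vnorm q) - p i * p j / dot p p) <= th.

(** The radius [d] depends on [p] through its length only. The choice of [m] keeps the two unit
    vectors within [2 m / a <= th / 2] in each coordinate, and a product of two coordinates doubles
    this; dividing by [n] passes from coordinates to the norm. *)
Lemma direction_close a th : 0 < a -> 0 < th -> exists d, 0 < d /\
  forall p, vnorm p = a -> near_direction p d th.
Proof.
move=> ha hth; pose m := Rmin (a / 2) (th * a / 4).
have mp : 0 < m by apply: Rmin_pos; nra.
have m1 : m <= a / 2 := Rmin_l _ _; have m2 : m <= th * a / 4 := Rmin_r _ _.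
exists (m / INR n); split; first exact: Rdiv_lt_0_compat.
move=> p hp q hq.
have dm : vnorm (vsub q p) <= m.
  have := vnorm_le_sup (x := vsub q p) (a := m / INR n) ltac:(left; exact: Rdiv_lt_0_compat) hq.
  by have -> : INR n * (m / INR n) = m by field; lra.
have tri1 : a <= vnorm q + m.
  have := vnorm_sub q (vsub q p); have -> : vsub q (vsub q p) = p by vext.
  by lra.
have tri2 : vnorm q <= a + m.
  have := vnorm_add p (vsub q p); have -> : vadd p (vsub q p) = q by vext.
  by lra.
have qp : 0 < vnorm q by lra.
split.
  apply: NNPP => hn; have q0 : q = vzero.
    by apply: functional_extensionality => i; apply: NNPP => hi; apply: hn; exists i.
  by rewrite q0 vnorm0 in qp; lra.
have comp : forall i, Rabs (q i / vnorm q - p i / a) <= 2 * m / a.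
  move=> i; have e : q i / vnorm q - p i / a = (q i - p i) / a + q i / vnorm q * ((a - vnorm q) / a).
    by field; lra.
  have h1 : Rabs (q i - p i) <= m by apply: Rle_trans (coord_le_vnorm (vsub q p) i) dm.
  have h2 : Rabs (q i / vnorm q) <= 1.
    have := Rabs_div_le qp (coord_le_vnorm q i); rewrite {2}/Rdiv Rinv_r; lra.
  have h3 : Rabs (a - vnorm q) <= m by apply: Rabs_le; split; lra.
  have h4 := Rabs_div_le ha h1; have h5 := Rabs_div_le ha h3.
  rewrite e; apply: Rle_trans (Rabs_triang _ _) _; rewrite Rabs_mult.
  have h6 := Rabs_pos ((a - vnorm q) / a).
  have -> : 2 * m / a = m / a + m / a by field; lra.
  nra.
move=> i j.
have bp : forall k, Rabs (p k / a) <= 1.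
  by move=> k; have := Rabs_div_le ha (coord_le_vnorm p k); rewrite hp {2}/Rdiv Rinv_r; lra.
have bq : forall k, Rabs (q k / vnorm q) <= 1.
  by move=> k; have := Rabs_div_le qp (coord_le_vnorm q k); rewrite {2}/Rdiv Rinv_r; lra.
have -> : p i * p j / dot p p = p i / a * (p j / a) by rewrite -vnorm_sq hp; field; lra.
have e : 2 * m / a <= th / 2.
  have -> : th / 2 = 2 * (th * a / 4) / a by field; lra.
  by apply: Rmult_le_compat_r; [left; apply: Rinv_0_lt_compat|]; lra.
set u := q i / vnorm q; set v := q j / vnorm q; set u' := p i / a; set v' := p j / a.
have -> : u * v - u' * v' = u * (v - v') + v' * (u - u') by ring.
apply: Rle_trans (Rabs_triang _ _) _; rewrite (Rabs_mult u) (Rabs_mult v').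
have := comp i; have := comp j; have := bq i; have := bp j; rewrite -/u -/v -/u' -/v'.
move=> b1 b2 b3 b4.
have := Rmult_le_compat _ _ _ _ (Rabs_pos u) (Rabs_pos (v - v')) b2 b3.
have := Rmult_le_compat _ _ _ _ (Rabs_pos v') (Rabs_pos (u - u')) b1 b4.
lra.
Qed.

Lemma tr_perp_close eta p Y K th : 0 <= K -> (forall i j, Rabs (Y i j) <= 6 * K) ->
  (forall i j, Rabs (eta i * eta j - p i * p j / dot p p) <= th) ->
  tr_perp eta Y <= trP p Y + INR n * (INR n * (th * (6 * K))).
Proof.
move=> hK hY he.
have := @dsum_bound n (fun i j => (p i * p j / dot p p - eta i * eta j) * Y i j) (th * (6 * K)) _.
have -> : sumI (fun i => sumI (fun j => (p i * p j / dot p p - eta i * eta j) * Y i j)) =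
  tr_perp eta Y - trP p Y.
  rewrite (_ : forall a b, a - b = a + (-1) * b); last by move=> a b; ring.
  rewrite /tr_perp /trP -sumI_scal -sumI_add; apply: sumI_ext => i.
  by rewrite -sumI_scal -sumI_add; apply: sumI_ext => j; ring.
move=> hh; have := Rle_trans _ _ _ (Rle_abs _) (hh _); move=> h3.
suff : tr_perp eta Y - trP p Y <= INR n * (INR n * (th * (6 * K))) by lra.
apply: h3 => i j; rewrite Rabs_mult Rabs_minus_sym.
by apply: Rmult_le_compat => //; exact: Rabs_pos.
Qed.

Lemma trP_close p Y Y' d : 0 < dot p p -> 0 <= d -> (forall i j, Rabs (Y i j - Y' i j) <= d) ->
  trP p Y <= trP p Y' + INR n * (INR n * (2 * d)).
Proof.
move=> hp hd hY.
have := @dsum_bound n (fun i j => (kdelta i j - p i * p j / dot p p) * (Y i j - Y' i j)) (2 * d) _.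
have -> : sumI (fun i => sumI (fun j => (kdelta i j - p i * p j / dot p p) * (Y i j - Y' i j))) =
  trP p Y - trP p Y'.
  rewrite (_ : forall a b, a - b = a + (-1) * b); last by move=> a b; ring.
  rewrite /trP -sumI_scal -sumI_add; apply: sumI_ext => i.
  by rewrite -sumI_scal -sumI_add; apply: sumI_ext => j; ring.
move=> hh; have := Rle_trans _ _ _ (Rle_abs _) (hh _); move=> h3.
suff : trP p Y - trP p Y' <= INR n * (INR n * (2 * d)) by lra.
apply: h3 => i j; rewrite Rabs_mult; apply: Rmult_le_compat => //; try exact: Rabs_pos.
rewrite -perp_dir_dot; last lra.
have := CS (perp_dir p i) (perp_dir p j).
have := perp_dir_norm i hp; have := perp_dir_norm j hp.
have := vnorm_ge0 (perp_dir p i); have := vnorm_ge0 (perp_dir p j); nra.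
Qed.

Lemma vcont_lin f g a b d : vcont f -> vcont g -> vcont (fun z : 'I_n -> R => a * f z + b * g z + d).
Proof.
move=> hf hg z e he.
have a0 := Rabs_pos a; have b0 := Rabs_pos b.
pose e' := e / (Rabs a + Rabs b + 1).
have ep : 0 < e' by apply: Rdiv_lt_0_compat; lra.
have ee : e' * (Rabs a + Rabs b + 1) = e by rewrite /e'; field; lra.
have [d1 [dp1 h1]] := hf z e' ep; have [d2 [dp2 h2]] := hg z e' ep.
exists (Rmin d1 d2); split; first exact: Rmin_pos.
move=> y hy.
have k1 := h1 y (Rlt_le_trans _ _ _ hy (Rmin_l _ _)); have k2 := h2 y (Rlt_le_trans _ _ _ hy (Rmin_r _ _)).
have -> : a * f y + b * g y + d - (a * f z + b * g z + d) = a * (f y - f z) + b * (g y - g z) by ring.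
apply: Rle_lt_trans (Rabs_triang _ _) _; rewrite !Rabs_mult; nra.
Qed.

(** The barrier interpolates linearly in time across one step. The term [ka |z|^2] lifts it on the
    sphere [|z| = r] above the rough bound [h + BB]. The drift [E1] is shared in fifths: freezing
    the direction, replacing the stepped Hessian by the old one, the trace of [2 ka I], the error of
    the generator, and the strictness margin. *)
Lemma heat_step_compare (w : ('I_n -> R) -> R -> R) h (q : ('I_n -> R) -> 'I_n -> R) H Q X t1 p K K3 c D r ka E1 th d al eps2 BB :
  0 < K -> 0 <= K3 -> 0 < c -> 0 < D -> c * c = 2 * INR n * D -> 0 < r -> 0 < ka -> 0 < E1 ->
  0 < dot p p -> jsub w -> 0 <= t1 -> C1 h q K -> C2 H Q X K K3 ->
  near_direction p d th ->
  (forall z i, vnorm z < r -> Rabs (Q z i - p i) <= d - 2 * ka * r) ->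
  (forall z i, vnorm z < r -> Rabs (stepQ c p Q z i - p i) <= d - 2 * ka * r) ->
  INR n * (INR n * (th * (6 * K))) <= E1 / 5 ->
  INR n * (INR n * (2 * (K3 * c))) <= E1 / 5 ->
  2 * ka * INR n <= E1 / 5 -> 2 * INR n * K3 * c <= E1 / 5 ->
  (forall z, H z >= h z - eps2) -> (forall z, heat_step c p H z >= h z - eps2) ->
  BB + eps2 <= ka * (r * r) + al ->
  (forall z s, 0 <= s <= D -> w z (t1 + s) <= h z + BB) ->
  (forall z, vnorm z <= r -> w z t1 <= H z + ka * dot z z + al) ->
  forall z, vnorm z <= r -> w z (t1 + D) <= heat_step c p H z + ka * dot z z + (al + E1 * D).
Proof.
move=> hK hK3 hc hD hcD hr hka hE1 hp hw ht1 hC HC2 hdir hQ hQ' e1 e2 e3 e4 hH hH' hBB hbd hinit z0 hz0.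
have C2' := heat_step_C2 np (Rlt_le _ _ hc) hp HC2.
set H' := heat_step c p H in C2' hH' *; set Q' := stepQ c p Q in C2' hQ' *; set X' := stepX c p X in C2' *.
(* This shape matches [vcont_lin] and [C1_quadratic]. *)
pose A z := 1 * H z + 1 * (0 + dot vzero z + ka * dot z z) + al.
pose B z := / D * H' z + (- / D) * H z + E1.
have ka0 := Rlt_le _ _ hka.
have cH : vcont H by apply: C1_vcont (proj1 HC2); lra.
have cH' : vcont H' by apply: C1_vcont (proj1 C2'); lra.
have cA : vcont A by apply: vcont_lin => //; apply: C1_vcont (C1_quadratic _ _ _) => //; lra.
have cB : vcont B by apply: vcont_lin.
have AE z s : A z + s * B z = (1 - s / D) * H z + s / D * H' z + ka * dot z z + (al + E1 * s).
  by rewrite /A /B dot0l; field; lra.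
have AD : A z0 + D * B z0 = H' z0 + ka * dot z0 z0 + (al + E1 * D) by rewrite AE; field; lra.
rewrite -AD.
have := @comparison n w t1 D r A B (E1 / 5) hw ht1 hD hr ltac:(lra) cA cB.
move=> cmp; apply: cmp => //; last by lra.
- move=> z s hz hs.
  pose la := s / D; have la0 : 0 <= la by apply: Rdiv_le_0_compat; lra.
  have la1 : la <= 1 by apply: (Rmult_le_reg_r D) => //; rewrite /la /Rdiv Rmult_assoc Rinv_l; lra.
  pose Xh := fun i j => (1 - la) * X z i j + la * X' z i j.
  exists (vadd (vadd (vscal (1 - la) (Q z)) (vscal la (Q' z))) (vscal (2 * ka) z)),
    (fun i j => 1 * Xh i j + 2 * ka * kdelta i j), K3,
    (/ D * (vnorm (Q' z) + K) + / D * (vnorm (Q z) + K)).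
  have [C1a [sa [ba [la_ ta]]]] := HC2; have [C1b [sb [bb [lb tb]]]] := C2'.
  have iD : 0 < / D by apply: Rinv_0_lt_compat.
  split; first by apply: symm_lin; [apply: symm_lin|exact: symm_id].
  split; first lra.
  split.
    have := vnorm_ge0 (Q' z); have := vnorm_ge0 (Q z) => *.
    by apply: Rplus_le_le_0_compat; apply: Rmult_le_pos; lra.
  split.
    move=> y _; rewrite !AE -/la qform_lin qform_id /Xh qform_lin.
    have -> : dot (vadd z y) (vadd z y) = dot z z + 2 * dot z y + dot y y.
      by rewrite !(dotDl, dotDr) (dotC y z); ring.
    rewrite (dotDl _ (vscal (2 * ka) z)) (dotDl (vscal (1 - la) (Q z))).
    rewrite (dotZl (1 - la) (Q z)) (dotZl la (Q' z)) (dotZl (2 * ka) z).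
    have := Rle_trans _ _ _ (Rle_abs _) (ta z y); have := Rle_trans _ _ _ (Rle_abs _) (tb z y).
    set rem := K3 * _ => h1 h2.
    have h3 := Rmult_le_compat_l (1 - la) _ _ ltac:(lra) h2.
    have h4 := Rmult_le_compat_l la _ _ la0 h1.
    lra.
  split.
    move=> y hy; rewrite /B.
    have := C1_local_lip (Rlt_le _ _ hK) C1a z hy; have := C1_local_lip (Rlt_le _ _ hK) C1b z hy.
    move=> h1 h2.
    have -> : / D * H' (vadd z y) + - / D * H (vadd z y) + E1 - (/ D * H' z + - / D * H z + E1) =
      / D * (H' (vadd z y) - H' z) + (/ D) * (- (H (vadd z y) - H z)) by ring.
    apply: Rle_trans (Rabs_triang _ _) _; rewrite !Rabs_mult Rabs_Ropp (Rabs_pos_eq (/ D)); last lra.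
    rewrite Rmult_plus_distr_r !Rmult_assoc.
    by apply: Rplus_le_compat; apply: Rmult_le_compat_l; lra.
  move=> eta [_ had].
  have [|nz hth] := hdir (vadd (vadd (vscal (1 - la) (Q z)) (vscal la (Q' z))) (vscal (2 * ka) z)).
    move=> i; rewrite /vadd /vscal.
    have := hQ z i hz; have := hQ' z i hz; have := coord_le_vnorm z i.
    move=> /Rabs_le_between h1 /Rabs_le_between h2 /Rabs_le_between h3.
    have h4 : 2 * ka * z i <= 2 * ka * r by apply: Rmult_le_compat_l; lra.
    have h5 : 2 * ka * (- r) <= 2 * ka * z i by apply: Rmult_le_compat_l; lra.
    apply: Rabs_le; split; nra.
  have het i j : Rabs (eta i * eta j - p i * p j / dot p p) <= th.
    by rewrite !(had nz); apply: hth.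
  rewrite tr_perp_lin tr_perp_id tr_perp_lin.
  have t1_ := tr_perp_close (Rlt_le _ _ hK) (ba z) het.
  have t2_ := tr_perp_close (Rlt_le _ _ hK) (bb z) het.
  have Kc : 0 <= K3 * c by apply: Rmult_le_pos; lra.
  have t3_ := trP_close hp Kc (stepX_close np (Rlt_le _ _ hc) hp hK3 la_ z); rewrite -/X' in t3_.
  have := heat_step_generator np (Rlt_le _ _ hc) hp hK3 HC2 hcD z.
  rewrite -/H' => /Rabs_le_between [g1 _].
  have g2 : trP p (X z) - 2 * INR n * K3 * c + E1 <= B z.
    have -> : B z = / D * (H' z - H z - D * trP p (X z)) + trP p (X z) + E1 by rewrite /B; field; lra.
    have := Rmult_le_compat_l (/ D) _ _ (Rlt_le _ _ iD) g1.
    have -> : / D * - (K3 * (c * (c * c))) = - (2 * INR n * K3 * c) by rewrite hcD; field; lra.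
    lra.
  have de := dot_ge0 eta.
  have := Rmult_le_compat_l (1 - la) _ _ ltac:(lra) t1_.
  have := Rmult_le_compat_l la _ _ la0 t2_.
  have := Rmult_le_compat_l la _ _ la0 t3_.
  have : 2 * ka * (INR n - dot eta eta) <= 2 * ka * INR n by apply: Rmult_le_compat_l; lra.
  have hh : la * (INR n * (INR n * (2 * (K3 * c)))) <= 1 * (E1 / 5).
    apply: Rmult_le_compat => //.
    by do 3 (apply: Rmult_le_pos; [lra|]) => //; lra.
  nra.
- by move=> z hz; have := hinit z hz; rewrite /A dot0l; lra.
- move=> z s hz hs; rewrite AE.
  pose la := s / D; have la0 : 0 <= la by apply: Rdiv_le_0_compat; lra.
  have la1 : la <= 1 by apply: (Rmult_le_reg_r D) => //; rewrite /la /Rdiv Rmult_assoc Rinv_l; lra.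
  rewrite -/la -vnorm_sq hz.
  have := hbd z s hs; have := hH z; have := hH' z => h1 h2 h3.
  have := Rmult_le_compat_l (1 - la) _ _ ltac:(lra) (Rge_le _ _ h2).
  have := Rmult_le_compat_l la _ _ la0 (Rge_le _ _ h1).
  have : 0 <= E1 * s by apply: Rmult_le_pos; lra.
  nra.
Qed.

End Evolution.

Lemma pos_small_factor a b : 0 <= a -> 0 < b -> exists x, 0 < x /\ a * x <= b.
Proof.
move=> ha hb; exists (b / (a + 1)); split; first by apply: Rdiv_lt_0_compat; lra.
have -> : a * (b / (a + 1)) = b - b / (a + 1) by field; lra.
have : 0 < b / (a + 1) by apply: Rdiv_lt_0_compat; lra.
lra.
Qed.

Lemma pos_small_factor_mono a x y b : 0 <= a -> y <= x -> a * x <= b -> a * y <= b.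
Proof. by move=> ha hxy hb; apply: Rle_trans hb; apply: Rmult_le_compat_l. Qed.

Section Evolution.
Variable n : nat.
Hypothesis np : 0 < INR n.
Implicit Types (y z p : 'I_n -> R) (H h : ('I_n -> R) -> R) (Q q : ('I_n -> R) -> 'I_n -> R)
  (X : ('I_n -> R) -> 'I_n -> 'I_n -> R) (w : ('I_n -> R) -> R -> R).

(** The step depends on the line spanned by [p] only; hence the gradients [p] of the barrier for [u]
    and [- p] of the one for [- u] produce the same evolution. *)
Lemma heat_step_opp_dir c p H : heat_step c (vscal (-1) p) H = heat_step c p H.
Proof.
apply: functional_extensionality => z; rewrite /heat_step /avgT; congr (_ * _).
have e : forall i, perp_dir (vscal (-1) p) i = perp_dir p i.
  move=> i; apply: functional_extensionality => k.
  rewrite /perp_dir dotZl dotZr /vadd /vscal.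
  by rewrite (_ : -1 * (-1 * dot p p) = dot p p) /Rdiv; ring.
by apply: sumI_ext => i; rewrite !e.
Qed.

Lemma iter_heat_step_opp c p H k :
  iter k (heat_step c p) (fun z => - H z) = fun z => - iter k (heat_step c p) H z.
Proof.
elim: k => [//|k IH]; rewrite !iterS IH; apply: functional_extensionality => z.
rewrite /heat_step /avgT Ropp_mult_distr_r; congr (_ * _).
rewrite -[RHS]Rmult_1_l -Ropp_mult_distr_r Ropp_mult_distr_l -sumI_scal.
by apply: sumI_ext => i; ring.
Qed.

(** The order of the quantifiers is essential. The accuracy [eps1] depends on [tau], and smoothing
    to that accuracy determines [K3]; then [c] and [M] are fixed before [w] and [p], so that [u] and
    [- u] undergo the same discrete evolution. Half of [cE] pays for the smoothing error [eps1],
    half for the drift [E1]. *)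
Lemma evolution a K cE : 0 < a -> 0 < K -> 0 < cE -> exists mu tau0, 0 < mu /\ 0 < tau0 /\
  forall tau, 0 < tau <= tau0 -> exists eps1, 0 < eps1 /\
  forall K3, 0 <= K3 -> exists c M,
  forall w h q H Q X t1 p, vnorm p = a -> jsub w -> 0 <= t1 -> C1 h q K ->
    (forall i, Rabs (q vzero i - p i) <= mu) -> (forall z, w z t1 <= h z) ->
    C2 H Q X K K3 -> (forall z, Rabs (H z - h z) <= eps1) ->
    w vzero (t1 + tau) <= iter M (heat_step c p) H vzero + cE * tau.
Proof.
move=> ha hK hcE; pose N := INR n; pose E1 := cE / 2; have E1p : 0 < E1 by rewrite /E1; lra.
have N0 : 0 < N := np.
have NN : 0 < N * N by apply: Rmult_lt_0_compat.
have NK : 0 < N * K by apply: Rmult_lt_0_compat.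
have [th [thp th1]] := @pos_small_factor (N * (N * (6 * K))) (E1 / 5) ltac:(nra) ltac:(lra).
have [d [dp hd]] := @direction_close n np a th ha thp.
have [ka [kap ka1]] := @pos_small_factor (2 * N) (E1 / 5) ltac:(lra) ltac:(lra).
have [r [rp r1]] := @pos_small_factor (6 * K + 2 * ka) (d / 4) ltac:(lra) ltac:(lra).
have [sg [sgp sg1]] := @pos_small_factor (2 * K) (d / 8) ltac:(lra) ltac:(lra).
(* The first bound makes the term [2 eps2 / sg] of [gradient_close] at most [d / 8]; the second is
   the height available on the lateral boundary. *)
pose B2 := Rmin (sg * d / 16) (ka * (r * r)).
have B2p : 0 < B2 by apply: Rmin_pos; [nra|apply: Rmult_lt_0_compat => //; nra].
(* The factor is [eps2 + BB] divided by [tau]: [E1 + 2 n K] from smoothing and accumulated steps,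
   [2 n K + 1] from [C1_barrier]. *)
have [tau0 [tp0 tau1]] := @pos_small_factor (E1 + 4 * (N * K) + 1) B2 ltac:(lra) B2p.
exists (d / 4), tau0; split; first lra. split=> // tau [htau htau'].
have htB : (E1 + 4 * (N * K) + 1) * tau <= B2 by apply: pos_small_factor_mono tau1 => //; lra.
pose eps1 := E1 * tau; have ep : 0 < eps1 by apply: Rmult_lt_0_compat.
exists eps1; split=> // K3 hK3.
have [c0 [c0p c01]] := @pos_small_factor (2 * (N * N) * K3 + 2 * N * K3) (E1 / 5)
  ltac:(apply: Rplus_le_le_0_compat; apply: Rmult_le_pos; lra) ltac:(lra).
(* Enough steps that [c^2 = 2 n tau / M] is at most [c0^2]. *)
have [M0 hM0] := INR_unbounded (2 * N * tau / (c0 * c0)).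
pose M := S M0; have Mp : 0 < INR M by apply: lt_0_INR; rewrite /M; lia.
pose D := tau / INR M; have Dp : 0 < D by apply: Rdiv_lt_0_compat.
have MD : INR M * D = tau by rewrite /D; field; lra.
pose c := sqrt (2 * N * D).
have cc : c * c = 2 * N * D by apply: sqrt_sqrt; apply: Rmult_le_pos; lra.
have cp : 0 < c by apply: sqrt_lt_R0; apply: Rmult_lt_0_compat; lra.
have cle : c <= c0.
  have c0c : 0 < c0 * c0 by apply: Rmult_lt_0_compat.
  have : c * c <= c0 * c0; last by nra.
  rewrite cc; have hM : 2 * N * tau / (c0 * c0) <= INR M by rewrite /M S_INR; lra.
  have := Rmult_le_compat_r (c0 * c0 * / INR M) _ _ ltac:(left; apply: Rmult_lt_0_compat => //; exact: Rinv_0_lt_compat) hM.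
  have -> : 2 * N * tau / (c0 * c0) * (c0 * c0 * / INR M) = 2 * N * D by rewrite /D; field; lra.
  by have -> : INR M * (c0 * c0 * / INR M) = c0 * c0 by field; lra.
have nk0 : 0 <= N * N * K3 by apply: Rmult_le_pos; lra.
have nk1 : 0 <= N * K3 by apply: Rmult_le_pos; lra.
have c1 : N * (N * (2 * (K3 * c))) <= E1 / 5 by nra.
have c2 : 2 * N * K3 * c <= E1 / 5 by nra.
exists c, M => w h q H Q X t1 p hp hw ht1 hC hq hwh hC2 hHh.
pose eps2 := eps1 + 2 * (N * K) * tau.
have nkt : 0 <= N * K * tau by apply: Rmult_le_pos; lra.
have pp : 0 < dot p p by rewrite -vnorm_sq hp; apply: Rmult_lt_0_compat.
have hB2a : B2 <= sg * d / 16 := Rmin_l _ _; have hB2b : B2 <= ka * (r * r) := Rmin_r _ _.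
have grad : forall G QG, C1 G QG K -> (forall z, Rabs (G z - h z) <= eps2) ->
   forall z i, vnorm z < r -> Rabs (QG z i - p i) <= d - 2 * ka * r.
  move=> G QG CG hG z i hz.
  have := gradient_close hC CG hG z i sgp.
  have := gradient_lipschitz (Rlt_le _ _ hK) hC vzero z i.
  have -> : vadd vzero z = z by vext.
  have e2 : 2 * eps2 / sg <= d / 8.
    apply: (Rmult_le_reg_r sg) => //; rewrite /Rdiv Rmult_assoc Rinv_l; last lra.
    by rewrite /eps2 /eps1; lra.
  have e3 : 6 * K * vnorm z <= 6 * K * r by apply: Rmult_le_compat_l; lra.
  have := hq i => /Rabs_le_between q1 /Rabs_le_between q2 /Rabs_le_between q3.
  by apply: Rabs_le; split; lra.
(* The distance to [h] is carried along because it keeps the gradient near [p]; it grows by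
   [K c^2 = 2 n K D] per step, hence by at most [2 n K tau] in all. *)
have claim : forall k, (k <= M)%coq_nat -> exists Qk Xk,
    C2 (iter k (heat_step c p) H) Qk Xk K K3 /\
    (forall z, Rabs (iter k (heat_step c p) H z - h z) <= eps1 + INR k * (K * (c * c))) /\
    forall z, vnorm z <= r -> w z (t1 + INR k * D) <=
      iter k (heat_step c p) H z + ka * dot z z + (eps1 + E1 * (INR k * D)).
  elim=> [|k IH] hk.
    exists Q, X; split=> //; split; first by move=> z; have := hHh z; rewrite /=; lra.
    move=> z hz; rewrite /= Rmult_0_l Rplus_0_r Rmult_0_r.
    have := hwh z; have := hHh z => /Rabs_le_between h1 h2; have := dot_ge0 z => h3.
    have : 0 <= ka * dot z z by apply: Rmult_le_pos; lra.
    lra.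
  have [Qk [Xk [Ck2 [Hk wk]]]] := IH ltac:(lia).
  set Hk_ := iter k (heat_step c p) H in Ck2 Hk wk *.
  have C2' := heat_step_C2 np (Rlt_le _ _ cp) pp Ck2.
  have kM : INR k + 1 <= INR M by rewrite -S_INR; apply: le_INR.
  have k0 := pos_INR k.
  have kD : (INR k + 1) * D <= tau by rewrite -MD; apply: Rmult_le_compat_r; lra.
  have Hk2 : forall z, Rabs (Hk_ z - h z) <= eps2.
    move=> z; apply: Rle_trans (Hk z) _; rewrite cc /eps2.
    have : K * N * (INR k * D) <= K * N * tau by apply: Rmult_le_compat_l; lra.
    rewrite -/N; lra.
  have Hk1 : forall z, Rabs (heat_step c p Hk_ z - h z) <= eps1 + INR (S k) * (K * (c * c)).
    move=> z; rewrite S_INR; have := heat_step_close np (Rlt_le _ _ cp) pp (Rlt_le _ _ hK) (proj1 Ck2) z.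
    have := Hk z => /Rabs_le_between h1 /Rabs_le_between h2.
    by apply: Rabs_le; split; lra.
  have Hk1' : forall z, Rabs (heat_step c p Hk_ z - h z) <= eps2.
    move=> z; apply: Rle_trans (Hk1 z) _; rewrite S_INR cc /eps2.
    have : K * N * ((INR k + 1) * D) <= K * N * tau by apply: Rmult_le_compat_l; lra.
    rewrite -/N; lra.
  exists (stepQ c p Qk), (stepX c p Xk); rewrite iterS -/Hk_; split=> //; split=> // z hz.
  rewrite S_INR; have -> : t1 + (INR k + 1) * D = t1 + INR k * D + D by ring.
  have -> : eps1 + E1 * ((INR k + 1) * D) = (eps1 + E1 * (INR k * D)) + E1 * D by ring.
  have kDp : 0 <= INR k * D by apply: Rmult_le_pos; lra.
  apply: (@heat_step_compare n np w h q Hk_ Qk Xk (t1 + INR k * D) p K K3 c D r ka E1 th d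
    (eps1 + E1 * (INR k * D)) eps2 ((2 * N * K + 1) * tau)) => //.
  - by lra.
  - exact: hd.
  - exact: grad (proj1 Ck2) Hk2.
  - exact: grad (proj1 C2') Hk1'.
  - by rewrite -/N; lra.
  - by rewrite -/N; lra.
  - by move=> y; have := Hk2 y => /Rabs_le_between; lra.
  - by move=> y; have := Hk1' y => /Rabs_le_between; lra.
  - have : 0 <= E1 * (INR k * D) by apply: Rmult_le_pos; lra.
    have e1t : 0 < E1 * tau := ep.
    by rewrite /eps2 /eps1; lra.
  - move=> y s hs; rewrite Rplus_assoc.
    apply: Rle_trans (C1_barrier hw ht1 hK hC hwh y (tau := INR k * D + s) ltac:(lra)) _.
    apply: Rplus_le_compat_l; apply: Rmult_le_compat_l; rewrite -/N; lra.
have [_ [_ [_ [_ hfin]]]] := claim M (le_n _).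
have := hfin vzero; rewrite vnorm0 dot0l MD => /(_ (Rlt_le _ _ rp)).
by rewrite /eps1 /E1; lra.
Qed.

End Evolution.

(** * Lasry-Lions interpolation *)

Section LasryLions.
Variable n : nat.
Implicit Types (x y z a p : 'I_n -> R) (f h : ('I_n -> R) -> R).

Definition parab p K z a : R := dot p (vsub z a) + K * dot (vsub z a) (vsub z a).

Lemma parab_vcont p K z : 0 <= K -> vcont (parab p K z).
Proof.
move=> hK.
have -> : parab p K z = fun a => (dot p z + K * dot z z) + dot (vadd (vscal (-1) p) (vscal (-2 * K) z)) a + K * dot a a.
  apply: functional_extensionality => a.
  rewrite /parab !(dotBl, dotBr, dotDl, dotZl) (dotC a z); ring.
exact: C1_vcont hK (C1_quadratic _ _ hK).
Qed.

Lemma parab_lower p K z a : 0 < K -> forall B, 0 <= B ->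
  (vnorm p + B) / K + 1 <= vnorm (vsub z a) -> B <= parab p K z a.
Proof.
move=> hK B hB; rewrite /parab -vnorm_sq; set v := vsub z a => hv.
have v0 := vnorm_ge0 v; have p0 := vnorm_ge0 p.
have := CS p v; move=> /Rabs_le_between [h1 _].
have e : K * ((vnorm p + B) / K + 1) = vnorm p + B + K by field; lra.
have h2 : vnorm p + B + K <= K * vnorm v by rewrite -e; apply: Rmult_le_compat_l; lra.
have h3 : 1 <= vnorm v.
  have : 0 <= (vnorm p + B) / K by apply: Rdiv_le_0_compat; lra.
  lra.
nra.
Qed.

(* [h z = inf_a (sup_y (f y - parab p (K/2) y a) + parab p K z a)]. The infimum makes [h]
   semiconcave; [h] stays semiconvex because the outer parabola is steeper than the inner one. *)
Lemma lasry_lions f M p K : 0 < K -> (forall y, Rabs (f y) <= M) ->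
  exists h q, C1 h q (3 * K) /\ (forall z, f z <= h z) /\
   forall al x, (forall y, f y <= al + parab p (K / 2) y x) -> forall z, h z <= al + parab p K z x.
Proof.
move=> hK hM; have K2 : 0 < K / 2 by lra.
have M0 : 0 <= M := Rle_trans _ _ _ (Rabs_pos _) (hM vzero).
have p0 := vnorm_ge0 p.
have low : forall y a, - (vnorm p * vnorm p / (2 * K)) <= parab p (K / 2) y a.
  move=> y a; rewrite /parab -vnorm_sq; set v := vsub y a.
  have := CS p v; move=> /Rabs_le_between [h1 _].
  have e : vnorm p * vnorm p / (2 * K) = K / 2 * ((vnorm p / K) * (vnorm p / K)) by field; lra.
  have e2 : vnorm p = K * (vnorm p / K) by field; lra.
  rewrite e; set t := vnorm p / K in e2 *; rewrite e2 in h1.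
  have : 0 <= K / 2 * ((vnorm v - t) * (vnorm v - t)) by apply: Rmult_le_pos; [lra|exact: Rle_0_sqr].
  lra.
have hF : forall a, exists m, is_lub (fun v => exists y, v = f y - parab p (K / 2) y a) m.
  move=> a; have [| |m hm] := completeness (fun v => exists y, v = f y - parab p (K / 2) y a).
  - exists (M + vnorm p * vnorm p / (2 * K)) => v [y ->].
    by have := low y a; have := hM y => /Rabs_le_between; lra.
  - by exists (f a - parab p (K / 2) a a), a.
  by exists m.
pose F a := proj1_sig (constructive_indefinite_description _ (hF a)).
have Fub a y : f y - parab p (K / 2) y a <= F a.
  by rewrite /F; case: constructive_indefinite_description => m /= [h1 _]; apply: h1; exists y.
have Flub a b : (forall y, f y - parab p (K / 2) y a <= b) -> F a <= b.
  rewrite /F; case: constructive_indefinite_description => m /= [_ h1] hb.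
  by apply: h1 => v [y ->].
have Fapp a e : 0 < e -> exists y, F a < f y - parab p (K / 2) y a + e.
  move=> he; apply: NNPP => hn; have : F a <= F a - e; last by lra.
  apply: Flub => y; apply: Rnot_lt_le => hlt; apply: hn; exists y; lra.
have parab0 k z : parab p k z z = 0.
  by rewrite /parab (_ : vsub z z = vzero) ?dot0r; [ring|vext].
have Flow a : - M <= F a.
  by have := Fub a a; rewrite parab0; have := hM a => /Rabs_le_between; lra.
(* Beyond the radius [rho] the parabola exceeds [M + |F z|] while [F >= - M], so these points do
   worse than [a = z]. *)
have att : forall z, exists a, forall b, F a + parab p K z a <= F b + parab p K z b.
  move=> z; have f0 := Rabs_pos (F z); have f1 := Rle_abs (F z).
  pose B := M + Rabs (F z).
  pose rho := (vnorm p + B) / K + 1.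
  have B0 : 0 <= B by rewrite /B; lra.
  have rho0 : 0 < rho.
    have : 0 <= (vnorm p + B) / K by apply: Rdiv_le_0_compat; lra.
    rewrite /rho; lra.
  have [|||a [ha hmin]] := @usc_attains_max _ (fun a : 'I_n -> R => vnorm (vsub z a) <= rho)
    (fun a => - (F a + parab p K z a)) (vnorm z + rho).
  - by exists z; rewrite (_ : vsub z z = vzero) ?vnorm0; [lra|vext].
  - move=> a ha i; apply: Rle_trans (coord_le_vnorm a i) _.
    by have := vnorm_sub z (vsub z a); rewrite (_ : vsub z (vsub z a) = a); [lra|vext].
  - move=> x l hx hl; have cv := coord_vcv hl; split.
      apply: (@vcv_norm_le _ (fun k => vsub z (x k))) => // e he.
      have [N hN] := cv e he; exists N => k hk.
      rewrite (_ : vsub (vsub z (x k)) (vsub z l) = vscal (-1) (vsub (x k) l)); last by vext.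
      by rewrite vnorm_opp; apply: hN.
    (* Lower semicontinuity of [F] at [l]: a nearly optimal [y] for [l] remains a competitor at
       nearby points. *)
    move=> e he; have [y hy] := Fapp l (e / 4) ltac:(lra).
    have e4 : e / 4 > 0 by lra.
    have [N1 h1] := vcont_vcv (parab_vcont p y (Rlt_le _ _ K2)) cv e4.
    have [N2 h2] := vcont_vcv (parab_vcont p z (Rlt_le _ _ hK)) cv e4.
    exists (N1 + N2)%coq_nat => k hk.
    have := h1 k ltac:(lia); have := h2 k ltac:(lia); rewrite /Rdist => /Rabs_def2 [g1 g2] /Rabs_def2 [g3 g4].
    by have := Fub (x k) y; lra.
  exists a => b; case: (Rle_lt_dec (vnorm (vsub z b)) rho) => hb; first by have := hmin b hb; lra.
  have := hmin z; rewrite (_ : vsub z z = vzero) ?vnorm0; last by vext.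
  move=> /(_ (Rlt_le _ _ rho0)); rewrite parab0.
  by have := parab_lower hK B0 (Rlt_le _ _ hb); have := Flow b; rewrite /B; lra.
pose sel z := proj1_sig (constructive_indefinite_description _ (att z)).
have selP z b : F (sel z) + parab p K z (sel z) <= F b + parab p K z b.
  by rewrite /sel; case: constructive_indefinite_description.
pose h z := F (sel z) + parab p K z (sel z).
pose q z := vadd p (vscal (2 * K) (vsub z (sel z))).
have up : forall z y, h (vadd z y) <= h z + dot (q z) y + K * dot y y.
  move=> z y; apply: Rle_trans (selP _ (sel z)) _; rewrite /h /q /parab.
  set a := sel z; have -> : vsub (vadd z y) a = vadd (vsub z a) y by vext.
  by move: (vsub z a) => v; rewrite !(dotDl, dotDr, dotZl) (dotC y v); lra.
have mid : forall z y, 2 * h z <= h (vadd z y) + h (vsub z y) + 2 * K * dot y y.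
  move=> z y; set a1 := sel (vadd z y); set a2 := sel (vsub z y).
  pose a : 'I_n -> R := vscal (/2) (vadd a1 a2); pose da : 'I_n -> R := vscal (/2) (vsub a1 a2).
  suff : forall e, 0 < e -> 2 * h z <= h (vadd z y) + h (vsub z y) + 2 * K * dot y y + 2 * e.
    move=> hh; apply: Rnot_lt_le => hlt.
    set g := (X in X < _) in hlt; set g' := (X in _ < X) in hlt.
    have := hh ((g' - g) / 4) ltac:(lra); rewrite -/g -/g'; lra.
  move=> e he; have [y0 hy0] := Fapp a e he.
  have := selP z a; rewrite -/(h z); have := Fub a1 y0; have := Fub a2 y0.
  have -> : h (vadd z y) = F a1 + parab p K (vadd z y) a1 by [].
  have -> : h (vsub z y) = F a2 + parab p K (vsub z y) a2 by [].
  rewrite /parab in hy0 *.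
  have e1 : vsub y0 a1 = vsub (vsub y0 a) da.
    by apply: functional_extensionality => i; rewrite /a /da /vsub /vadd /vscal; field.
  have e2 : vsub y0 a2 = vadd (vsub y0 a) da.
    by apply: functional_extensionality => i; rewrite /a /da /vsub /vadd /vscal; field.
  have e3 : vsub (vadd z y) a1 = vadd (vsub z a) (vsub y da).
    by apply: functional_extensionality => i; rewrite /a /da /vsub /vadd /vscal; field.
  have e4 : vsub (vsub z y) a2 = vsub (vsub z a) (vsub y da).
    by apply: functional_extensionality => i; rewrite /a /da /vsub /vadd /vscal; field.
  rewrite e1 e2 e3 e4; have := dot_ge0 (vsub (vscal 2 y) da).
  move: hy0 {e1 e2 e3 e4}; move: (vsub y0 a) (vsub z a) da => u v da hy0.
  rewrite (dotDl v) !(dotDr _ (vsub y da)) (dotBl v) !(dotBr _ (vsub y da)) (dotC (vsub y da) v).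
  rewrite (dotDl u) !(dotDr _ da) (dotBl u) !(dotBr _ da) (dotC da u).
  rewrite !(dotBl, dotBr, dotZl, dotZr) (dotC da y) => h1 h2 h3 h4.
  (* The two parabolas leave [2 K |y - da|^2 + 2 K |y|^2 - K |da|^2], which is the square
     [K |2 y - da|^2]. The last loss [K |da|^2] stems from the inner slope [K / 2]. *)
  have : 0 <= K * (4 * dot y y - 4 * dot y da + dot da da) by apply: Rmult_le_pos; lra.
  lra.
exists h, q; split.
  (* The lower bound combines the midpoint loss [2 K] with the upper bound [K] at [- y], whence
     [3 K]. *)
  move=> z y; have u1 := up z y; have u2 := up z (vscal (-1) y); have m1 := mid z y.
  rewrite (_ : vadd z (vscal (-1) y) = vsub z y) in u2; last by vext.
  rewrite !dotZr dotZl in u2.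
  have : 0 <= K * dot y y by apply: Rmult_le_pos; [lra|exact: dot_ge0].
  by move=> d0; apply: Rabs_le; split; lra.
split.
  move=> z; rewrite /h; have := Fub (sel z) z; rewrite /parab.
  have : 0 <= K * dot (vsub z (sel z)) (vsub z (sel z)) by apply: Rmult_le_pos; [lra|exact: dot_ge0].
  lra.
move=> al x hx z; apply: Rle_trans (selP z x) _; apply: Rplus_le_compat_r.
by apply: Flub => y; have := hx y; lra.
Qed.

End LasryLions.

(** * The two cases *)

Section NonzeroGradient.
Variable n : nat.
Implicit Types (x y z v p : 'I_n -> R) (u w : ('I_n -> R) -> R -> R) (h H : ('I_n -> R) -> R)
  (q Q : ('I_n -> R) -> 'I_n -> R) (X : ('I_n -> R) -> 'I_n -> 'I_n -> R).

Lemma C1_opp h q K : C1 h q K -> C1 (fun z => - h z) (fun z => vscal (-1) (q z)) K.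
Proof.
move=> hC z y; apply: Rle_trans (hC z y); right.
by rewrite dotZl -Rabs_Ropp; congr Rabs; ring.
Qed.

Lemma C2_opp H Q X K K3 : C2 H Q X K K3 ->
  C2 (fun z => - H z) (fun z => vscal (-1) (Q z)) (fun z i j => - X z i j) K K3.
Proof.
move=> [hC [hs [hb [hl ht]]]]; split; first exact: C1_opp.
split; first by move=> z i j; rewrite hs.
split; first by move=> z i j; rewrite Rabs_Ropp.
split.
  move=> z y i j; apply: Rle_trans (hl z y i j); right.
  by rewrite -Rabs_Ropp; congr Rabs; ring.
move=> z y; apply: Rle_trans (ht z y); right.
have -> : qform (fun i j => - X z i j) y = - qform (X z) y.
  have := qform_lin (X z) (X z) (-1) 0 y => e.
  rewrite (_ : - qform (X z) y = -1 * qform (X z) y + 0 * qform (X z) y); last by ring.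
  by rewrite -e; apply: sumI_ext => i; apply: sumI_ext => j; ring.
by rewrite dotZl -Rabs_Ropp; congr Rabs; ring.
Qed.

(** Contrapositive of [quadratic_barrier]: a paraboloid starting lower than its rise
    [(2 n K + 1) tau] permits, by an extra [tau], cannot lie above [w] at time [t1]. *)
Lemma barrier_witness w t1 tau K p : jsub w -> 0 <= t1 -> 0 < tau -> 0 < K ->
  exists y, w vzero (t1 + tau) - (2 * INR n * K + 2) * tau + dot p y + K * dot y y < w y t1.
Proof.
move=> hw ht1 htau hK; apply: NNPP => hn.
have := @quadratic_barrier n w t1 (w vzero (t1 + tau) - (2 * INR n * K + 2) * tau) p K hw ht1 hK _ tau (Rlt_le _ _ htau).
move=> hh; have : w vzero (t1 + tau) <= w vzero (t1 + tau) - tau; last by lra.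
apply: Rle_trans (hh _) _; last by lra.
by move=> y; apply: Rnot_lt_le => hlt; apply: hn; exists y.
Qed.

Lemma vnorm_pos_dim p : 0 < vnorm p -> 0 < INR n.
Proof.
move=> hp; apply: lt_0_INR; case: (Nat.eq_dec n 0) => [e|]; last by lia.
exfalso; suff e0 : p = vzero by rewrite e0 vnorm0 in hp; lra.
by apply: functional_extensionality => -[i hi]; exfalso; move: hi; rewrite e.
Qed.

(* The pair at the origin only almost touches at time [t1 + tau], but the barriers at time [t1] are
   steeper (slope [2 K]) than the doubling penalty [K / 2]; this forces almost-touching points [y], [x]
   close to the origin, which pins the gradient of [h] there to [p]. *)
Lemma interpolant_gradient w1 w2 t1 tau p K h q de mu zeta sg :
  jsub w1 -> jsub w2 -> 0 <= t1 -> 0 < tau -> 0 < K -> 0 < sg ->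
  (forall y x, w1 y t1 + w2 x t1 <= parab p (K / 2) y x) ->
  - de <= w1 vzero (t1 + tau) + w2 vzero (t1 + tau) ->
  C1 h q (6 * K) -> (forall z, w1 z t1 <= h z) -> (forall z x, h z <= - w2 x t1 + parab p (2 * K) z x) ->
  de + 2 * (4 * INR n * K + 2) * tau <= zeta ->
  9 * zeta <= sg * (mu / 4) -> 10 * K * sg <= mu / 4 -> 72 * K * (72 * K) * zeta <= K * (mu * mu) -> 0 < mu ->
  forall i, Rabs (q vzero i - p i) <= mu.
Proof.
move=> hw1 hw2 ht1 htau hK hsg h12 hde hC hf hg hz z1 z2 z3 hmu i.
have [y hy] := barrier_witness p hw1 ht1 htau (ltac:(lra) : 0 < 2 * K).
have [x hx] := barrier_witness (vscal (-1) p) hw2 ht1 htau (ltac:(lra) : 0 < 2 * K).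
rewrite dotZl in hx.
have y0 := dot_ge0 y; have x0 := dot_ge0 x.
have s0 : dot (vadd y x) (vadd y x) = dot y y + 2 * dot y x + dot x x.
  by rewrite !(dotDl, dotDr) (dotC x y); ring.
have s1 := dot_ge0 (vadd y x); rewrite s0 in s1.
have d0 : dot (vsub y x) (vsub y x) = dot y y - 2 * dot y x + dot x x.
  by rewrite !(dotBl, dotBr) (dotC x y); ring.
have hyx : dot p (vsub y x) = dot p y - dot p x by rewrite dotBr.
(* The witnesses contribute [2 K (|y|^2 + |x|^2)] and the doubling penalty takes back at most half,
   so [K (|y|^2 + |x|^2) <= zeta]. *)
have k0 : K / 2 * dot (vsub y x) (vsub y x) <= K * (dot y y + dot x x).
  by rewrite d0; nra.
have := h12 y x; rewrite /parab hyx => hyx2.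
have kz : K * (dot y y + dot x x) <= zeta by lra.
(* Here [h] is squeezed: [h y >= w1 y] and [h (y + v)] is below the parabola centred at [x]. The
   [10] is [6 + 4], from [C1] and from expanding that parabola; the [9] is one [zeta] of almost
   touching plus [4 K |y - x|^2 <= 8 zeta]. *)
have key : forall v, dot (q y) v - dot p v <= 9 * zeta + 10 * K * dot v v.
  move=> v; have := hC y v => /Rabs_le_between [c1 _].
  have := hg (vadd y v) x; have := hf y; rewrite /parab.
  have -> : vsub (vadd y v) x = vadd v (vsub y x) by vext.
  have e1 : dot p (vadd v (vsub y x)) = dot p v + (dot p y - dot p x) by rewrite dotDr dotBr.
  have e2 : dot (vadd v (vsub y x)) (vadd v (vsub y x)) <= 2 * dot v v + 2 * dot (vsub y x) (vsub y x).
    move: (vsub y x) => e; have := dot_ge0 (vsub v e).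
    by rewrite !(dotBl, dotBr, dotDl, dotDr) (dotC e v); lra.
  have e3 := Rmult_le_compat_l (2 * K) _ _ ltac:(lra) e2.
  have v0 := dot_ge0 v.
  have ky : 0 <= K * (dot y y + dot x x) by apply: Rmult_le_pos; lra.
  rewrite e1; lra.
have hq1 : Rabs (q y i - p i) <= mu / 2.
  have k1 := key (vscal sg (ebas i)); have k2 := key (vscal (- sg) (ebas i)).
  rewrite !dotZr !dotZl !dot_ebas (_ : ebas i i = 1) in k1 k2; last by rewrite /ebas eqxx.
  have m1 : 10 * K * (sg * (sg * 1)) <= sg * (mu / 4).
    by have := Rmult_le_compat_l sg _ _ (Rlt_le _ _ hsg) z2; lra.
  apply: Rabs_le; split; apply: (Rmult_le_reg_l sg) => //; lra.
have hq2 : Rabs (q vzero i - q y i) <= mu / 2.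
  have := gradient_lipschitz (ltac:(lra) : 0 <= 6 * K) hC y (vscal (-1) y) i.
  have -> : vadd y (vscal (-1) y) = vzero by vext.
  rewrite vnorm_opp => hh; apply: Rle_trans hh _.
  (* The gradient has Lipschitz constant [6 (6 K) = 36 K], so this distance costs [mu / 2]. *)
  have ny : vnorm y <= mu / (72 * K).
    apply: vnorm_le; first by left; apply: Rdiv_lt_0_compat; lra.
    have mt : mu = 72 * K * (mu / (72 * K)) by field; lra.
    have KK := Rlt_0_sqr (72 * K) ltac:(lra); rewrite /Rsqr in KK.
    move: z3; rewrite {1 2}mt; move: (mu / (72 * K)) => s z3.
    have z4 : zeta <= K * (s * s) by apply: (Rmult_le_reg_l _ _ _ KK); lra.
    have kx : 0 <= K * dot x x by apply: Rmult_le_pos; lra.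
    apply: (Rmult_le_reg_l K) => //; lra.
  have := Rmult_le_compat_l (36 * K) _ _ ltac:(lra) ny.
  have -> : 36 * K * (mu / (72 * K)) = mu / 2 by field; lra.
  lra.
have -> : q vzero i - p i = (q vzero i - q y i) + (q y i - p i) by ring.
by apply: Rle_trans (Rabs_triang _ _) _; lra.
Qed.

(** The upper bound is global in space but is required before [t0] only. One near-maximal pair
    suffices, with a tolerance [de] small compared with the gap [b * tau]. *)
Lemma no_increase_nonzero_gradient u a K b m t0 r0 : 0 < a -> 0 < K -> 0 < b -> 0 < t0 -> 0 < r0 ->
  jsub u -> jsub (fun x t => - u x t) ->
  (forall de, 0 < de -> exists x0 y0 p, vnorm p = a /\ m - de <= u y0 t0 - u x0 t0 /\
     forall x y t, 0 <= t -> t0 - r0 <= t <= t0 ->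
       u (vadd y0 y) t - u (vadd x0 x) t <= m + parab p (K / 2) y x - b * (t0 - t)) ->
  False.
Proof.
move=> ha hK hb ht0 hr0 hu hmu' hnear.
have np : 0 < INR n.
  by have [_ [_ [p [hp _]]]] := hnear 1 ltac:(lra); apply: (@vnorm_pos_dim p); rewrite hp.
have [mu [tau0 [mup [tp0 evo]]]] := @evolution n np a (6 * K) (b / 8) ha ltac:(lra) ltac:(lra).
have [sg [sgp sg1]] := @pos_small_factor (10 * K) (mu / 4) ltac:(lra) ltac:(lra).
have KK : 0 < 72 * K * (72 * K) by apply: Rmult_lt_0_compat; lra.
have NK : 0 < INR n * K by apply: Rmult_lt_0_compat.
have [zeta [zp [z1 z2]]] : exists zeta, 0 < zeta /\ 9 * zeta <= sg * (mu / 4) /\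
    72 * K * (72 * K) * zeta <= K * (mu * mu).
  have [za [za0 za1]] := @pos_small_factor 9 (sg * (mu / 4)) ltac:(lra) ltac:(nra).
  have [zb [zb0 zb1]] := @pos_small_factor (72 * K * (72 * K)) (K * (mu * mu)) ltac:(lra) ltac:(apply: Rmult_lt_0_compat => //; nra).
  exists (Rmin za zb); split; first exact: Rmin_pos.
  split; first by have := Rmin_l za zb; lra.
  by apply: pos_small_factor_mono zb1; [lra|exact: Rmin_r].
have [ta [ta0 ta1]] := @pos_small_factor (2 * (4 * INR n * K + 2)) (zeta / 2) ltac:(lra) ltac:(lra).
pose tau := Rmin (Rmin tau0 ta) (Rmin r0 t0).
have taup : 0 < tau by rewrite /tau; do 2 (try apply: Rmin_pos).
have l1 : tau <= tau0 := Rle_trans _ _ _ (Rmin_l _ _) (Rmin_l _ _).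
have l2 : tau <= ta := Rle_trans _ _ _ (Rmin_l _ _) (Rmin_r _ _).
have l3 : tau <= r0 := Rle_trans _ _ _ (Rmin_r _ _) (Rmin_l _ _).
have l4 : tau <= t0 := Rle_trans _ _ _ (Rmin_r _ _) (Rmin_r _ _).
have ta2 : 2 * (4 * INR n * K + 2) * tau <= zeta / 2 by apply: pos_small_factor_mono ta1; lra.
have [eps1 [ep1 evo1]] := evo tau (conj taup l1).
have btau : 0 < b * tau by apply: Rmult_lt_0_compat.
pose de := Rmin (zeta / 2) (b * tau / 2).
have dep : 0 < de by apply: Rmin_pos; lra.
have de1 : de <= zeta / 2 := Rmin_l _ _; have de2 : de <= b * tau / 2 := Rmin_r _ _.
have [x0 [y0 [p [hp [hnm hub]]]]] := hnear de dep.
pose t1 := t0 - tau; have ht1 : 0 <= t1 by rewrite /t1; lra.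
have t1E : t1 + tau = t0 by rewrite /t1; ring.
(* With this shift the upper bound at [t1] becomes the bare paraboloid, while at [t0] the sum
   [w1 + w2] at the origin is at least [b * tau - de]. *)
pose m' := m - b * tau.
pose w1 := fun x t => u (vadd y0 x) t + 0; pose w2 := fun x t => - u (vadd x0 x) t + - m'.
have hw1 : jsub w1 := jsub_shift y0 0 hu; have hw2 : jsub w2 := jsub_shift x0 (- m') hmu'.
have h12 : forall y x, w1 y t1 + w2 x t1 <= parab p (K / 2) y x.
  move=> y x; have := hub x y t1 ht1 ltac:(rewrite /t1; lra).
  by rewrite /w1 /w2 /m' /t1; lra.
have [M hM] : exists M, forall y, Rabs (w1 y t1) <= M.
  by have [_ [M hM]] := proj1 hw1; exists M => y; apply: hM.
(* The outer slope [2 K] is the one that [interpolant_gradient] expects; the inner slope [K]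
   dominates the given [K / 2]. *)
have [h [q [hC [hf hg]]]] := lasry_lions p (ltac:(lra) : 0 < 2 * K) hM.
rewrite (_ : 3 * (2 * K) = 6 * K) in hC; last by ring.
have parab_mono y x : parab p (K / 2) y x <= parab p (2 * K / 2) y x.
  by rewrite /parab; have := dot_ge0 (vsub y x); nra.
have hg' : forall z x, h z <= - w2 x t1 + parab p (2 * K) z x.
  move=> z x; apply: hg => y; have := h12 y x; have := parab_mono y x; lra.
have hg0 : forall z, w2 z t1 <= - h z.
  move=> z; have := hg' z z; rewrite /parab (_ : vsub z z = vzero) ?dot0r; [lra|vext].
have hz0 : vadd y0 vzero = y0 by vext. have hx0 : vadd x0 vzero = x0 by vext.
have hde : - de <= w1 vzero (t1 + tau) + w2 vzero (t1 + tau).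
  by rewrite t1E /w1 /w2 hz0 hx0 /m'; lra.
have hze : de + 2 * (4 * INR n * K + 2) * tau <= zeta by lra.
have hgr := interpolant_gradient hw1 hw2 ht1 taup hK sgp h12 hde hC hf hg' hze z1 sg1 z2 mup.
have [rh [rhp rh1]] := @pos_small_factor (INR n * (6 * K)) eps1 ltac:(lra) ep1.
pose rho := Rmin rh 1; have rhop : 0 < rho by apply: Rmin_pos; lra.
have [H [Q [X [K3 [K3p [HC2 Hh]]]]]] := smoothing (ltac:(lra) : 0 <= 6 * K) rhop hC.
have Hh' : forall z, Rabs (H z - h z) <= eps1.
  move=> z; apply: Rle_trans (Hh z) _; apply: Rle_trans rh1.
  have r1 : rho <= rh := Rmin_l _ _; have r2 : rho <= 1 := Rmin_r _ _.
  rewrite -Rmult_assoc; apply: Rmult_le_compat_l; [lra|nra].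
have [c [Mi evo2]] := evo1 K3 K3p.
have E1 := evo2 w1 h q H Q X t1 p hp hw1 ht1 hC hgr hf HC2 Hh'.
have P1 : vnorm (vscal (-1) p) = a by rewrite vnorm_opp.
have P2 : forall i, Rabs (vscal (-1) (q vzero) i - vscal (-1) p i) <= mu.
  move=> i; rewrite /vscal (_ : -1 * q vzero i - -1 * p i = - (q vzero i - p i)); last by ring.
  by rewrite Rabs_Ropp.
have P3 : forall z, Rabs (- H z - - h z) <= eps1.
  move=> z; rewrite (_ : - H z - - h z = - (H z - h z)); last by ring.
  by rewrite Rabs_Ropp.
have := evo2 w2 _ _ _ _ _ t1 (vscal (-1) p) P1 hw2 ht1 (C1_opp hC) P2 hg0 (C2_opp HC2) P3.
have -> : heat_step c (vscal (-1) p) = heat_step c p.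
  by apply: functional_extensionality => G; apply: heat_step_opp_dir.
(* The two evolutions cancel in the sum, leaving [b tau - de <= 2 (b / 8) tau] although
   [de <= b tau / 2]. *)
by rewrite iter_heat_step_opp; move: E1; rewrite t1E /w1 /w2 hz0 hx0 /m'; lra.
Qed.

End NonzeroGradient.

(** * Vanishing gradient: doubling the time variable *)

Section ZeroGradient.
Variable n : nat.
Implicit Types (y z v e eta : 'I_n -> R) (u : ('I_n -> R) -> R -> R).

Lemma vcv_add (x x' : nat -> 'I_n -> R) z z' : vcv x z -> vcv x' z' ->
  vcv (fun k => vadd (x k) (x' k)) (vadd z z').
Proof.
move=> h1 h2 eps he.
have [N1 k1] := h1 (eps / 2) ltac:(lra); have [N2 k2] := h2 (eps / 2) ltac:(lra).
exists (N1 + N2)%coq_nat => k hk.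
rewrite (_ : vsub _ _ = vadd (vsub (x k) z) (vsub (x' k) z')); last by vext.
have := vnorm_add (vsub (x k) z) (vsub (x' k) z').
by have := k1 k ltac:(lia); have := k2 k ltac:(lia); lra.
Qed.

Lemma dot_vcv e (x : nat -> 'I_n -> R) z : vcv x z -> Un_cv (fun k => dot e (x k)) (dot e z).
Proof.
apply: (@vcont_vcv n (fun y => dot e y)); apply: vcont_local_lip => y; exists (vnorm e) => v _.
by rewrite dotDr (_ : _ - _ = dot e v); [exact: CS|ring].
Qed.

Lemma normsq_vcv (x : nat -> 'I_n -> R) z : vcv x z -> Un_cv (fun k => dot (x k) (x k)) (dot z z).
Proof.
move=> h; have := vcont_vcv (C1_vcont (ltac:(lra) : 0 <= 1) (@C1_quadratic n 0 vzero 1 ltac:(lra))) h.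
move=> hh eps he; have [N hN] := hh eps he; exists N => k hk; have := hN k hk.
by rewrite /Rdist !dot0l; rewrite !Rplus_0_l !Rmult_1_l.
Qed.

(** Allows the two times of the doubled function to be identified up to [de], since the touching
    inequality is known at equal times only. *)
Lemma uniform_time_continuity u rho t0 de : cont_bdd u -> 0 < rho -> rho <= t0 -> 0 < de ->
  exists nu, 0 < nu /\ forall y t s, vnorm y <= rho -> Rabs (t - t0) <= rho -> Rabs (s - t0) <= rho ->
    Rabs (t - s) < nu -> Rabs (u y t - u y s) <= de.
Proof.
move=> hu hrho hrt hde; apply: NNPP => hn.
have step k : exists p : ('I_n -> R) * (R * R), vnorm p.1 <= rho /\ Rabs (p.2.1 - t0) <= rho /\
    Rabs (p.2.2 - t0) <= rho /\ Rabs (p.2.1 - p.2.2) < / INR (S k) /\ de < Rabs (u p.1 p.2.1 - u p.1 p.2.2).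
  apply: NNPP => hk; apply: hn; exists (/ INR (S k)); split.
    by apply: Rinv_0_lt_compat; apply: lt_0_INR; lia.
  move=> y t s h1 h2 h3 h4; apply: Rnot_lt_le => hlt; apply: hk.
  by exists (y, (t, s)).
pose pk k := proj1_sig (constructive_indefinite_description _ (step k)).
have pkP k : vnorm (pk k).1 <= rho /\ Rabs ((pk k).2.1 - t0) <= rho /\
    Rabs ((pk k).2.2 - t0) <= rho /\ Rabs ((pk k).2.1 - (pk k).2.2) < / INR (S k) /\
    de < Rabs (u (pk k).1 (pk k).2.1 - u (pk k).1 (pk k).2.2).
  by rewrite /pk; case: constructive_indefinite_description.
have [|s [l [hs hl]]] := @bolzano_family (option 'I_n) (fun k => st (pk k).1 (pk k).2.1) (rho + t0).
  move=> k [i|] /=; have [h1 [h2 _]] := pkP k.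
    by apply: Rle_trans (coord_le_vnorm _ i) _; lra.
  by apply: Rabs_le; move/Rabs_le_between: h2; split; lra.
pose xk k := (pk (s k)).1; pose tk k := (pk (s k)).2.1; pose sk k := (pk (s k)).2.2.
have cx : vcv xk (fun i => l (Some i)) by apply: coord_vcv => i; apply: (hl (Some i)).
have ct : Un_cv tk (l None) := hl None.
have cs : Un_cv sk (l None).
  move=> eps he; have [N1 h1] := ct (eps / 2) ltac:(lra).
  have [N2 [h2 h2']] := archimed_cor1 (eps / 2) ltac:(lra).
  exists (N1 + N2)%coq_nat => k hk.
  have := h1 k ltac:(lia); have [_ [_ [_ [h3 _]]]] := pkP (s k); rewrite /Rdist -/(tk k) -/(sk k) in h3 *.
  have h4 : / INR (S (s k)) <= / INR N2.
    by apply: Rinv_le_contravar; [exact: lt_0_INR|apply: le_INR; have := extraction_ge hs k; lia].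
  by move: h3 => /Rabs_def2 [h5 h6] /Rabs_def2 [h7 h8]; apply: Rabs_def1; lra.
have tp k : 0 <= tk k by have [_ [/Rabs_le_between h2 _]] := pkP (s k); rewrite /tk; lra.
have sp k : 0 <= sk k by have [_ [_ [/Rabs_le_between h2 _]]] := pkP (s k); rewrite /sk; lra.
have [N1 h1] := cont_bdd_cv hu tp cx ct (ltac:(lra) : de / 2 > 0).
have [N2 h2] := cont_bdd_cv hu sp cx cs (ltac:(lra) : de / 2 > 0).
have := h1 (N1 + N2)%coq_nat ltac:(lia); have := h2 (N1 + N2)%coq_nat ltac:(lia).
have [_ [_ [_ [_ h3]]]] := pkP (s (N1 + N2)%coq_nat).
by move: h3; rewrite /Rdist /xk /tk /sk; split_Rabs; lra.
Qed.

Lemma doubled_max (Psi : ('I_n -> R) -> ('I_n -> R) -> R -> R -> R) rho t0 : 0 < rho -> rho <= t0 ->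
  (forall (x w : nat -> 'I_n -> R) (t s : nat -> R) xl wl tl sl,
    (forall k, 0 <= t k) -> (forall k, 0 <= s k) ->
    vcv x xl -> vcv w wl -> Un_cv t tl -> Un_cv s sl ->
    Un_cv (fun k => Psi (x k) (w k) (t k) (s k)) (Psi xl wl tl sl)) ->
  exists x w t s, (vnorm x <= rho /\ vnorm w <= rho /\ t0 - rho <= t <= t0 + rho /\ t0 - rho <= s <= t0 + rho) /\
    forall x' w' t' s', vnorm x' <= rho -> vnorm w' <= rho -> t0 - rho <= t' <= t0 + rho ->
      t0 - rho <= s' <= t0 + rho -> Psi x' w' t' s' <= Psi x w t s.
Proof.
move=> hr hrt hc.
pose I := option (option ('I_n + 'I_n)).
pose px (p : I -> R) : 'I_n -> R := fun i => p (Some (Some (inl i))).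
pose pw (p : I -> R) : 'I_n -> R := fun i => p (Some (Some (inr i))).
pose pt (p : I -> R) : R := p (Some None); pose ps (p : I -> R) : R := p None.
pose mk (x w : 'I_n -> R) (t s : R) : I -> R := fun d =>
  match d with Some (Some (inl i)) => x i | Some (Some (inr i)) => w i | Some None => t | None => s end.
have [|||p [hp hmax]] := @usc_attains_max I
  (fun p => vnorm (px p) <= rho /\ vnorm (pw p) <= rho /\ t0 - rho <= pt p <= t0 + rho /\
     t0 - rho <= ps p <= t0 + rho) (fun p => Psi (px p) (pw p) (pt p) (ps p)) (t0 + rho).
- exists (mk vzero vzero t0 t0); rewrite /px /pw /pt /ps /mk.
  rewrite (_ : (fun i => vzero i) = @vzero n) // vnorm0; lra.
- move=> p [h1 [h2 [h3 h4]]] [[[i|i]|]|].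
  + by apply: Rle_trans (coord_le_vnorm (px p) i) _; lra.
  + by apply: Rle_trans (coord_le_vnorm (pw p) i) _; lra.
  + by rewrite -/(pt p) Rabs_pos_eq; lra.
  + by rewrite -/(ps p) Rabs_pos_eq; lra.
- move=> x l hx hl.
  have cx : vcv (fun k => px (x k)) (px l) by apply: coord_vcv => i; apply: hl.
  have cw : vcv (fun k => pw (x k)) (pw l) by apply: coord_vcv => i; apply: hl.
  have ct : Un_cv (fun k => pt (x k)) (pt l) by apply: hl.
  have cs : Un_cv (fun k => ps (x k)) (ps l) by apply: hl.
  split.
    split; first by apply: vcv_norm_le cx => k; have := hx k; tauto.
    split; first by apply: vcv_norm_le cw => k; have := hx k; tauto.
    by split; [apply: Un_cv_between ct|apply: Un_cv_between cs] => k; have := hx k; tauto.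
  move=> eps he.
  have [||N hN] := hc _ _ _ _ _ _ _ _ _ _ cx cw ct cs eps he.
  + by move=> k; have [_ [_ [h _]]] := hx k; lra.
  + by move=> k; have [_ [_ [_ h]]] := hx k; lra.
  by exists N => k hk; have := hN k hk; rewrite /Rdist => /Rabs_def2; lra.
exists (px p), (pw p), (pt p), (ps p); split=> // x' w' t' s' h1 h2 h3 h4.
exact: (hmax (mk x' w' t' s')).
Qed.

Lemma tr_perp_rank1 eta e : tr_perp eta (fun i j => e i * e j) = dot e e - dot eta e * dot eta e.
Proof.
have -> : dot e e - dot eta e * dot eta e = sumI (fun i => e i * e i + (- dot eta e) * (eta i * e i)).
  by rewrite sumI_add sumI_scal -/(dot e e) -/(dot eta e); ring.
apply: sumI_ext => i.
transitivity (sumI (fun j => kdelta i j * (e i * e j)) + (- (eta i * e i)) * sumI (fun j => eta j * e j)).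
  by rewrite -sumI_scal -sumI_add; apply: sumI_ext => j; ring.
by rewrite (sum_kdelta (fun j => e i * e j)) -/(dot eta e); ring.
Qed.

Lemma qform_rank1 e y : qform (fun i j => e i * e j) y = dot e y * dot e y.
Proof.
rewrite /qform {1}/dot [RHS]Rmult_comm -sumI_scal; apply: sumI_ext => i.
by rewrite Rmult_comm /dot -sumI_scal; apply: sumI_ext => j; ring.
Qed.

Definition aniso K1 al e z : R := /2 * (K1 * (dot e z * dot e z) + al * dot z z).

Lemma aniso_add K1 al e z v : aniso K1 al e (vadd z v) = aniso K1 al e z
  + dot (vadd (vscal (K1 * dot e z) e) (vscal al z)) v
  + /2 * qform (fun i j => K1 * (e i * e j) + al * kdelta i j) v.
Proof.
rewrite /aniso qform_lin qform_rank1 qform_id !(dotDl, dotDr, dotZl, dotZr) (dotC v z); field.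
Qed.

(** The bound holds for every [eta], so nothing has to be known about the gradient at the doubled
    maximum. *)
Lemma aniso_trace K1 al e eta : 0 <= K1 -> 0 <= al -> vnorm e = 1 ->
  tr_perp eta (fun i j => K1 * (e i * e j) + al * kdelta i j) <= K1 + al * INR n.
Proof.
move=> hK hal he; rewrite tr_perp_lin tr_perp_rank1 tr_perp_id -vnorm_sq he.
have := dot_ge0 eta; have := Rle_0_sqr (dot eta e); rewrite /Rsqr => h1 h2.
have := Rmult_le_pos _ _ hK h1; have := Rmult_le_pos _ _ hal h2; lra.
Qed.

Lemma aniso_symm K1 al e : symm (fun i j => K1 * (e i * e j) + al * kdelta i j).
Proof. by apply: symm_lin; [move=> i j; ring|exact: symm_id]. Qed.

(** Only the time doubling has a large coefficient [Np], and its slope cancels when the inequalities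
    are added. In space, the two points are coupled by the fixed quadratic [G], so each side
    contributes at most [K1 + al n] up to small terms. *)
Lemma time_slope_zero_gradient u K1 al b C m t0 r0 : 0 <= K1 -> 0 <= al -> 0 <= C -> 0 < t0 -> 0 < r0 ->
  jsub u -> jsub (fun x t => - u x t) ->
  (forall de, 0 < de -> exists x0 y0 e, vnorm e = 1 /\ m - de <= u y0 t0 - u x0 t0 /\
     forall x z t, 0 <= t -> vnorm z < r0 -> Rabs (t - t0) < r0 ->
       u (vadd y0 (vadd x z)) t - u (vadd x0 x) t <=
       m + aniso K1 al e z + b * (t - t0) + C * ((t - t0) * (t - t0))) ->
  b <= 2 * (K1 + al * INR n).
Proof.
move=> hK1 hal hC ht0 hr0 hu hmu hnear; apply: Rnot_lt_le => hlt.
pose sl := b - 2 * (K1 + al * INR n); have slp : 0 < sl by rewrite /sl; lra.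
have np := pos_INR n.
have [ka [kap ka1]] := @pos_small_factor (6 * INR n) (sl / 4) ltac:(lra) ltac:(lra).
(* Error budget: the localizers add [2 ka n] and [4 ka n] to the traces, whence the [6 n] above;
   within [ra] the quadratic time term changes the slope by at most [sl / 4]. *)
have [ra [rap ra1]] := @pos_small_factor (2 * (C + ka)) (sl / 4) ltac:(lra) ltac:(lra).
pose rho := Rmin ra (Rmin (r0 / 2) t0).
have rhop : 0 < rho by rewrite /rho; do 2 (try apply: Rmin_pos); lra.
have rh1 : rho <= ra := Rmin_l _ _.
have rh2 : rho <= r0 / 2 := Rle_trans _ _ _ (Rmin_r _ _) (Rmin_l _ _).
have rh3 : rho <= t0 := Rle_trans _ _ _ (Rmin_r _ _) (Rmin_r _ _).
have rr : 0 < rho * rho by apply: Rmult_lt_0_compat.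
(* The localizing terms at the maximum total at most [2 de], which keeps [xh], [wh] and [th - t0]
   within [rho / 4], safely inside the domain. *)
pose de := ka * (rho * rho) / 64.
have dep : 0 < de by rewrite /de; have := Rmult_lt_0_compat _ _ kap rr; lra.
have [x0 [y0 [e [he [hnm hub]]]]] := hnear de dep.
pose u1 := fun x t => u (vadd y0 x) t + 0; pose u2 := fun x t => - u (vadd x0 x) t + 0.
have j1 : jsub u1 := jsub_shift y0 0 hu; have j2 : jsub u2 := jsub_shift x0 0 hmu.
have [nu [nup hnu]] := uniform_time_continuity (proj1 j2) rhop rh3 dep.
have [_ [M1 hM1]] := proj1 j1; have [_ [M2 hM2]] := proj1 j2.
pose nu' := Rmin nu (rho / 4); have nup' : 0 < nu' by apply: Rmin_pos; lra.
pose B1 := Rabs (M1 + M2 + Rabs b * rho - (m - de)).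
have B1p : 0 <= B1 := Rabs_pos _.
(* The penalty at the maximum is at most [B1], by boundedness of [u]; this coefficient then forces
   [|th - sh| < nu']. *)
pose Np := (B1 + 1) / (nu' * nu').
have nn : 0 < nu' * nu' by apply: Rmult_lt_0_compat.
have Npp : 0 < Np by apply: Rdiv_lt_0_compat; lra.
have NpE : Np * (nu' * nu') = B1 + 1 by rewrite /Np; field; lra.
pose G z := aniso K1 al e z + ka * dot z z.
have GE z : G z = aniso K1 (al + 2 * ka) e z by rewrite /G /aniso; field.
pose Psi x z t s := u1 (vadd x z) t + u2 x s - G z - ka * dot x x - b * (t - t0)
   - (C + ka) * ((t - t0) * (t - t0)) - Np * ((t - s) * (t - s)).
have [|xh [wh [th [sh [[hx [hw [ht hs]]] hmax]]]]] := @doubled_max Psi rho t0 rhop rh3.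
  move=> x w t s xl wl tl s_l t0' s0' cx cw ct cs.
  have cd : Un_cv (fun k => t k - t0) (tl - t0) by apply: CV_minus => //; apply: Un_cv_const.
  have cds : Un_cv (fun k => t k - s k) (tl - s_l) by apply: CV_minus.
  apply: CV_minus; last by apply: CV_mult; [exact: Un_cv_const|apply: CV_mult].
  apply: CV_minus; last by apply: CV_mult; [exact: Un_cv_const|apply: CV_mult].
  apply: CV_minus; last by apply: CV_mult; [exact: Un_cv_const|].
  apply: CV_minus; last by apply: CV_mult; [exact: Un_cv_const|exact: normsq_vcv].
  apply: CV_minus; last first.
    apply: CV_plus; last by apply: CV_mult; [exact: Un_cv_const|exact: normsq_vcv].
    apply: CV_mult; first exact: Un_cv_const.
    apply: CV_plus; apply: CV_mult; try exact: Un_cv_const; last exact: normsq_vcv.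
    by apply: CV_mult; apply: dot_vcv.
  apply: CV_plus; apply: cont_bdd_cv => //; [exact: (proj1 j1)|exact: vcv_add|exact: (proj1 j2)].
have z0 : vnorm (@vzero n) <= rho by rewrite vnorm0; lra.
have Psi0 : m - de <= Psi vzero vzero t0 t0.
  have a0 : vadd (@vzero n) vzero = vzero by vext.
  have a1 : vadd y0 vzero = y0 by vext.
  have a2 : vadd x0 vzero = x0 by vext.
  rewrite /Psi /u1 /u2 /G /aniso a0 a1 a2 !dot0r !Rminus_diag !Rmult_0_r; lra.
have Psih := Rle_trans _ _ _ Psi0 (hmax vzero vzero t0 t0 z0 z0 ltac:(lra) ltac:(lra)).
have Gpos z : ka * dot z z <= G z.
  rewrite /G /aniso; have := Rle_0_sqr (dot e z); rewrite /Rsqr => h1.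
  have := Rmult_le_pos _ _ hK1 h1; have := Rmult_le_pos _ _ hal (dot_ge0 z); lra.
have q1 : 0 <= ka * dot xh xh by apply: Rmult_le_pos; [lra|exact: dot_ge0].
have q2 : 0 <= ka * dot wh wh by apply: Rmult_le_pos; [lra|exact: dot_ge0].
have q3 : 0 <= ka * ((th - t0) * (th - t0)) by apply: Rmult_le_pos; [lra|exact: Rle_0_sqr].
have q4 : 0 <= C * ((th - t0) * (th - t0)) by apply: Rmult_le_pos; [lra|exact: Rle_0_sqr].
have q5 : 0 <= Np * ((th - sh) * (th - sh)) by apply: Rmult_le_pos; [lra|exact: Rle_0_sqr].
have g1 := Gpos wh.
have bt : - (Rabs b * rho) <= b * (th - t0).
  have := Rle_abs (- (b * (th - t0))); rewrite Rabs_Ropp Rabs_mult => h1.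
  have : Rabs b * Rabs (th - t0) <= Rabs b * rho.
    by apply: Rmult_le_compat_l; [exact: Rabs_pos|apply: Rabs_le; split; lra].
  lra.
have tsn : Rabs (th - sh) < nu'.
  have h1 : Np * ((th - sh) * (th - sh)) < Np * (nu' * nu').
    rewrite NpE; have := Rle_abs (M1 + M2 + Rabs b * rho - (m - de)); rewrite -/B1.
    have := hM1 (vadd xh wh) th ltac:(lra) => /Rabs_le_between.
    have := hM2 xh sh ltac:(lra) => /Rabs_le_between.
    by move: Psih; rewrite /Psi; lra.
  have := Rmult_lt_reg_l _ _ _ Npp h1; split_Rabs; nra.
have nl := Rmin_l nu (rho / 4); have nr := Rmin_r nu (rho / 4); rewrite -/nu' in nl nr.
have small : ka * dot xh xh + ka * dot wh wh + ka * ((th - t0) * (th - t0)) <= 2 * de.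
  have h1 := hnu xh th sh hx ltac:(apply: Rabs_le; split; lra) ltac:(apply: Rabs_le; split; lra) ltac:(lra).
  have := hub xh wh th ltac:(lra) ltac:(lra) ltac:(apply: Rabs_def1; lra).
  move: Psih h1; rewrite /Psi /u1 /u2 /G => h2 /Rabs_le_between h3; lra.
have rb : forall r2, ka * r2 <= 2 * de -> r2 <= rho / 4 * (rho / 4).
  move=> r2 h; apply: (Rmult_le_reg_l ka) => //; rewrite /de in h.
  by have := Rmult_lt_0_compat _ _ kap rr; lra.
have bx : vnorm xh <= rho / 4 by apply: vnorm_le; [lra|apply: rb; lra].
have bw : vnorm wh <= rho / 4 by apply: vnorm_le; [lra|apply: rb; lra].
have btt : Rabs (th - t0) <= rho / 4.
  have := rb ((th - t0) * (th - t0)) ltac:(lra) => h; split_Rabs; nra.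
have bts : - (rho / 2) <= sh - t0 <= rho / 2.
  by move: tsn btt => /Rabs_def2 h1 /Rabs_le_between h2; lra.
have /Rabs_le_between btt' := btt.
(* The upper point and its time vary, the lower point being frozen: [z] moves by [v]. *)
have [|eta1 [_ s1]] := proj2 j1 (vadd xh wh) th ltac:(lra)
  (b + 2 * (C + ka) * (th - t0) + 2 * Np * (th - sh))
  (vadd (vscal (K1 * dot e wh) e) (vscal (al + 2 * ka) wh))
  (fun i j => K1 * (e i * e j) + (al + 2 * ka) * kdelta i j) (C + ka + Np) (rho / 4)
  (aniso_symm _ _ _) ltac:(lra).
  move=> y t htt; move ev: (vsub y (vadd xh wh)) => v hv /Rabs_def2 hdt.
  have ey : y = vadd xh (vadd wh v) by rewrite -ev; vext.
  have hwv : vnorm (vadd wh v) <= rho by have := vnorm_add wh v; lra.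
  have := hmax xh (vadd wh v) t sh hx hwv ltac:(lra) ltac:(lra).
  rewrite /Psi !GE aniso_add -ey; lra.
(* The lower point varies while the upper one [x + z] is frozen: [z] moves by [- v], and the
   localizer in [x] adds another [2 ka I]. *)
have [|eta2 [_ s2]] := proj2 j2 xh sh ltac:(lra)
  (- (2 * Np * (th - sh)))
  (vadd (vscal (-1) (vadd (vscal (K1 * dot e wh) e) (vscal (al + 2 * ka) wh))) (vscal (2 * ka) xh))
  (fun i j => K1 * (e i * e j) + (al + 4 * ka) * kdelta i j) Np (rho / 4)
  (aniso_symm _ _ _) ltac:(lra).
  move=> x s hss; move ev: (vsub x xh) => v hv /Rabs_def2 hds.
  have ex : x = vadd xh v by rewrite -ev; vext.
  have hxv : vnorm x <= rho by rewrite ex; have := vnorm_add xh v; lra.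
  have hwv : vnorm (vadd wh (vscal (-1) v)) <= rho.
    by have := vnorm_add wh (vscal (-1) v); rewrite vnorm_opp; lra.
  have := hmax x (vadd wh (vscal (-1) v)) th s hxv hwv ltac:(lra) ltac:(lra).
  rewrite /Psi !GE aniso_add.
  have -> : vadd x (vadd wh (vscal (-1) v)) = vadd xh wh by rewrite ex; vext.
  have -> : dot x x = dot xh xh + 2 * dot xh v + dot v v.
    by rewrite ex !(dotDl, dotDr) (dotC v xh); ring.
  rewrite qform_scal !qform_lin qform_id dotZr.
  rewrite (dotDl (vscal (-1) _)) (dotZl (-1)) (dotZl (2 * ka) xh); lra.
have u1_ := aniso_trace eta1 hK1 (ltac:(lra) : 0 <= al + 2 * ka) he.
have u2_ := aniso_trace eta2 hK1 (ltac:(lra) : 0 <= al + 4 * ka) he.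
have : - (sl / 4) <= 2 * (C + ka) * (th - t0).
  have : 2 * (C + ka) * (- ra) <= 2 * (C + ka) * (th - t0) by apply: Rmult_le_compat_l; lra.
  lra.
by rewrite /sl in ka1 slp *; lra.
Qed.

End ZeroGradient.

(** * Reduction to the two cases *)

Lemma mean_value (f f' : R -> R) a b : (forall x, is_derive f x (f' x)) ->
  exists c, Rmin a b <= c <= Rmax a b /\ f b - f a = f' c * (b - a).
Proof.
move=> hf; have [||c [hc e]] := @MVT_gen f a b f'.
- by move=> x _; apply: hf.
- by move=> x _; apply/continuity_pt_filterlim; apply: ex_derive_continuous; exists (f' x).
by exists c.
Qed.

Lemma has_partial_unique (I : finType) (F G G' : (I -> R) -> R) i :
  has_partial F G i -> has_partial F G' i -> G = G'.
Proof.
by move=> h h'; apply: functional_extensionality => p; apply: uniqueness_limite (h p) (h' p).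
Qed.

Lemma is_derive_pt2_fst F G s t : has_partial F G true ->
  is_derive (fun s => F (pt2 s t)) s (G (pt2 s t)).
Proof.
move=> h; apply/is_derive_Reals => eps he; have [d hd] := h (pt2 s t) eps he.
exists d => k hk hkd; have := hd k hk hkd; rewrite Rplus_0_l.
have e k' : upd (pt2 s t) true k' = pt2 (s + k') t.
  by apply: functional_extensionality => -[]; rewrite /upd /pt2 /=.
by rewrite !e Rplus_0_r.
Qed.

Lemma is_derive_pt2_snd F G s t : has_partial F G false ->
  is_derive (fun t => F (pt2 s t)) t (G (pt2 s t)).
Proof.
move=> h; apply/is_derive_Reals => eps he; have [d hd] := h (pt2 s t) eps he.
exists d => k hk hkd; have := hd k hk hkd; rewrite Rplus_0_l.
have e k' : upd (pt2 s t) false k' = pt2 s (t + k').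
  by apply: functional_extensionality => -[]; rewrite /upd /pt2 /=.
by rewrite !e Rplus_0_r.
Qed.

(** The derivatives in the theorem are arbitrary witnesses; uniqueness of partial derivatives
    identifies them with the continuous ones provided by [smooth]. *)
Lemma smooth_hessian_cont (I : finType) (phi : (I -> R) -> R) Dphi D2phi : smooth phi ->
  (forall d, has_partial phi (Dphi d) d) -> (forall e d, has_partial (Dphi d) (D2phi e d) e) ->
  forall e d : I, contR (D2phi e d).
Proof.
move=> hs h1 h2 e d; have [_ /(_ d) [G [hG [_ /(_ e) [G' [hG' hc]]]]]] := hs (S (S O)).
have eG := has_partial_unique hG (h1 d); subst G.
by have eG' := has_partial_unique hG' (h2 e d); subst G'.
Qed.

Lemma Rmin_Rmax_dist a b c : Rmin a b <= c <= Rmax a b -> Rabs (c - a) <= Rabs (b - a).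
Proof. by rewrite /Rmin /Rmax; case: Rle_dec => h1 h2; split_Rabs; lra. Qed.

(** Expanding in [s] at time [t0], and then in [t] at the new [s], leaves one product
    [|s - s0| |t - t0|]. Young's inequality splits it into a small multiple of [(s - s0)^2] and a
    harmless multiple of [(t - t0)^2]. *)
Lemma taylor_upper (phi : (bool -> R) -> R) Dphi D2phi s0 t0 al : smooth phi ->
  (forall d, has_partial phi (Dphi d) d) -> (forall e d, has_partial (Dphi d) (D2phi e d) e) ->
  0 < al -> exists C rho, 0 <= C /\ 0 < rho /\ forall s t, Rabs (s - s0) < rho -> Rabs (t - t0) < rho ->
    phi (pt2 s t) <= phi (pt2 s0 t0) + Dphi true (pt2 s0 t0) * (s - s0)
      + Dphi false (pt2 s0 t0) * (t - t0)
      + /2 * (D2phi true true (pt2 s0 t0) + al) * ((s - s0) * (s - s0)) + C * ((t - t0) * (t - t0)).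
Proof.
move=> hs h1 h2 hal.
have hc := smooth_hessian_cont hs h1 h2.
have [d1 [d1p k1]] := hc true true (pt2 s0 t0) (al / 2) ltac:(lra).
have [d2 [d2p k2]] := hc true false (pt2 s0 t0) 1 ltac:(lra).
have [d3 [d3p k3]] := hc false false (pt2 s0 t0) 1 ltac:(lra).
set A := D2phi true true (pt2 s0 t0) in k1 *.
set B := D2phi true false (pt2 s0 t0) in k2; set E := D2phi false false (pt2 s0 t0) in k3.
pose L := Rabs B + Rabs E + 1.
have B0 := Rabs_pos B; have E0 := Rabs_pos E; have L0 : 0 < L by rewrite /L; lra.
exists (L + L * L / al), (Rmin d1 (Rmin d2 d3)).
split.
  have : 0 < L * L / al by apply: Rdiv_lt_0_compat; nra.
  lra.
split; first by do 2 (try apply: Rmin_pos).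
move=> s t hs' ht'.
have near : forall s' t', Rabs (s' - s0) <= Rabs (s - s0) -> Rabs (t' - t0) <= Rabs (t - t0) ->
   forall j, Rabs (pt2 s' t' j - pt2 s0 t0 j) < Rmin d1 (Rmin d2 d3).
  by move=> s' t' hh1 hh2 [] /=; lra.
have m1 := Rmin_l d1 (Rmin d2 d3).
have m2 := Rle_trans _ _ _ (Rmin_r d1 (Rmin d2 d3)) (Rmin_l d2 d3).
have m3 := Rle_trans _ _ _ (Rmin_r d1 (Rmin d2 d3)) (Rmin_r d2 d3).
have zz : forall x, Rabs (x - x) = 0 by move=> x; rewrite Rminus_diag Rabs_R0.
have ap := Rabs_pos (s - s0); have bp := Rabs_pos (t - t0).
have part1 : phi (pt2 s t0) <= phi (pt2 s0 t0) + Dphi true (pt2 s0 t0) * (s - s0)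
    + /2 * (A + al / 2) * ((s - s0) * (s - s0)).
  pose k x := phi (pt2 x t0) - (Dphi true (pt2 s0 t0) * (x - s0) + /2 * (A + al / 2) * ((x - s0) * (x - s0))).
  pose k' x := Dphi true (pt2 x t0) - (Dphi true (pt2 s0 t0) + (A + al / 2) * (x - s0)).
  have dk x : is_derive k x (k' x).
    have dd1 := is_derive_pt2_fst x t0 (h1 true).
    have dd2 : is_derive (fun x => Dphi true (pt2 s0 t0) * (x - s0) + /2 * (A + al / 2) * ((x - s0) * (x - s0)))
       x (Dphi true (pt2 s0 t0) + (A + al / 2) * (x - s0)) by auto_derive => //; field.
    exact: (is_derive_minus _ _ _ _ _ dd1 dd2).
  have [c [hcb hce]] := mean_value s0 s dk.
  have cd := Rmin_Rmax_dist hcb.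
  have [c' [hcb' hce']] := mean_value s0 c (fun x => is_derive_pt2_fst x t0 (h2 true true)).
  have cd' := Rmin_Rmax_dist hcb'.
  have := k1 (pt2 c' t0) ltac:(move=> j; apply: Rlt_le_trans (near _ _ _ _ j) m1; rewrite ?zz; lra).
  move=> /Rabs_def2 [kk1 kk2].
  have hk : k' c = (D2phi true true (pt2 c' t0) - A - al / 2) * (c - s0) by rewrite /k'; lra.
  have sg : 0 <= (c - s0) * (s - s0).
    by move: hcb; rewrite /Rmin /Rmax; case: Rle_dec => hh1 hh2; nra.
  have : k s - k s0 <= 0 by rewrite hce hk; nra.
  rewrite /k; lra.
have part2 : phi (pt2 s t) - phi (pt2 s t0) <= Dphi false (pt2 s0 t0) * (t - t0)
    + L * (Rabs (s - s0) * Rabs (t - t0)) + L * ((t - t0) * (t - t0)).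
  have [c [hcb hce]] := mean_value t0 t (fun x => is_derive_pt2_snd s x (h1 false)).
  have cd := Rmin_Rmax_dist hcb.
  have [c1 [hcb1 hce1]] := mean_value s0 s (fun x => is_derive_pt2_fst x c (h2 true false)).
  have cd1 := Rmin_Rmax_dist hcb1.
  have [c2 [hcb2 hce2]] := mean_value t0 c (fun x => is_derive_pt2_snd s0 x (h2 false false)).
  have cd2 := Rmin_Rmax_dist hcb2.
  have := k2 (pt2 c1 c) ltac:(move=> j; apply: Rlt_le_trans (near _ _ _ _ j) m2; lra).
  have := k3 (pt2 s0 c2) ltac:(move=> j; apply: Rlt_le_trans (near _ _ _ _ j) m3; rewrite ?zz; lra).
  move=> kk3 kk2.
  have b2 : Rabs (D2phi true false (pt2 c1 c)) <= L by have := Rabs_triang_inv (D2phi true false (pt2 c1 c)) B; rewrite /L; lra.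
  have b3 : Rabs (D2phi false false (pt2 s0 c2)) <= L by have := Rabs_triang_inv (D2phi false false (pt2 s0 c2)) E; rewrite /L; lra.
  have e1 : Dphi false (pt2 s c) - Dphi false (pt2 s0 t0) =
    D2phi true false (pt2 c1 c) * (s - s0) + D2phi false false (pt2 s0 c2) * (c - t0) by lra.
  have e2 : Rabs (Dphi false (pt2 s c) - Dphi false (pt2 s0 t0)) <= L * Rabs (s - s0) + L * Rabs (t - t0).
    rewrite e1; apply: Rle_trans (Rabs_triang _ _) _; rewrite !Rabs_mult.
    by apply: Rplus_le_compat; apply: Rmult_le_compat => //; try exact: Rabs_pos; exact: Rle_refl.
  rewrite hce.
  have -> : Dphi false (pt2 s c) * (t - t0) = Dphi false (pt2 s0 t0) * (t - t0) +
    (Dphi false (pt2 s c) - Dphi false (pt2 s0 t0)) * (t - t0) by ring.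
  have := Rle_abs ((Dphi false (pt2 s c) - Dphi false (pt2 s0 t0)) * (t - t0)); rewrite Rabs_mult.
  have := Rmult_le_compat_r _ _ _ bp e2.
  have -> : (t - t0) * (t - t0) = Rabs (t - t0) * Rabs (t - t0).
    by rewrite -Rabs_mult Rabs_pos_eq //; exact: Rle_0_sqr.
  lra.
have ss : (s - s0) * (s - s0) = Rabs (s - s0) * Rabs (s - s0).
  by rewrite -Rabs_mult Rabs_pos_eq //; exact: Rle_0_sqr.
have tt : (t - t0) * (t - t0) = Rabs (t - t0) * Rabs (t - t0).
  by rewrite -Rabs_mult Rabs_pos_eq //; exact: Rle_0_sqr.
move: part1 part2; rewrite ss tt; move: (Rabs (s - s0)) (Rabs (t - t0)) => a b p1 p2.
have amgm : L * (a * b) <= al / 4 * (a * a) + L * L / al * (b * b).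
  have -> : al / 4 * (a * a) + L * L / al * (b * b) =
     al / 4 * ((a - 2 * L / al * b) * (a - 2 * L / al * b)) + L * (a * b) by field; lra.
  have : 0 <= al / 4 * ((a - 2 * L / al * b) * (a - 2 * L / al * b)).
    by apply: Rmult_le_pos; [lra|exact: Rle_0_sqr].
  lra.
lra.
Qed.

(** * From the modulus to differences of [u] at pairs of points *)

Section Distance.
Variable n : nat.
Implicit Types (x y z e : 'I_n -> R).

(** The lower bound is Cauchy-Schwarz for [z0] and [z0 + z], the upper one is [0 <= (v - 2 s0)^2];
    the gap between them measures the curvature of the sphere of radius [2 s0]. *)
Lemma norm_expansion z0 z s0 : 0 < s0 -> vnorm z0 = 2 * s0 ->
  dot (vscal (/ (2 * s0)) z0) z <= vnorm (vadd z0 z) - 2 * s0 <=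
  dot (vscal (/ (2 * s0)) z0) z + dot z z / (4 * s0).
Proof.
move=> hs hz; rewrite dotZl; set a := dot z0 z; set v := vnorm (vadd z0 z).
have v0 : 0 <= v := vnorm_ge0 _.
have vv : v * v = 4 * s0 * s0 + 2 * a + dot z z.
  by rewrite /v vnorm_sq !(dotDl, dotDr) (dotC z z0) -(vnorm_sq z0) hz /a; ring.
have e1 : 2 * s0 * (/ (2 * s0) * a) = a by field; lra.
have cs : a <= 2 * s0 * v - 4 * s0 * s0.
  have := CS z0 (vadd z0 z) => /Rabs_le_between [_].
  by rewrite dotDr -(vnorm_sq z0) hz -/v -/a; lra.
split; apply: (Rmult_le_reg_l (2 * s0)); rewrite ?Rmult_plus_distr_l ?Rmult_minus_distr_l ?e1; try lra.
have -> : 2 * s0 * (dot z z / (4 * s0)) = dot z z / 2 by field; lra.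
have := Rle_0_sqr (v - 2 * s0); rewrite /Rsqr; lra.
Qed.

Lemma norm_increment z0 z s0 : vnorm z0 = 2 * s0 -> Rabs (vnorm (vadd z0 z) - 2 * s0) <= vnorm z.
Proof.
move=> hz; have h1 := vnorm_add z0 z; have h2 := vnorm_sub (vadd z0 z) z.
rewrite (_ : vsub (vadd z0 z) z = z0) in h2; last by vext.
by apply: Rabs_le; split; lra.
Qed.

End Distance.

Section Modulus.
Variable n : nat.
Variables (u : ('I_n -> R) -> R -> R) (omega : R -> R -> R).
Implicit Types (x y z : 'I_n -> R).

(** Since [omega] is half a difference at half a distance, the change [D] of the distance moves [s]
    by [D / 2] and everything is doubled: the coefficients become [phi'], [phi'' / 4] and [2 phi_t].
    The bound holds for every pair at distance [2 s0], near-maximal or not. *)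
Lemma omega_local_bound (phi : (bool -> R) -> R) Dphi D2phi s0 t0 r al : is_omega u omega -> smooth phi ->
  (forall d, has_partial phi (Dphi d) d) -> (forall e d, has_partial (Dphi d) (D2phi e d) e) ->
  0 < s0 -> 0 < t0 -> 0 < r -> 0 < al ->
  (forall s t, 0 < s -> 0 < t -> Rabs (s - s0) < r -> Rabs (t - t0) < r ->
     omega s t - phi (pt2 s t) <= omega s0 t0 - phi (pt2 s0 t0)) ->
  exists C rho, 0 <= C /\ 0 < rho /\ rho <= s0 /\ rho <= t0 /\
  (forall de, 0 < de -> exists x0 y0, vnorm (vsub y0 x0) = 2 * s0 /\
     2 * omega s0 t0 - de <= u y0 t0 - u x0 t0) /\
  (forall x0 y0 x z t, vnorm (vsub y0 x0) = 2 * s0 -> vnorm z < rho -> Rabs (t - t0) < rho ->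
     let D := vnorm (vadd (vsub y0 x0) z) - 2 * s0 in
     u (vadd y0 (vadd x z)) t - u (vadd x0 x) t <= 2 * omega s0 t0 + Dphi true (pt2 s0 t0) * D
      + /4 * (D2phi true true (pt2 s0 t0) + al) * (D * D)
      + 2 * Dphi false (pt2 s0 t0) * (t - t0) + C * ((t - t0) * (t - t0))).
Proof.
move=> hom hsm h1 h2 hs0 ht0 hr hal hmax.
have [C [rho [C0 [rho0 ht]]]] := taylor_upper s0 t0 hsm h1 h2 hal.
pose rh := Rmin (Rmin rho r) (Rmin s0 t0).
have l1 : rh <= rho := Rle_trans _ _ _ (Rmin_l _ _) (Rmin_l _ _).
have l2 : rh <= r := Rle_trans _ _ _ (Rmin_l _ _) (Rmin_r _ _).
have l3 : rh <= s0 := Rle_trans _ _ _ (Rmin_r _ _) (Rmin_l _ _).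
have l4 : rh <= t0 := Rle_trans _ _ _ (Rmin_r _ _) (Rmin_r _ _).
exists (2 * C), rh; split; first lra. split; first by rewrite /rh; do 2 (try apply: Rmin_pos).
split=> //; split=> //; split.
  move=> de hde; have [_ hlub] := hom s0 t0 ltac:(lra) ltac:(lra).
  apply: NNPP => hn; have : omega s0 t0 <= omega s0 t0 - de / 2; last by lra.
  apply: hlub => v [x [y [hxy ->]]]; apply: Rnot_lt_le => hlt; apply: hn.
  by exists x, y; split; lra.
move=> x0 y0 x z t hz0 hz htt D.
have hD := norm_increment z hz0; rewrite -/D in hD.
pose s := s0 + D / 2.
have sd : s - s0 = D / 2 by rewrite /s; ring.
have D2 : Rabs (D / 2) < rh by move: hD; split_Rabs; lra.
have hs : Rabs (s - s0) < rh by rewrite sd.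
have sp : 0 < s by move: hs => /Rabs_def2; lra.
have tp : 0 < t by move: htt => /Rabs_def2; lra.
have [hub _] := hom s t ltac:(lra) ltac:(lra).
have := hub ((u (vadd y0 (vadd x z)) t - u (vadd x0 x) t) / 2).
have e : vsub (vadd y0 (vadd x z)) (vadd x0 x) = vadd (vsub y0 x0) z by vext.
have hh : vnorm (vsub (vadd y0 (vadd x z)) (vadd x0 x)) / 2 = s by rewrite e /s /D; field.
move=> /(_ (ex_intro _ _ (ex_intro _ _ (conj hh erefl)))) k1.
have k2 := hmax s t sp tp ltac:(lra) ltac:(lra).
have := ht s t ltac:(lra) ltac:(lra); rewrite sd; lra.
Qed.

Lemma omega_subsolution_of_jsub : jsub u -> jsub (fun x t => - u x t) -> is_omega u omega ->
  omega_subsolution omega.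
Proof.
move=> hu hmu hom phi hsm s0 t0 hs0 ht0 [r [hr hmax]] Dphi D2phi h1 h2.
set p0 := pt2 s0 t0; apply: Rnot_lt_le => hlt.
pose A := D2phi true true p0; pose ft := Dphi false p0; pose fs := Dphi true p0.
have ftp : 0 < ft by apply: Rle_lt_trans (Rmax_l _ _) hlt.
have ftA : Rmax 0 A < 2 * ft.
  have := Rle_lt_trans _ _ _ (Rmax_r _ _) hlt; rewrite -/A -/ft => k1.
  by rewrite /Rmax; case: Rle_dec => k2; move: k1; split_Rabs; lra.
have A1 := Rmax_r 0 A; have A2 := Rmax_l 0 A.
have unit : forall x0 y0 : 'I_n -> R, vnorm (vsub y0 x0) = 2 * s0 -> vnorm (vscal (/ (2 * s0)) (vsub y0 x0)) = 1.
  move=> x0 y0 h; rewrite vnorm_scal h Rabs_pos_eq; first by field; lra.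
  by left; apply: Rinv_0_lt_compat; lra.
have np := pos_INR n.
case: (Req_dec fs 0) => hfs.
  (* One quarter of the slack [sl] pays for the Taylor error [al], another for the isotropic part
     [ka * n * be]. *)
  pose sl := 2 * ft - Rmax 0 A; have slp : 0 < sl by rewrite /sl; lra.
  pose al := sl / 4; pose ka := Rmax 0 A + al.
  have kap : 0 < ka by rewrite /ka /al; lra.
  have [a' [ap1 ap2]] := @pos_small_factor (ka * INR n) (sl / 4) ltac:(apply: Rmult_le_pos; lra) ltac:(lra).
  pose be := Rmin a' 1; have bep : 0 < be by apply: Rmin_pos; lra.
  have be1 : be <= 1 := Rmin_r _ _.
  have be2 : ka * INR n * be <= sl / 4.
    by apply: pos_small_factor_mono ap2; [apply: Rmult_le_pos; lra|exact: Rmin_l].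
  have [C [rho [C0 [rho0 [rs [rt [hnear hloc]]]]]]] := omega_local_bound hom hsm h1 h2 hs0 ht0 hr (ltac:(rewrite /al; lra) : 0 < al) hmax.
  have sbe : 0 < s0 * be by apply: Rmult_lt_0_compat.
  have := @time_slope_zero_gradient n u (ka / 2) (ka * be / 2) (2 * ft) C (2 * omega s0 t0) t0 (Rmin rho (s0 * be)).
  move=> /(_ ltac:(lra) ltac:(have := Rmult_lt_0_compat _ _ kap bep; lra) C0 ht0 ltac:(by apply: Rmin_pos) hu hmu).
  have key : ka + ka * INR n * be < 2 * ft by rewrite /ka /al /sl in be2 *; lra.
  suff hh : forall de, 0 < de -> exists x0 y0 e, vnorm e = 1 /\ 2 * omega s0 t0 - de <= u y0 t0 - u x0 t0 /\
     forall x z t, 0 <= t -> vnorm z < Rmin rho (s0 * be) -> Rabs (t - t0) < Rmin rho (s0 * be) ->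
       u (vadd y0 (vadd x z)) t - u (vadd x0 x) t <=
       2 * omega s0 t0 + aniso (ka / 2) (ka * be / 2) e z + 2 * ft * (t - t0) + C * ((t - t0) * (t - t0)).
    by move=> /(_ hh); lra.
  move=> de hde; have [x0 [y0 [hd hnm]]] := hnear de hde.
  exists x0, y0, (vscal (/ (2 * s0)) (vsub y0 x0)); split; first exact: unit.
  split=> // x z t ht hz htt.
  have z1 := Rlt_le_trans _ _ _ hz (Rmin_l _ _); have z2 := Rlt_le_trans _ _ _ hz (Rmin_r _ _).
  have := hloc x0 y0 x z t hd z1 (Rlt_le_trans _ _ _ htt (Rmin_l _ _)).
  rewrite -/p0 -/A -/ft -/fs hfs /=.
  have [n1 n2] := norm_expansion z hs0 hd.
  have un := unit _ _ hd; set e := vscal _ _ in n1 n2 un *; set D := vnorm _ - _ in n1 n2 *.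
  have nz := vnorm_ge0 z.
  have cs := CS e z; rewrite un Rmult_1_l in cs.
  (* For [|z| < s0 be] the expansion gives [D - e.z <= be |z| / 4], and [|D + e.z|] is at most
     [3 |z|]; so the square of the distance increment is nearly rank one. *)
  have D2 : D * D <= dot e z * dot e z + be * dot z z.
    rewrite -vnorm_sq in n2 *; move: (vnorm z) nz z2 cs n2 => Z nz z2 /Rabs_le_between cs n2.
    have e0 : Z * Z / (4 * s0) <= be / 4 * Z.
      have -> : be / 4 * Z = (s0 * be * Z) / (4 * s0) by field; lra.
      apply: Rmult_le_compat_r; first by left; apply: Rinv_0_lt_compat; lra.
      by apply: Rmult_le_compat_r; lra.
    move: (dot e z) n1 n2 cs => E n1 n2 cs.
    have k0 : D - E <= be / 4 * Z by lra.
    have k3 : be / 4 * Z <= Z / 4 by nra.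
    have : (D - E) * (D + E) <= (be / 4 * Z) * (3 * Z).
      apply: Rle_trans (_ : (D - E) * (3 * Z) <= _); first by apply: Rmult_le_compat_l; lra.
      by apply: Rmult_le_compat_r; lra.
    have : 0 <= be * (Z * Z) by apply: Rmult_le_pos; nra.
    lra.
  rewrite /aniso.
  have a1 : / 4 * (A + al) * (D * D) <= /4 * ka * (D * D).
    by apply: Rmult_le_compat_r; [exact: Rle_0_sqr|rewrite /ka; lra].
  have := Rmult_le_compat_l (/4 * ka) _ _ ltac:(lra) D2.
  lra.
have [C [rho [C0 [rho0 [rs [rt [hnear hloc]]]]]]] := omega_local_bound hom hsm h1 h2 hs0 ht0 hr Rlt_0_1 hmax.
have [_ [M hM]] := proj1 hu.
(* Half of the time slope [2 ft] absorbs the term [C (t - t0)^2] for [t] in [[t0 - rc, t0]]; the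
   slope [ft] remains. *)
have [rc [rcp rc1]] := @pos_small_factor C ft C0 ftp.
pose r0 := Rmin rc (rho / 2); have r0p : 0 < r0 by apply: Rmin_pos; lra.
have r01 : r0 <= rc := Rmin_l _ _; have r02 : r0 <= rho / 2 := Rmin_r _ _.
have fa := Rabs_pos_lt _ hfs; have A0 := Rabs_pos A; have w0 := Rabs_pos (2 * omega s0 t0).
have M0 : 0 <= M by apply: Rle_trans (Rabs_pos _) (hM vzero 0 ltac:(lra)).
(* [Q1] handles [|z| < rho], covering the curvature of the distance and the second derivative of
   [phi]. [Q2] makes the paraboloid dominate the bound of [u] for [|z| >= rho], as the
   nonzero-gradient case requires a global inequality. *)
pose Q1 := Rabs fs / (4 * s0) + (Rabs A + 1) / 4.
pose Q2 := Rabs fs / rho + (2 * M + Rabs (2 * omega s0 t0) + ft * r0) / (rho * rho).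
have rr : 0 < rho * rho by apply: Rmult_lt_0_compat.
have fr : 0 < ft * r0 by apply: Rmult_lt_0_compat.
have Q1p : 0 < Q1.
  have : 0 < Rabs fs / (4 * s0) by apply: Rdiv_lt_0_compat; lra.
  rewrite /Q1; lra.
have Q2p : 0 < Q2.
  have : 0 < Rabs fs / rho by apply: Rdiv_lt_0_compat; lra.
  have : 0 < (2 * M + Rabs (2 * omega s0 t0) + ft * r0) / (rho * rho) by apply: Rdiv_lt_0_compat; lra.
  rewrite /Q2; lra.
pose K := 2 * (Q1 + Q2).
apply: (@no_increase_nonzero_gradient n u (Rabs fs) K ft (2 * omega s0 t0) t0 r0 fa _ ftp ht0 r0p hu hmu).
  by rewrite /K; lra.
move=> de hde; have [x0 [y0 [hd hnm]]] := hnear de hde.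
have un := unit _ _ hd.
set e := vscal _ _ in un.
exists x0, y0, (vscal fs e); split; first by rewrite vnorm_scal un; ring.
split=> // x y t ht htt.
rewrite /parab dotZl; set z := vsub y x.
have K2 : K / 2 = Q1 + Q2 by rewrite /K; field.
rewrite K2.
have nz := vnorm_ge0 z; have zz := dot_ge0 z.
have cs := CS e z; rewrite un Rmult_1_l in cs.
case: (Rlt_le_dec (vnorm z) rho) => hz.
  have := hloc x0 y0 x z t hd hz ltac:(apply: Rabs_def1; lra).
  rewrite -/p0 -/A -/ft -/fs /= (_ : vadd x z = y); last by rewrite /z; vext.
  have [n1 n2] := norm_expansion z hs0 hd; have n3 := norm_increment z hd.
  rewrite -/e in n1 n2; set D := vnorm _ - _ in n1 n2 n3 *.
  have k1 : fs * D <= fs * dot e z + Rabs fs / (4 * s0) * dot z z.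
    have -> : Rabs fs / (4 * s0) * dot z z = Rabs fs * (dot z z / (4 * s0)) by field; lra.
    have w4 : 0 <= dot z z / (4 * s0) by apply: Rdiv_le_0_compat; lra.
    move: (dot z z / (4 * s0)) w4 n2 => W w4 n2.
    case: (Rle_lt_dec 0 fs) => hf; [rewrite (Rabs_pos_eq fs) //|rewrite (Rabs_left fs) //].
      by have := Rmult_le_compat_l fs _ _ hf n2; lra.
    have := Rmult_le_compat_l (- fs) _ _ ltac:(lra) n1.
    by have := Rmult_le_pos (- fs) W ltac:(lra) w4; lra.
  have k2 : / 4 * (A + 1) * (D * D) <= (Rabs A + 1) / 4 * dot z z.
    have DD : D * D <= dot z z.
      by rewrite -vnorm_sq; move: n3 => /Rabs_le_between n3; nra.
    have := Rle_abs A; have := Rle_0_sqr D; rewrite /Rsqr => d0 a0.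
    apply: Rle_trans (_ : / 4 * (Rabs A + 1) * (D * D) <= _); first by apply: Rmult_le_compat_r; lra.
    apply: Rle_trans (_ : / 4 * (Rabs A + 1) * dot z z <= _); last lra.
    by apply: Rmult_le_compat_l; lra.
  have k3 : 2 * ft * (t - t0) + C * ((t - t0) * (t - t0)) <= - (ft * (t0 - t)).
    have : C * (t0 - t) <= ft by apply: Rle_trans rc1; apply: Rmult_le_compat_l; lra.
    nra.
  have : 0 <= Q2 * dot z z by apply: Rmult_le_pos; lra.
  rewrite /Q1; lra.
have := hM (vadd y0 y) t ht; have := hM (vadd x0 x) t ht.
move=> /Rabs_le_between m1 /Rabs_le_between m2.
have b1 : ft * (t0 - t) <= ft * r0 by apply: Rmult_le_compat_l; lra.
have b2 : - (Rabs fs * vnorm z) <= fs * dot e z.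
  have := Rle_abs (- (fs * dot e z)); rewrite Rabs_Ropp Rabs_mult.
  have := Rmult_le_compat_l _ _ _ (Rlt_le _ _ fa) cs; lra.
have b3 : Rabs fs * vnorm z <= Rabs fs / rho * dot z z.
  rewrite -vnorm_sq; have -> : Rabs fs / rho * (vnorm z * vnorm z) = Rabs fs * (vnorm z * (vnorm z / rho)) by field; lra.
  apply: Rmult_le_compat_l; first lra.
  have : 1 <= vnorm z / rho by apply: (Rmult_le_reg_r rho) => //; rewrite /Rdiv Rmult_assoc Rinv_l; lra.
  nra.
have b4 : 2 * M + Rabs (2 * omega s0 t0) + ft * r0 <=
   (2 * M + Rabs (2 * omega s0 t0) + ft * r0) / (rho * rho) * dot z z.
  have zr : rho * rho <= dot z z by rewrite -vnorm_sq; nra.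
  set T := 2 * M + _ + _; have T0 : 0 <= T / (rho * rho) by apply: Rdiv_le_0_compat; rewrite /T; lra.
  have {1}-> : T = T / (rho * rho) * (rho * rho) by field; lra.
  exact: Rmult_le_compat_l.
have b5 : 0 <= Q1 * dot z z by apply: Rmult_le_pos; lra.
have := Rle_abs (- (2 * omega s0 t0)); rewrite Rabs_Ropp => b6.
rewrite /Q2; lra.
Qed.

End Modulus.

Unset Implicit Arguments.

Theorem theorem1p2 (n : nat) (u : ('I_n -> R) -> R -> R) (g : ('I_n -> R) -> R)
  (omega : R -> R -> R) :
  ES_solution u ->
  (forall x, u x 0 = g x) ->
  (forall x eps, 0 < eps -> exists del, 0 < del /\
     forall y, vnorm (vsub y x) < del -> Rabs (g y - g x) < eps) ->
  (exists S c, 0 < S /\ forall x, S <= vnorm x -> g x = c) ->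
  is_omega u omega ->
  omega_subsolution omega.
Proof.
move=> [hsub hsup] _ _ _ hom.
exact: omega_subsolution_of_jsub (ES_sub_jsub hsub) (ES_super_jsub hsup) hom.
Qed.
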